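(* Let $S_{g,n}$ be a compact oriented topological surface of genus $g\ge0$ with $n\ge1$ holes, and let $\mathcal D=\{V,E,F\}$ be a finite polygonal cellular decomposition of $S_{g,n}$ with $V=V^{\partial}\sqcup V^{\circ}$, $V^{\circ}=\{v_1,\dots,v_N\}$. Let $\hat{\mathbf k}:V^{\partial}\to\mathbb R_+$ and let $\hat{\mathbf T}:V^{\circ}\to\mathbb R_+$ be such that for every nonempty $Q\subset V^{\circ}$, $$\sum_{v\in Q}\hat{\mathbf T}(v)<\sum_{f\in F_Q}\pi\min\{N(f,Q),N(f)-2\},$$ where $F_Q$ is the set of faces having a vertex in $Q$, $N(f)=\#V(f)$, $N(f,Q)=\#(V(f)\cap Q)$. Let $\mathbf k^0:V\to\mathbb R_+$ be an arbitrary vector with $\mathbf k^0(w)=\hat{\mathbf k}(w)$ for all $w\in V^{\partial}$, and define $\mathbf k^m$ inductively by Thurston's algorithm: $\mathbf k^{m+1}(w)=\hat{\mathbf k}(w)$ for $w\in V^{\partial}$, and for each $i=1,\dots,N$, $\mathbf k^{m+1}(v_i)$ is the unique positive number $k_{v_i}^{m+1}$ such that $$\mathbf T_{(k^m_{v_1},\dots,k^m_{v_{i-1}},\,k^{m+1}_{v_i},\,k^m_{v_{i+1}},\dots,k^m_{v_N})}(v_i)=\hat{\mathbf T}(v_i),\qquad k^m_{v_j}=\mathbf k^m(v_j)$$ (boundary curvatures kept equal to $\hat{\mathbf k}$; all $N$ equations are solved independently with the other interior coordinates at their old values). Then $\mathbf k^m$ converges to $\mathbf k^*$, where $\mathbf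 k^*:V\to\mathbb R_+$ is the geodesic curvature vector of the unique generalized hyperbolic conical circle packing associated with $\mathcal D$ satisfying $$\mathbf k^*(w)=\hat{\mathbf k}(w)\ (w\in V^{\partial}),\qquad \mathbf T_{\mathbf k^*}(v)=\hat{\mathbf T}(v)\ (v\in V^{\circ}).$$ Consequently, the packings $\mathcal P^m$ determined by $\mathbf k^m$ converge, up to isometry, to the packing determined by $\mathbf k^*$ (in the sense that their geodesic curvature vectors converge to $\mathbf k^*$).
   Context: Finite polygonal cellular decomposition: $\mathcal D=\{V,E,F\}$, where $V,E,F$ are finite collections of 0-, 1-, 2-cells on $S_{g,n}$ such that (I) each 0-cell is an endpoint of at least three 1-cells; (II) two 1-cells do not intersect except possibly at endpoints; (III) the boundary of each 2-cell consists of at least three 1-cells, two distinct 2-cells that intersect do so in a 1-cell (or a 0-cell), and the union of all 2-cells is $S_{g,n}$; (IV) every boundary component of $S_{g,n}$ contains at least three 0-cells. The 1-skeleton is a simple graph. $V^{\partial}$ is the set of vertices on $\partial S_{g,n}$, $V^{\circ}=V\setminus V^{\partial}$; $V(f)$ is the vertex set of the face $f$. $\mathbb R_+=(0,\infty)$. Generalized circles: a generalized circle in $\mathbb H^2$ is a hyperbolic circle (geodesic curvature $k>1$, radius $r=\operatorname{arccoth}k$), a horocycle ($k=1$, center an ideal point), or a hypercycle ($0<k<1$), i.e. a component of the set of points at distance $\operatorname{arctanh}k$ from a geodesic called its axis (regarded as its center). The total geodesic curvature of an arc of length $\ell$ is $T=k\ell$. Generalized circle configuration: cyclically ordered generalized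 circles $C_1,\dots,C_m$ ($m\ge3$) in $\mathbb H^2$ such that consecutive ones are externally tangent at one point, non-consecutive ones are disjoint and no three meet at a common point, the configuration bounds a convex region with nonempty interior (compact apart from possible ideal vertices at centers of horocycles), and there is a hyperbolic circle $C_P$ (the dual circle) of curvature $k_P>1$ containing all tangency points and perpendicular to all $C_i$. It is known that for each $(k_1,\dots,k_m)\in\mathbb R_+^m$ there is a unique such configuration up to isometry with $C_i$ of curvature $k_i$; $k_P$ is determined by $\sum_i\theta_i=2\pi$ with $\theta_i\in(0,\pi)$, $\cot(\theta_i/2)=k_i/\sqrt{k_P^2-1}$. The interstice $\Omega_f$ is the region bounded by the arcs of $C_1,\dots,C_m$ between consecutive tangency points, lying inside $C_P$. Generalized hyperbolic conical circle packing associated with $\mathcal D$: a collection $\{C_v\}_{v\in V}$ such that, for each face $f$, the circles at the vertices of $f$ form a generalized circle configuration. Each $\mathbf k\in\mathbb R_+^{V}$ determines exactly one packing up to isometry, with $C_v$ of curvature $\mathbf k(v)$. For $v\in V(f)$ let $T_{v,f}$ be the total geodesic curvature of the side of $\Omega_f$ on $C_v$; then $\mathbf T_{\mathbf k}(v)=\sum_{f\ni v}T_{v,f}$. Explicitly, with $k=\mathbf k(v)$ and $k_P$ the dual curvature of $f$: $T_{v,f}=\frac{2k}{\sqrt{k^2-1}}\operatorname{arccot}\frac{k_P}{\sqrt{k^2-1}}$ if $k>1$; $2/k_P$ if $k=1$; $\frac{2k}{\sqrt{1-k^2}}\operatorname{arccoth}\frac{k_P}{\sqrt{1-k^2}}$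 if $0<k<1$. In $\mathbf T_{(k_{v_1},\dots,k_{v_N})}(v_i)$ only interior curvatures are displayed; boundary curvatures are $\hat{\mathbf k}$. Under the stated condition on $\hat{\mathbf T}$ the packing with curvature vector $\mathbf k^*$ exists and is unique. *)

(* Defs.v *)
From HB Require Import structures.
From mathcomp Require Import all_boot all_order all_algebra.
From mathcomp Require Import all_classical all_reals all_analysis.
Set Implicit Arguments.
Unset Strict Implicit.
Unset Printing Implicit Defensive.
Import Order.TTheory GRing.Theory Num.Theory.
Import numFieldNormedType.Exports.
Local Open Scope ring_scope.

(** * Cellular decompositions of S_{g,n}

   The decomposed surface is encoded by a combinatorial map.  A dart is an
   oriented 1-cell; [rev] reverses it, and [next d] is the dart following [d]
   on the boundary of the region to the left of [d].  The orbits of [next] are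
   the 2-cells and the [n] boundary circles of the surface (each circle being
   traversed with the removed disc on its left); the orbits of [next \o rev]
   are the stars of the 0-cells.  Two 1-cells can only meet at end points, and
   the surface is oriented, by construction of the model. *)

Record decomposition (g n : nat) := Decomposition {
  dart : finType;
  vert : finType;
  face : finType;
  rev : dart -> dart;
  next : dart -> dart;
  org : dart -> vert;
  left_side : dart -> face + 'I_n;
  (* an arbitrary side of each face, used only to enumerate its corners *)
  side0 : face -> dart;
  side0P : forall f, left_side (side0 f) = inl f;
  revK : involutive rev;
  rev_neq : forall d, rev d != d;
  next_inj : injective next;
  orgP : forall d d', (org d == org d') = fconnect (next \o rev) d d';
  left_sideP : forall d d',
    (left_side d == left_side d') = fconnect next d d';
  dart_connected : forall d d',
    connect [rel x y | (y == rev x) || (y == next x)] d d';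
  (* #V - #E + #F = 2 - 2g - n; the 1-cells are the orbits of [rev] *)
  euler_char : (#|vert| + #|face| + n + 2 * g = 2 + fcard rev dart)%N;
  (* the boundary components are pairwise disjoint simple closed curves *)
  hole_simple : forall d d' h h', left_side d = inr h -> left_side d' = inr h' ->
    org d = org d' -> d = d';
  (* the 1-skeleton is a simple graph *)
  no_loop : forall d, org (rev d) != org d;
  no_multi : forall d d', org d = org d' -> org (rev d) = org (rev d') -> d = d';
  vert_degree : forall v, (3 <= #|[set d | org d == v]|)%N;
  face_sides : forall f, (3 <= #|[set d | left_side d == inl f]|)%N;
  (* a closed 2-cell is an embedded polygon, so that its number of sides is its
     number of vertices *)
  face_embedded : forall d d' f, left_side d = inl f -> left_side d' = inl f ->
    org d = org d' -> d = d';
  (* two distinct closed 2-cells share nothing, a 0-cell, or a closed 1-cell *)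
  face_inter : forall f f', f != f' ->
    let W := [set org d | d in [set d | left_side d == inl f]] :&:
             [set org d | d in [set d | left_side d == inl f']] in
    (#|W| <= 1)%N \/
    exists d, [/\ left_side d = inl f, left_side (rev d) = inl f' &
                  W = [set org d; org (rev d)]];
  faces_cover : forall d, exists f, left_side d = inl f \/ left_side (rev d) = inl f;
  hole_sides : forall h,
    (3 <= #|[set org d | d in [set d | left_side d == inr h]]|)%N
}.

Section Combinatorics.
Variables (g n : nat) (D : decomposition g n).

Definition bdry_verts : {set vert D} :=
  [set v | [exists d, (org d == v) && ~~ is_inl (left_side d)]].

Definition int_verts : {set vert D} := ~: bdry_verts.

Definition face_verts (f : face D) : {set vert D} :=
  [set org d | d in [set d | left_side d == inl f]].

Definition corner (f : face D) (i : 'I_#|face_verts f|) : vert D :=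
  org (iter i (@next _ _ D) (side0 f)).

Definition faces_at (Q : {set vert D}) : {set face D} :=
  [set f | face_verts f :&: Q != finset.set0].

End Combinatorics.

(** * The hyperbolic plane: upper sheet of the hyperboloid in R^{1,2} *)

Local Open Scope classical_set_scope.

Section Hyperbolic.
Variable R : realType.
Implicit Types x y : 'rV[R]_3.

Definition cosh (r : R) : R := (expR r + expR (- r)) / 2.
Definition sinh (r : R) : R := (expR r - expR (- r)) / 2.

(* The distance of two points x, y of the plane satisfies
   cosh (d(x, y)) = mink x y. *)
Definition mink x y : R :=
  x ord0 0 * y ord0 0 - x ord0 1 * y ord0 1 - x ord0 2%R * y ord0 2%R.

Definition hyp x : Prop := mink x x = 1 /\ 0 < x ord0 0.

Definition isometry (A : 'M[R]_3) : Prop :=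
  (forall x y, mink (x *m A) (y *m A) = mink x y) /\
  (forall x, hyp x -> hyp (x *m A)).

(* [Circle c r] has center c and radius r.  [Horocycle p] is centered at the
   ideal point given by the null ray of p; rescaling p gives the other
   horocycles with this center.  [Hypercycle u d] has as axis the geodesic
   {x | mink x u = 0}, and is the component of the points at distance d from it
   lying on the side mink x u > 0: there mink x u is the sinh of the distance
   of x to the axis. *)
Inductive gcircle :=
  | Circle of 'rV[R]_3 & R
  | Horocycle of 'rV[R]_3
  | Hypercycle of 'rV[R]_3 & R.

Definition gcircle_wf (C : gcircle) : Prop :=
  match C with
  | Circle c r => hyp c /\ 0 < r
  | Horocycle p => mink p p = 0 /\ 0 < p ord0 0
  | Hypercycle u d => mink u u = -1 /\ 0 < d
  end.

Definition curvature (C : gcircle) : R :=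
  match C with
  | Circle _ r => cosh r / sinh r
  | Horocycle _ => 1
  | Hypercycle _ d => sinh d / cosh d
  end.

Definition pole (C : gcircle) : 'rV[R]_3 :=
  match C with Circle c _ => c | Horocycle p => p | Hypercycle u _ => u end.

Definition level (C : gcircle) : R :=
  match C with Circle _ r => cosh r | Horocycle _ => 1 | Hypercycle _ d => sinh d end.

Definition on_gcircle (C : gcircle) x : Prop := mink x (pole C) = level C.

(* The closed convex side of C: it contains the center, or the axis. *)
Definition in_gcircle (C : gcircle) x : Prop := mink x (pole C) <= level C.

Definition ext_tangent_at (C C' : gcircle) t : Prop :=
  [/\ hyp t, on_gcircle C t, on_gcircle C' t &
      forall x, hyp x -> in_gcircle C x -> in_gcircle C' x -> x = t].

(* At a point x of C, this vector is tangent to the plane and normal to C. *)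
Definition normal (C : gcircle) x : 'rV[R]_3 := pole C - mink (pole C) x *: x.

Definition perpendicular (C C' : gcircle) : Prop :=
  forall x, hyp x -> on_gcircle C x -> on_gcircle C' x ->
    mink (normal C x) (normal C' x) = 0.

(** * Generalized circle configurations *)

(* [tang i] is the tangency point of [circ i] and [circ (ordS i)], the indices
   being cyclic.  [Circle dual_center dual_radius] is the dual circle. *)
Record configuration (m : nat) := Configuration {
  circ : 'I_m -> gcircle;
  tang : 'I_m -> 'rV[R]_3;
  dual_center : 'rV[R]_3;
  dual_radius : R
}.

Section Configuration.
Variables (m : nat) (K : configuration m).

Definition dual_circle : gcircle := Circle (dual_center K) (dual_radius K).

(* The tangency points are met in the order of their indices when running once
   around the dual circle. *)
Definition cyclic_order : Prop :=
  exists (e1 e2 : 'rV[R]_3) (phi : 'I_m -> R),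
  let o := dual_center K in let r := dual_radius K in
  [/\ [/\ mink e1 e1 = -1, mink e2 e2 = -1, mink e1 e2 = 0,
          mink o e1 = 0 & mink o e2 = 0],
      forall i, tang K i =
        cosh r *: o + sinh r *: (cos (phi i) *: e1 + sin (phi i) *: e2),
      forall i j : 'I_m, (i < j)%N -> phi i < phi j &
      forall i j, phi j < phi i + pi * 2].

(* The polygon bounded by the configuration.  Its sides are the axes of the
   hypercycles and the geodesics orthogonal to two consecutive circles at their
   tangency point t, i.e. joining their centers; such a geodesic is tangent
   at t to the dual circle.  In terms of the center o and radius r of the
   latter, it has normal o - cosh r *: t. *)
Definition region x : Prop :=
  [/\ hyp x,
      forall i, mink x (dual_center K - cosh (dual_radius K) *: tang K i) <= 0 &
      forall i u d, circ K i = Hypercycle u d -> 0 <= mink x u].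

Definition region_nonempty_interior : Prop :=
  exists x eps, [/\ hyp x, 0 < eps &
    forall y, hyp y -> mink x y < cosh eps -> region y].

(* The region is closed, so it suffices to bound the distances to a point. *)
Definition region_compact_off_ideal_vertices : Prop :=
  exists M : R, forall x, region x ->
    (forall i p, circ K i = Horocycle p -> ~ in_gcircle (circ K i) x) ->
    mink x (dual_center K) <= M.

Definition is_configuration : Prop :=
  [/\ [/\ (3 <= m)%N, forall i, gcircle_wf (circ K i) & gcircle_wf dual_circle],
      [/\ forall i, ext_tangent_at (circ K i) (circ K (ordS i)) (tang K i),
          forall i j x, j != i -> j != ordS i -> i != ordS j -> hyp x ->
            on_gcircle (circ K i) x -> ~ on_gcircle (circ K j) x &
          forall i j l x, i != j -> j != l -> i != l -> hyp x ->
            on_gcircle (circ K i) x -> on_gcircle (circ K j) x ->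
            ~ on_gcircle (circ K l) x],
      [/\ forall i, on_gcircle dual_circle (tang K i),
          forall i, perpendicular dual_circle (circ K i) & cyclic_order],
      region_nonempty_interior & region_compact_off_ideal_vertices].

(* [gamma] is an arc-length parametrization of the side of the interstice
   on [circ K i]: the arc of this circle between its two tangency points that
   lies inside the dual circle.  [ell] is thus the length of this side. *)
Definition side_length (i : 'I_m) (ell : R) : Prop :=
  0 < ell /\
  exists gamma dgamma : R -> 'rV[R]_3,
  [/\ gamma 0 = tang K (ord_pred i) /\ gamma ell = tang K i,
      forall s, 0 <= s <= ell ->
        [/\ hyp (gamma s), on_gcircle (circ K i) (gamma s) &
            in_gcircle dual_circle (gamma s)],
      forall s j, 0 <= s <= ell ->
        is_derive s 1 (fun s' => gamma s' ord0 j) (dgamma s ord0 j),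
      forall j, {within `[0, ell], continuous (fun s => dgamma s ord0 j)} &
      forall s, 0 <= s <= ell -> mink (dgamma s) (dgamma s) = -1].

End Configuration.

Definition isometric_configuration m (K K' : configuration m) : Prop :=
  exists A : 'M[R]_3, isometry A /\
    forall i x, hyp x ->
      on_gcircle (circ K i) x <-> on_gcircle (circ K' i) (x *m A).

(** * Circle packings *)

Section Packing.
Variables (g n : nat) (D : decomposition g n).

(* Each face is developed into the hyperbolic plane.  The circles at a vertex v
   in the faces around v all have curvature [pcurv v]; the gluing of the faces,
   in general a conical hyperbolic surface, is determined by these data. *)
Record packing := Packing {
  pcurv : vert D -> R;
  pconf : forall f : face D, configuration #|face_verts f|;
  pconfP : forall f, is_configuration (pconf f);
  pcurvP : forall f i, curvature (circ (pconf f) i) = pcurv (corner i)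
}.

Definition isometric_packing (P P' : packing) : Prop :=
  forall f, isometric_configuration (pconf P f) (pconf P' f).

(* [t] is the total geodesic curvature of [P] at [v].  The corners of a face are
   distinct: the inner sum has one term if v is a vertex of f, and none
   otherwise. *)
Definition packing_total_curv (P : packing) (v : vert D) (t : R) : Prop :=
  exists ell : forall f : face D, 'I_#|face_verts f| -> R,
    (forall f i, side_length (pconf P f) i (ell f i)) /\
    t = \sum_(f : face D) \sum_(i | corner i == v) pcurv P v * ell f i.

(* T_k(v) = t *)
Definition total_curv (k : vert D -> R) (v : vert D) (t : R) : Prop :=
  exists P : packing, pcurv P =1 k /\ packing_total_curv P v t.

Definition update (k : vert D -> R) (v : vert D) (t : R) : vert D -> R :=
  fun w => if w == v then t else k w.

Definition admissible (khat k : vert D -> R) : Prop :=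
  (forall v, 0 < k v) /\ (forall w, w \in bdry_verts D -> k w = khat w).

(* [khat] and [That] are only relevant on the boundary, resp. interior,
   vertices. *)
Definition realizes (khat That : vert D -> R) (P : packing) : Prop :=
  (forall w, w \in bdry_verts D -> pcurv P w = khat w) /\
  (forall v, v \in int_verts D -> packing_total_curv P v (That v)).

Definition thurston_sequence (khat That : vert D -> R)
    (k : nat -> vert D -> R) : Prop :=
  [/\ admissible khat (k 0%N),
      forall m, admissible khat (k m.+1) &
      forall m v, v \in int_verts D ->
        total_curv (update (k m) v (k m.+1 v)) v (That v)].

Definition packing_cvg (P : nat -> packing) (Q : packing) : Prop :=
  forall v, (fun m => pcurv (P m) v) @ \oo --> pcurv Q v.

End Packing.
End Hyperbolic.

(* Main.v *)
Require Import Defs.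
From HB Require Import structures.
From mathcomp Require Import all_boot all_order all_algebra.
From mathcomp Require Import all_classical all_reals all_analysis.
From mathcomp Require Import ring lra.
Import Order.TTheory GRing.Theory Num.Theory.
Import numFieldNormedType.Exports.
Set Implicit Arguments.
Unset Strict Implicit.
Unset Printing Implicit Defensive.
Local Open Scope classical_set_scope.
Local Open Scope ring_scope.

(* Normalize the pole of a generalized circle of curvature [k] so that it becomes
   a vector [n] with [<n, n> = k^2 - 1]; the circle then is [<x, n> = k] in all
   three cases.  In an orthonormal frame at the centre of the dual circle, of
   radius [arsinh s], a configuration is determined by the tangency angles, whose
   gaps are [2 (pi/2 - atan (k_i s))]; their sum being [2 pi] determines [s].
   The slope of the arc of curvature [k] seen from its pole obeys a Riccati
   equation, and integration gives the total geodesic curvature [2 A(k, k s)], where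
   [A(k, z)] is the integral over [0, z] of [1 / ((1 + y^2) sqrt (1 + y^2 / k^2))].

   [A] increases in both arguments, and multiplying all curvatures by [l] leaves
   the products [k_i s] unchanged.  Hence the total curvature at [v] increases with
   [k v], decreases with the other curvatures, and increases under homothety.
   Monotonicity yields a maximum principle, so uniqueness; it also makes one step
   of the algorithm an increasing operator.  Started from small curvatures the
   iterates increase, and if some of them, at the vertices of [Q] say, were
   unbounded, the total curvatures on [Q] would in the limit reach the bound
   excluded by the hypothesis; so they converge to a solution [k*].  Finally any
   sequence produced by the algorithm is squeezed between the monotone iterates
   started from [l k*] and [k* / l], both of which converge to [k*]. *)

(** * Derivatives and the half curvature of a side *)

(** The dual radius is defined only implicitly, so its dependence on the curvatures is controlled by
    order and homogeneity. If two curvature vectors agree up to a factor [l] at every vertex, so do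
    their dual radii, and the total curvatures agree up to [l ^+ 3]. This estimate takes the place
    of continuity, both in solving equations and in passing to limits. The minimum in the hypothesis
    reflects two ways in which a face reacts when the curvatures grow on [Q]. If the dual radius
    stays away from 0, each vertex of [Q] contributes nearly pi. If it shrinks, the terms of the
    other vertices become negligible, and the fixed angle sum forces the vertices of [Q] to
    contribute together nearly pi (N(f) - 2). On the geometric side, incidence with two tangency
    points and perpendicularity to the dual circle determine a pole only up to a sign: the wrong
    sign is an arc subtending the supplementary half angle. It is excluded because consecutive
    closed convex sides meet in a single point. *)

Section Derivatives.
Variable R : realType.
Implicit Types (f g df : R -> R) (a b x y : R).

(* [is_derive] is a class: this alias keeps instance resolution from choosing
   the form of the derivative. *)
Definition has_deriv f x a := is_derive x 1 f a.

Lemma has_deriv_eq f x a b : has_deriv f x a -> a = b -> is_derive x 1 f b.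
Proof. by move=> ? <-. Qed.

Lemma derC c x : has_deriv (fun=> c) x 0.
Proof. exact: is_derive_cst. Qed.

Lemma derI x : has_deriv (fun y => y) x 1.
Proof. exact: is_derive_id. Qed.

Lemma derD f g x a b : has_deriv f x a -> has_deriv g x b ->
  has_deriv (fun y => f y + g y) x (a + b).
Proof. by move=> ha hb; exact: is_deriveD. Qed.

Lemma derN f x a : has_deriv f x a -> has_deriv (fun y => - f y) x (- a).
Proof. by move=> ha; exact: is_deriveN. Qed.

Lemma derM f g x a b : has_deriv f x a -> has_deriv g x b ->
  has_deriv (fun y => f y * g y) x (f x * b + g x * a).
Proof. by move=> ha hb; exact: is_deriveM. Qed.

Lemma derV f x a : f x != 0 -> has_deriv f x a ->
  has_deriv (fun y => (f y)^-1) x (- (f x) ^- 2 * a).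
Proof. by move=> h ha; exact: is_deriveV. Qed.

Lemma derX f n x a : has_deriv f x a ->
  has_deriv (fun y => f y ^+ n.+1) x (n.+1%:R * f x ^+ n * a).
Proof.
move=> ha; have -> : (fun y => f y ^+ n.+1) = f ^+ n.+1.
  by apply/funext => y; rewrite exprfctE.
exact: is_deriveX.
Qed.

Lemma der_atan f x a : has_deriv f x a ->
  has_deriv (fun y => atan (f y)) x ((1 + f x ^+ 2)^-1 * a).
Proof. by move=> ha; exact: (@is_derive1_comp R (@atan R) f). Qed.

Lemma der_sin f x a : has_deriv f x a ->
  has_deriv (fun y => sin (f y)) x (cos (f x) * a).
Proof. by move=> ha; exact: (@is_derive1_comp R (@sin R) f). Qed.

Lemma der_cos f x a : has_deriv f x a ->
  has_deriv (fun y => cos (f y)) x (- sin (f x) * a).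
Proof. by move=> ha; exact: (@is_derive1_comp R (@cos R) f). Qed.

Lemma der_expR f x a : has_deriv f x a ->
  has_deriv (fun y => expR (f y)) x (expR (f x) * a).
Proof. by move=> ha; exact: (@is_derive1_comp R (@expR R) f). Qed.

Lemma der_ln f x a : 0 < f x -> has_deriv f x a ->
  has_deriv (fun y => ln (f y)) x ((f x)^-1 * a).
Proof.
move=> h ha; apply: (@is_derive1_comp R (@ln R) f) => //.
exact: is_derive1_ln.
Qed.

Lemma der_sqrt f x a : 0 < f x -> has_deriv f x a ->
  has_deriv (fun y => Num.sqrt (f y)) x ((2 * Num.sqrt (f x))^-1 * a).
Proof.
move=> h ha; apply: (@is_derive1_comp R (@Num.sqrt R) f) => //.
exact: is_derive1_sqrt.
Qed.

Lemma der_within_continuous f df a b :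
  (forall x, a <= x <= b -> is_derive x 1 f (df x)) ->
  {within `[a, b], continuous f}.
Proof.
move=> h; apply: derivable_within_continuous => x; rewrite in_itv /= => hx.
by case: (h _ hx).
Qed.

Lemma mvt f df a b : a < b ->
  (forall x, a <= x <= b -> is_derive x 1 f (df x)) ->
  exists2 c, a < c < b & f b - f a = df c * (b - a).
Proof.
move=> ab h.
have [x||c] := @MVT R f df a b ab; last by rewrite in_itv; exists c.
  by rewrite in_itv /= => /andP[ax xb]; apply: h; rewrite !ltW.
exact: der_within_continuous h.
Qed.

Lemma le_increment f df g dg a b : a <= b ->
  (forall x, a <= x <= b -> is_derive x 1 f (df x)) ->
  (forall x, a <= x <= b -> is_derive x 1 g (dg x)) ->
  (forall x, a < x < b -> df x <= dg x) -> f b - f a <= g b - g a.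
Proof.
rewrite le_eqVlt => /predU1P[-> _ _ _|ab df_ dg_ le]; first by rewrite !subrr.
have hD x : a <= x <= b -> is_derive x 1 (fun y => g y - f y) (dg x - df x).
  by move=> hx; apply: derD; [exact: dg_|apply: derN; exact: df_].
have [c cab e] := mvt ab hD.
have : 0 <= (dg c - df c) * (b - a).
  by rewrite mulr_ge0// subr_ge0 ?le// ltW.
by rewrite -e; lra.
Qed.

Lemma lt_increment f df g dg a b : a < b ->
  (forall x, a <= x <= b -> is_derive x 1 f (df x)) ->
  (forall x, a <= x <= b -> is_derive x 1 g (dg x)) ->
  (forall x, a < x < b -> df x < dg x) -> f b - f a < g b - g a.
Proof.
move=> ab df_ dg_ lt.
have hD x : a <= x <= b -> is_derive x 1 (fun y => g y - f y) (dg x - df x).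
  by move=> hx; apply: derD; [exact: dg_|apply: derN; exact: df_].
have [c cab e] := mvt ab hD.
have : 0 < (dg c - df c) * (b - a).
  by rewrite mulr_gt0// subr_gt0 ?lt.
by rewrite -e; lra.
Qed.

End Derivatives.

Ltac der := repeat first
  [ exact: derC | exact: derI | apply: derD | apply: derN | apply: derX
  | apply: derM | apply: derV | apply: der_atan | apply: der_sin | apply: der_cos
  | apply: der_expR | apply: der_ln | apply: der_sqrt ].

Section TotalCurvature.
Variable R : realType.
Implicit Types k x z l : R.

(** The primitive vanishing at 0 of [1 / (1 + (k ^+ 2 - 1) * x ^+ 2)], in its trigonometric,
    hyperbolic (artanh written as a logarithm) and linear forms. At x = 1 / k_P,
    [2 * k * half_arc k x] is the explicit formula for the total geodesic curvature of a side. *)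
Definition half_arc k x : R :=
  if 1 < k then let b := Num.sqrt (k ^+ 2 - 1) in atan (b * x) / b
  else if k < 1 then
    let b := Num.sqrt (1 - k ^+ 2) in ln ((1 + b * x) / (1 - b * x)) / (2 * b)
  else x.

Lemma half_arc0 k : half_arc k 0 = 0.
Proof.
rewrite /half_arc; case: ifP => _ /=; first by rewrite mulr0 atan0 mul0r.
by case: ifP => _ //=; rewrite mulr0 addr0 subr0 divr1 ln1 mul0r.
Qed.

Lemma half_arc_den k x : 0 < k -> -1 < x < 1 -> 0 < 1 + (k ^+ 2 - 1) * x ^+ 2.
Proof.
move=> k0 /andP[x1 x2]; have : 0 < (1 - x) * (1 + x) by rewrite mulr_gt0; lra.
have : 0 <= k ^+ 2 * x ^+ 2 by rewrite mulr_ge0 ?sqr_ge0.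
by lra.
Qed.

Lemma is_derive_half_arc k x : 0 < k -> -1 < x < 1 ->
  is_derive x 1 (half_arc k) (1 + (k ^+ 2 - 1) * x ^+ 2)^-1.
Proof.
move=> k0 hx; have den := half_arc_den k0 hx.
rewrite /half_arc; case: (ltrgtP 1 k) => [k1|k1|<-] /=; last first.
- have -> : (1 + (1 ^+ 2 - 1) * x ^+ 2)^-1 = 1 :> R.
    by rewrite expr1n subrr mul0r addr0 invr1.
  exact: derI.
- have b2 : 0 < 1 - k ^+ 2 by nra.
  set b := Num.sqrt _; have b0 : 0 < b by rewrite sqrtr_gt0.
  have bE : b ^+ 2 = 1 - k ^+ 2 by rewrite sqr_sqrtr// ltW.
  have b1 : b < 1 by nra.
  case/andP: hx => x1 x2.
  have hp : 0 < 1 + b * x by nra.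
  have hm : 0 < 1 - b * x by nra.
  apply: has_deriv_eq; first by der; rewrite ?gt_eqF ?divr_gt0.
  have : 1 + (k ^+ 2 - 1) * x ^+ 2 = (1 + b * x) * (1 - b * x) by nra.
  by move=> ->; field; rewrite !gt_eqF.
- have b2 : 0 < k ^+ 2 - 1 by rewrite subr_gt0 exprn_egt1.
  set b := Num.sqrt _; have b0 : 0 < b by rewrite sqrtr_gt0.
  have bE : b ^+ 2 = k ^+ 2 - 1 by rewrite sqr_sqrtr// ltW.
  apply: has_deriv_eq; first by der; rewrite gt_eqF.
  have bn : b != 0 by rewrite gt_eqF.
  have d0 : 1 + (b * x) ^+ 2 != 0 by rewrite gt_eqF// ltr_wpDr// sqr_ge0.
  by rewrite -bE -exprMn; field; rewrite bn d0.
Qed.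

(* With z = k s, where s is the hyperbolic sine of the radius of the dual
   circle, this is half the total geodesic curvature of a side: the argument
   of [half_arc] is the hyperbolic tangent of that radius. *)
Definition half_curv k z : R := k * half_arc k (z / Num.sqrt (k ^+ 2 + z ^+ 2)).

Definition half_curv' k z : R := k / ((1 + z ^+ 2) * Num.sqrt (k ^+ 2 + z ^+ 2)).

Lemma half_curv_arg k z : 0 < k -> -1 < z / Num.sqrt (k ^+ 2 + z ^+ 2) < 1.
Proof.
move=> k0; have d0 : 0 < k ^+ 2 + z ^+ 2 by have := sqr_ge0 z; nra.
have r0 : 0 < Num.sqrt (k ^+ 2 + z ^+ 2) by rewrite sqrtr_gt0.
have rE : Num.sqrt (k ^+ 2 + z ^+ 2) ^+ 2 = k ^+ 2 + z ^+ 2 by rewrite sqr_sqrtr// ltW.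
by rewrite ltr_pdivlMr// ltr_pdivrMr//; apply/andP; split; nra.
Qed.

Lemma is_derive_half_curv k z : 0 < k ->
  is_derive z 1 (half_curv k) (half_curv' k z).
Proof.
move=> k0; have d0 : 0 < k ^+ 2 + z ^+ 2 by have := sqr_ge0 z; nra.
have r0 : 0 < Num.sqrt (k ^+ 2 + z ^+ 2) by rewrite sqrtr_gt0.
have rE : Num.sqrt (k ^+ 2 + z ^+ 2) ^+ 2 = k ^+ 2 + z ^+ 2 by rewrite sqr_sqrtr// ltW.
have hx := half_curv_arg z k0.
rewrite /half_curv; apply: has_deriv_eq.
  apply: derM; first exact: derC.
  apply: (@is_derive1_comp R (half_arc k)); first exact: is_derive_half_arc.
  by der; rewrite ?gt_eqF//.
rewrite /= mulr0 addr0.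
have dd := half_arc_den k0 hx; move: dd; rewrite /half_curv'.
set r := Num.sqrt _ in r0 rE *.
have rn : r != 0 by rewrite gt_eqF.
have h2 : 1 + z ^+ 2 != 0 by rewrite gt_eqF//; have := sqr_ge0 z; lra.
have -> : 1 + (k ^+ 2 - 1) * (z / r) ^+ 2 = (k ^+ 2 * (1 + z ^+ 2)) / r ^+ 2.
  by rewrite rE; field: rE; rewrite -rE expf_neq0.
move=> _; have {}rE : z ^+ 2 = r ^+ 2 - k ^+ 2 by rewrite rE; ring.
(* The derivative of z / r, as r^2 - z^2 = k^2. *)
rewrite [X in k * (_ * X)](_ : _ = k ^+ 2 / r ^+ 3); last first.
  transitivity ((r ^+ 2 - z ^+ 2) / r ^+ 3); first by field.
  by rewrite rE; congr (_ / _); ring.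
by field; rewrite rn h2 gt_eqF.
Qed.

Lemma half_curv0 k : half_curv k 0 = 0.
Proof. by rewrite /half_curv mul0r half_arc0 mulr0. Qed.

Lemma half_curv'_gt0 k z : 0 < k -> 0 < half_curv' k z.
Proof.
move=> k0; rewrite divr_gt0// mulr_gt0//; first by have := sqr_ge0 z; lra.
by rewrite sqrtr_gt0; have := sqr_ge0 z; nra.
Qed.

End TotalCurvature.

(** * Monotonicity, scaling and limits of the half curvature *)

Section HalfCurv.
Variable R : realType.
Implicit Types k x z l : R.

Lemma hypot_gt0 k z : 0 < k -> 0 < Num.sqrt (k ^+ 2 + z ^+ 2).
Proof. by move=> k0; rewrite sqrtr_gt0; have := sqr_ge0 z; nra. Qed.

Lemma hypot_sqr k z : Num.sqrt (k ^+ 2 + z ^+ 2) ^+ 2 = k ^+ 2 + z ^+ 2.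
Proof. by rewrite sqr_sqrtr// addr_ge0// sqr_ge0. Qed.

Lemma oneDsqr_gt0 z : 0 < 1 + z ^+ 2.
Proof. by have := sqr_ge0 z; lra. Qed.

Lemma half_curv'E k z :
  half_curv' k z = k / Num.sqrt (k ^+ 2 + z ^+ 2) * (1 + z ^+ 2)^-1.
Proof. by rewrite /half_curv' invfM mulrCA mulrC. Qed.

Lemma hypot_ratio_lt k l z : 0 < k -> k < l -> z != 0 ->
  k / Num.sqrt (k ^+ 2 + z ^+ 2) < l / Num.sqrt (l ^+ 2 + z ^+ 2).
Proof.
move=> k0 kl z0; have l0 := lt_trans k0 kl.
have rk := hypot_gt0 z k0; have rl := hypot_gt0 z l0.
rewrite ltr_pdivrMr// mulrAC ltr_pdivlMr//.
rewrite -(@ltr_pXn2r _ 2)// ?nnegrE ?mulr_ge0 ?ltW// !exprMn !hypot_sqr.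
have zz : 0 < z ^+ 2 by rewrite exprn_even_gt0.
have -> : k ^+ 2 * (l ^+ 2 + z ^+ 2) = k ^+ 2 * l ^+ 2 + k ^+ 2 * z ^+ 2 by ring.
have -> : l ^+ 2 * (k ^+ 2 + z ^+ 2) = k ^+ 2 * l ^+ 2 + l ^+ 2 * z ^+ 2 by ring.
by rewrite ltrD2l ltr_pM2r// ltr_pXn2r// ?nnegrE ltW.
Qed.

Lemma hypot_ratio_le1 k z : 0 < k -> k / Num.sqrt (k ^+ 2 + z ^+ 2) <= 1.
Proof.
move=> k0; have rk := hypot_gt0 z k0; rewrite ler_pdivrMr// mul1r.
rewrite -(@ler_pXn2r _ 2)// ?nnegrE ?(ltW k0) ?(ltW rk)// hypot_sqr.
by have := sqr_ge0 z; lra.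
Qed.

Lemma half_curv'_le k z : 0 < k -> half_curv' k z <= (1 + z ^+ 2)^-1.
Proof.
move=> k0; rewrite half_curv'E ler_piMl ?hypot_ratio_le1//.
by rewrite invr_ge0 ltW// oneDsqr_gt0.
Qed.

Lemma half_curv'_nincr k x z : 0 < k -> 0 <= x -> x <= z ->
  half_curv' k z <= half_curv' k x.
Proof.
move=> k0 x0 xz; have z0 := le_trans x0 xz.
have sq : x ^+ 2 <= z ^+ 2 by rewrite ler_pXn2r// nnegrE.
have rx := hypot_gt0 x k0.
rewrite /half_curv' ler_pM2l// lef_pV2 ?posrE ?mulr_gt0 ?oneDsqr_gt0 ?hypot_gt0//.
apply: ler_pM; [exact/ltW/oneDsqr_gt0|exact: ltW|by rewrite lerD2l|].
by rewrite ler_sqrt ?lerD2l// addr_ge0 ?sqr_ge0.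
Qed.

Lemma der_atan1 z : is_derive z 1 (@atan R) (1 + z ^+ 2)^-1.
Proof. exact: is_derive1_atan. Qed.

Lemma der_scale (f df : R -> R) l z :
  is_derive z 1 f (df z) -> is_derive z 1 (fun y => l * f y) (l * df z).
Proof.
move=> h; apply: has_deriv_eq; first by apply: derM; [exact: derC|exact: h].
by rewrite mulr0 addr0.
Qed.

Lemma der_dilate (f df : R -> R) l z :
  is_derive (l * z) 1 f (df (l * z)) ->
  is_derive z 1 (fun y => f (l * y)) (l * df (l * z)).
Proof.
move=> h; rewrite mulrC; apply: (@is_derive1_comp R f ( *%R l)) => //.
have := @der_scale (fun y => y) (fun=> 1) l z (derI z).
by rewrite mulr1.
Qed.

Lemma half_curv_lt k x z : 0 < k -> x < z -> half_curv k x < half_curv k z.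
Proof.
move=> k0 xz; rewrite -subr_gt0 -(subrr (0 : R)).
apply: (@lt_increment _ (fun=> 0) (fun=> 0) _ (half_curv' k)) => // y _.
- exact: is_derive_half_curv.
- exact: half_curv'_gt0.
Qed.

Lemma half_curv_le k x z : 0 < k -> x <= z -> half_curv k x <= half_curv k z.
Proof. by move=> k0; rewrite le_eqVlt => /predU1P[->//|/(half_curv_lt k0)/ltW]. Qed.

Lemma half_curv_gt0 k z : 0 < k -> 0 < z -> 0 < half_curv k z.
Proof. by move=> k0 z0; rewrite -(half_curv0 k) half_curv_lt. Qed.

Lemma half_curv_le_atan k z : 0 < k -> 0 <= z -> half_curv k z <= atan z.
Proof.
move=> k0 z0; have -> : half_curv k z = half_curv k z - half_curv k 0.
  by rewrite half_curv0 subr0.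
have -> : atan z = atan z - atan 0 by rewrite atan0 subr0.
apply: (@le_increment _ _ (half_curv' k) _ (fun z => (1 + z ^+ 2)^-1)) => // y _.
- exact: is_derive_half_curv.
- exact: half_curv'_le.
Qed.

Lemma half_curv_incr k l z : 0 < k -> k < l -> 0 < z ->
  half_curv k z < half_curv l z.
Proof.
move=> k0 kl z0; have l0 := lt_trans k0 kl.
have -> : half_curv k z = half_curv k z - half_curv k 0.
  by rewrite half_curv0 subr0.
have -> : half_curv l z = half_curv l z - half_curv l 0.
  by rewrite half_curv0 subr0.
apply: (@lt_increment _ _ (half_curv' k) _ (half_curv' l)) => // y hy.
- exact: is_derive_half_curv.
- exact: is_derive_half_curv.
rewrite !half_curv'E ltr_pM2r ?invr_gt0 ?oneDsqr_gt0//.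
by apply: hypot_ratio_lt => //; case/andP: hy => hy _; rewrite gt_eqF.
Qed.

(** The integrand is at most multiplied by [l]. Together with the sublinearity in [z], which comes
    from the decrease of the integrand, this bounds the effect of any small distortion of the
    data. *)
Lemma half_curv_scale_curv k l z : 0 < k -> 1 <= l -> 0 <= z ->
  half_curv (l * k) z <= l * half_curv k z.
Proof.
move=> k0 l1 z0; have l0 : 0 < l by lra.
have lk0 : 0 < l * k by rewrite mulr_gt0.
have -> : half_curv (l * k) z = half_curv (l * k) z - half_curv (l * k) 0.
  by rewrite half_curv0 subr0.
have -> : l * half_curv k z = l * half_curv k z - l * half_curv k 0.
  by rewrite half_curv0 mulr0 subr0.
apply: (@le_increment _ _ (half_curv' (l * k)) (fun y => l * half_curv k y)
  (fun y => l * half_curv' k y)) => // y hy.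
- exact: is_derive_half_curv.
- exact/der_scale/is_derive_half_curv.
rewrite /half_curv' mulrA ler_pM2l// lef_pV2 ?posrE ?mulr_gt0 ?oneDsqr_gt0 ?hypot_gt0//.
rewrite ler_pM2l ?oneDsqr_gt0// ler_sqrt; last by rewrite addr_ge0 ?sqr_ge0.
by rewrite lerD2r ler_pXn2r ?nnegrE ?(ltW k0) ?(ltW lk0)// ler_peMl// ltW.
Qed.

Lemma half_curv_scale_arg k l z : 0 < k -> 1 <= l -> 0 <= z ->
  half_curv k (l * z) <= l * half_curv k z.
Proof.
move=> k0 l1 z0; have l0 : 0 < l by lra.
have -> : half_curv k (l * z) = half_curv k (l * z) - half_curv k (l * 0).
  by rewrite mulr0 half_curv0 subr0.
have -> : l * half_curv k z = l * half_curv k z - l * half_curv k 0.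
  by rewrite half_curv0 mulr0 subr0.
apply: (@le_increment _ (fun y => half_curv k (l * y))
  (fun y => l * half_curv' k (l * y)) (fun y => l * half_curv k y)
  (fun y => l * half_curv' k y)) => // y hy.
- exact/der_dilate/is_derive_half_curv.
- exact/der_scale/is_derive_half_curv.
case/andP: hy => /ltW y0 _.
by rewrite ler_pM2l// half_curv'_nincr// ler_peMl.
Qed.

Lemma atan_le_id z : 0 <= z -> atan z <= z.
Proof.
move=> z0; have -> : atan z = atan z - atan 0 by rewrite atan0 subr0.
rewrite -[leRHS]subr0.
apply: (@le_increment _ _ (fun z => (1 + z ^+ 2)^-1) (fun y => y) (fun=> 1)) => // y _.
- by rewrite invf_le1 ?oneDsqr_gt0// lerDl sqr_ge0.
Qed.

Lemma atan_scale l z : 1 <= l -> 0 <= z -> atan (l * z) <= l * atan z.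
Proof.
move=> l1 z0; have l0 : 0 < l by lra.
have -> : atan (l * z) = atan (l * z) - atan (l * 0) by rewrite mulr0 atan0 subr0.
have -> : l * atan z = l * atan z - l * atan 0 by rewrite atan0 mulr0 subr0.
apply: (@le_increment _ (fun y => atan (l * y))
  (fun y => l * (1 + (l * y) ^+ 2)^-1) (fun y => l * atan y)
  (fun y => l * (1 + y ^+ 2)^-1)) => // y hy.
- exact/(@der_dilate _ (fun z => (1 + z ^+ 2)^-1)).
case/andP: hy => /ltW y0 _.
rewrite ler_pM2l// lef_pV2 ?posrE ?oneDsqr_gt0// lerD2l.
by rewrite ler_pXn2r ?nnegrE ?mulr_ge0 ?(ltW l0)// ler_peMl.
Qed.

(** Cut the integral at [s], the square root of [k]. Up to [s] it is at most atan s <= s. Beyond [s]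
    the factor k / sqrt (k^2 + y^2) is at most [s], which leaves at most s * atan z < 2 s. The bound
    is uniform in [z], hence independent of the other curvatures of a face. *)
Lemma half_curv_small k z : 0 < k -> 0 <= z -> half_curv k z <= 3 * Num.sqrt k.
Proof.
move=> k0 z0; set s := Num.sqrt k.
have s0 : 0 < s by rewrite sqrtr_gt0.
have sE : s ^+ 2 = k by rewrite sqr_sqrtr// ltW.
have As : half_curv k s <= s.
  by rewrite (le_trans (half_curv_le_atan _ _))// ?atan_le_id// ltW.
have [zs|/ltW sz] := leP z s.
  by rewrite (le_trans (half_curv_le k0 zs))// (le_trans As)//; lra.
have : half_curv k z - half_curv k s <= s * atan z - s * atan s.
  apply: (@le_increment _ _ (half_curv' k) (fun y => s * atan y)
    (fun y => s * (1 + y ^+ 2)^-1)) => // y hy.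
  - exact: is_derive_half_curv.
  rewrite half_curv'E ler_pM2r ?invr_gt0 ?oneDsqr_gt0// ler_pdivrMr ?hypot_gt0//.
  rewrite -{1}sE expr2 ler_pM2l// -(@ler_pXn2r _ 2)// ?nnegrE ?(ltW s0) ?sqrtr_ge0//.
  rewrite hypot_sqr; case/andP: hy => hy _.
  have := sqr_ge0 k; have : s ^+ 2 <= y ^+ 2 by rewrite ler_pXn2r ?nnegrE ?(ltW s0) ?(ltW hy) ?(ltW (lt_trans s0 hy)).
  by lra.
have a2 : atan z < 2 by rewrite (lt_trans (atan_ltpi2 _)) ?pihalf_lt2.
have a1 : 0 <= atan s by rewrite -(@atan0 R) le_atan// ltW.
by nra.
Qed.

Lemma atan_large (e : R) : 0 < e -> exists2 z0, 0 < z0 & pi / 2 - e < atan z0.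
Proof.
move=> e0; have := @cvgy_atan R; move/cvgrPdist_lt => /(_ e e0) [M [_ hM]].
exists (Num.max (M + 1) 1); first by rewrite lt_max ltr01 orbT.
have /hM : M < Num.max (M + 1) 1 by rewrite lt_max ltrDl ltr01.
move=> /=; rewrite ltr_norml => /andP[_]; lra.
Qed.

(** The convergence to [atan] for large [k] is uniform in [z]: the difference is at most z / k,
    which is good up to a point [w] with atan w > pi / 2 - e / 2; beyond [w] neither function can
    still grow by more than the error allowed. *)
Lemma half_curv_large (e : R) : 0 < e -> exists2 k0, 0 < k0 &
  forall k z, k0 <= k -> 0 <= z -> atan z - e <= half_curv k z.
Proof.
move=> e0; have e2 : 0 < e / 2 by lra.
have [w w0 hw] := atan_large e2.
exists (w / (e / 2)); first by rewrite divr_gt0.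
move=> k z kw z0; have k0 : 0 < k by rewrite (lt_le_trans _ kw)// divr_gt0.
have wk : w / k <= e / 2 by rewrite ler_pdivrMr// mulrC -ler_pdivrMr.
have close y : 0 <= y -> atan y - half_curv k y <= y / k.
  move=> y0; have -> : atan y - half_curv k y =
      (atan y - half_curv k y) - (atan 0 - half_curv k 0).
    by rewrite atan0 half_curv0 !subr0.
  have -> : y / k = k^-1 * y - k^-1 * 0 by rewrite mulr0 subr0 mulrC.
  apply: (@le_increment _ (fun y => atan y - half_curv k y)
    (fun y => (1 + y ^+ 2)^-1 - half_curv' k y) (fun y => k^-1 * y)
    (fun y => k^-1 * 1)) => // x hx.
  - by apply: derD; [exact: der_atan1|apply: derN; exact: is_derive_half_curv].
  case/andP: hx => x0 _.
  have r0 := hypot_gt0 x k0; have d0 := oneDsqr_gt0 x.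
  rewrite half_curv'E mulr1 -[X in X - _]mul1r -mulrBl ler_pdivrMr//.
  have : Num.sqrt (k ^+ 2 + x ^+ 2) <= k + x.
    rewrite -(@ler_pXn2r _ 2)// ?nnegrE ?sqrtr_ge0 ?hypot_sqr//; last by lra.
    by have := mulr_gt0 k0 x0; lra.
  set r := Num.sqrt _ in r0 * => rkx.
  have : 1 - k / r <= x / k.
    rewrite lerBlDr -lerBlDl ler_pdivlMr// mulrBl mul1r mulrAC.
    rewrite lerBlDr -lerBlDl ler_pdivlMr//; nra.
  move/le_trans; apply; rewrite mulrC ler_pM2l ?invr_gt0//.
  by have := sqr_ge0 (x - 1); lra.
have [zw|wz] := leP z w.
  have := close z z0; have : z / k <= w / k by rewrite ler_pM2r ?invr_gt0.
  by lra.
have := close w (ltW w0); have := half_curv_le k0 (ltW wz); have := atan_ltpi2 z.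
lra.
Qed.

End HalfCurv.

(** * Thurston's algorithm on a hypergraph *)

Section Scaling.
Variable R : realType.
Implicit Types (a b c d l x y t : R) (f : R -> R).

Lemma cube_between c d : 0 < c -> c < d -> exists2 l, 1 < l & l ^+ 3 * c <= d.
Proof.
(* The constant is 7 = 3 + 3 + 1: for e <= 1, (1 + e)^3 <= 1 + 7 e. *)
move=> c0 cd; set e := Num.min 1 ((d - c) / (7 * c)).
have e0 : 0 < e by rewrite lt_min ltr01 divr_gt0// ?subr_gt0// mulr_gt0.
have e1 : e <= 1 by rewrite ge_min lexx.
have : e <= (d - c) / (7 * c) by rewrite ge_min lexx orbT.
rewrite ler_pdivlMr ?mulr_gt0// => h.
exists (1 + e); first by lra.
have : (1 + e) ^+ 3 <= 1 + 7 * e.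
  have ee : e ^+ 2 <= e by rewrite expr2 ler_piMl// ltW.
  have eee : e ^+ 3 <= e by rewrite exprS (le_trans _ ee)// expr2 ler_pM2l// expr2 ler_piMl// ltW.
  by nra.
move=> /(ler_wpM2r (ltW c0)); nra.
Qed.

Lemma le_of_cubes c d : 0 < d -> (forall l, 1 < l -> c <= l ^+ 3 * d) -> c <= d.
Proof.
move=> d0 h; rewrite leNgt; apply/negP => dc.
have dm : d < (d + c) / 2 by lra.
have [l l1 hl] := cube_between d0 dm.
by have := h l l1; lra.
Qed.

(** An intermediate value theorem without continuity: a nondecreasing positive function growing at
    most cubically under dilations has no jumps, so that the supremum of the points where f <= y is
    a root. *)
Lemma scaling_root f a b y :
  (forall x, 0 < x -> 0 < f x) ->
  (forall x z, 0 < x -> x <= z -> f x <= f z) ->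
  (forall l x, 1 <= l -> 0 < x -> f (l * x) <= l ^+ 3 * f x) ->
  0 < a -> 0 < b -> f a <= y -> y <= f b -> exists2 t, 0 < t & f t = y.
Proof.
move=> f0 fi fs a0 b0 fa fb.
(* If b <= a, then y <= f b <= f a <= y. *)
have [ba|/ltW ab] := leP b a.
  exists a => //; apply/eqP; rewrite eq_le fa (le_trans fb)//; exact: fi.
pose E := [set x | a <= x <= b /\ f x <= y].
have Ea : E a by split=> //; rewrite lexx.
have Eb : ubound E b by move=> x [/andP[]].
have hE : has_sup E by split; [exists a|exists b].
set t := sup E.
have ta : a <= t by exact: sup_upper_bound hE _ Ea.
have tb : t <= b by apply: ge_sup; [exists a|].
have t0 : 0 < t by exact: lt_le_trans a0 ta.
have y0 : 0 < y by exact: lt_le_trans (f0 _ a0) fa.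
exists t => //; apply/eqP; rewrite eq_le; apply/andP; split; rewrite leNgt; apply/negP.
- move=> yft; have ym : y < (y + f t) / 2 by lra.
  have [l l1 hl] := cube_between y0 ym.
  have l0 : 0 < l by lra.
  have tl : t / l < t by rewrite ltr_pdivrMr// ltr_pMr.
  suff : t <= t / l by rewrite leNgt tl.
  apply: ge_sup; first by exists a.
  move=> x [/andP[ax xb] fx]; rewrite leNgt; apply/negP => tlx.
  have x0 : 0 < x by exact: lt_le_trans ax.
  have : f t <= l ^+ 3 * f x.
    apply: le_trans (fs l x (ltW l1) x0); apply: fi => //.
    by rewrite mulrC -ler_pdivrMr// ltW.
  have : l ^+ 3 * f x <= l ^+ 3 * y by rewrite ler_pM2l// exprn_gt0.
  lra.
- move=> fty; have ym : f t < (y + f t) / 2 by lra.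
  have [l l1 hl] := cube_between (f0 t t0) ym.
  have l0 : 0 < l by lra.
  have flt : f (l * t) < y.
    have := fs l t (ltW l1) t0; lra.
  have tl : t < l * t by rewrite ltr_pMl.
  suff : l * t <= t by rewrite leNgt tl.
  apply: (sup_upper_bound hE); split; last exact: ltW.
  rewrite (le_trans ta (ltW tl)) /= leNgt; apply/negP => /ltW blt.
  by have := fi _ _ b0 blt; lra.
Qed.

End Scaling.

(** * Dual radii and total curvatures *)

Section Hypergraph.
Variables (R : realType) (V F : finType) (fv : F -> {set V}).
Hypothesis fv_ge3 : forall f, (3 <= #|fv f|)%N.
Implicit Types (k : V -> R) (s t l : R) (f : F) (v w : V).

Definition curvatures k := forall v, 0 < k v.

Definition angle_sum f k s : R := \sum_(w in fv f) atan (k w * s).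

(** The half angles pi / 2 - atan at the N vertices must add up to pi, so the arctangents add up to
    N pi / 2 - pi. *)
Definition angle_target f : R := (#|fv f| - 2)%:R * (pi / 2).

(* The hyperbolic sine of the radius of the dual circle of [f]: since
   [k_P^2 - 1 = s^-2], the angles [theta / 2] are the [pi / 2 - atan (k w * s)]. *)
Definition dual f k : R :=
  xget 0 [set s | 0 < s /\ angle_sum f k s = angle_target f].

Definition total k v : R :=
  \sum_(f | v \in fv f) 2 * half_curv (k v) (k v * dual f k).

Lemma pihalf_gt0 : 0 < pi / 2 :> R.
Proof. by have := pi_gt0 R; lra. Qed.

Lemma angle_sum_lt f k s t : curvatures k -> s < t -> angle_sum f k s < angle_sum f k t.
Proof.
move=> k0 st; have : (0 < #|fv f|)%N by rewrite (leq_trans _ (fv_ge3 f)).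
rewrite /angle_sum => /card_gt0P [v vf].
rewrite (bigD1 v)//= [X in _ < X](bigD1 v)//= ltr_leD//.
  by apply: lt_atan; rewrite ltr_pM2l.
by apply: ler_sum => w _; apply: le_atan; rewrite ler_pM2l// ltW.
Qed.

Lemma dual_exists f k : curvatures k ->
  exists s, 0 < s /\ angle_sum f k s = angle_target f.
Proof.
move=> k0; have N3 := fv_ge3 f; have ph := pihalf_gt0.
have [v0 v0f] : exists v, v \in fv f.
  by apply/card_gt0P; rewrite (leq_trans _ N3).
have fs_ge1 : 1 <= (#|fv f| - 2)%:R :> R by rewrite ler1n subn_gt0.
suff [s s0 e] : exists2 s, 0 < s & angle_sum f k s = angle_target f by exists s.
pose K := \sum_(w in fv f) k w; pose L := \sum_(w in fv f) (k w)^-1.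
have ge_term (g : V -> R) v : (forall w, 0 < g w) -> v \in fv f ->
    g v <= \sum_(w in fv f) g w.
  move=> g0 vf; rewrite (bigD1 v)//= lerDl sumr_ge0// => w _; exact: ltW.
have K0 : 0 < K by rewrite (lt_le_trans (k0 v0))// ge_term.
have iv w : 0 < (k w)^-1 by rewrite invr_gt0.
have e0 : 0 < pi / #|fv f|%:R :> R.
  by rewrite divr_gt0 ?pi_gt0// ltr0n (leq_trans _ N3).
have [z z0 hz] := atan_large e0.
have L0 : 0 < L by rewrite (lt_le_trans (iv v0))// (ge_term (fun w => (k w)^-1)).
(* At the lower end, atan y <= y bounds the sum by pi / 2, which is at most the target since N >= 3.
   At the upper end, k w * L >= 1 for every w, so each term is at least atan z > pi / 2 - pi / N. *)
apply: (@scaling_root _ _ (pi / 2 / K) (L * z)).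
- move=> x x0; rewrite /angle_sum (bigD1 v0)//= ltr_pwDl//.
    by rewrite -(@atan0 R) lt_atan// mulr_gt0.
  by apply: sumr_ge0 => w _; rewrite -(@atan0 R) le_atan// mulr_ge0// ltW.
- by move=> x y x0; rewrite le_eqVlt => /predU1P[->//|/(angle_sum_lt f k0)/ltW].
- move=> l x l1 x0; rewrite /angle_sum mulr_sumr; apply: ler_sum => w _.
  have a0 : 0 <= atan (k w * x) by rewrite -(@atan0 R) le_atan// mulr_ge0// ltW.
  rewrite mulrCA (le_trans (atan_scale l1 _))// ?mulr_ge0 ?(ltW (k0 w)) ?(ltW x0)//.
  by rewrite ler_wpM2r// ler_eXnr.
- by rewrite divr_gt0.
- by rewrite mulr_gt0.
- rewrite /angle_sum (@le_trans _ _ (\sum_(w in fv f) k w * (pi / 2 / K)))//.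
    apply: ler_sum => w _; apply: atan_le_id.
    by rewrite ltW// mulr_gt0// divr_gt0.
  rewrite -mulr_suml -/K mulrCA divff ?gt_eqF// mulr1 /angle_target.
  by rewrite ler_peMl// ltW.
- rewrite /angle_target /angle_sum.
  apply: (@le_trans _ _ (\sum_(w in fv f) (pi / 2 - pi / #|fv f|%:R))).
    rewrite big_const iter_addr addr0 -[leRHS]mulr_natl natrB; last by rewrite ltnW.
    have n0 : #|fv f|%:R != 0 :> R by rewrite pnatr_eq0 -lt0n (leq_trans _ N3).
    by rewrite le_eqVlt; apply/orP; left; apply/eqP; field.
  apply: ler_sum => w wf; rewrite (le_trans (ltW hz))// le_atan//.
  rewrite mulrA ler_peMl ?(ltW z0)// -ler_pdivrMl// mulr1.
  exact: (ge_term (fun w => (k w)^-1)).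
Qed.

Lemma dualP f k : curvatures k -> 0 < dual f k /\ angle_sum f k (dual f k) = angle_target f.
Proof. by move=> /(dual_exists f); exact: xgetPex. Qed.

Lemma dual_gt0 f k : curvatures k -> 0 < dual f k.
Proof. by move=> /(dualP f)[]. Qed.

Lemma dual_uniq f k s : curvatures k -> angle_sum f k s = angle_target f -> s = dual f k.
Proof.
move=> k0 es; have [_ ed] := dualP f k0.
by apply/eqP; case: ltgtP => // /(angle_sum_lt f k0); rewrite es ed ltxx.
Qed.

Lemma dual_anti f k k' : curvatures k -> (forall w, k w <= k' w) ->
  dual f k' <= dual f k.
Proof.
move=> k0 kk'; have k'0 : curvatures k' by move=> v; exact: lt_le_trans (kk' v).
rewrite leNgt; apply/negP => /(angle_sum_lt f k'0); rewrite (dualP f k'0).2.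
rewrite -(dualP f k0).2 ltNge => /negP; apply; apply: ler_sum => w _.
by rewrite le_atan// ler_wpM2r// ltW// dual_gt0.
Qed.

Lemma curvatures_scale k l : curvatures k -> 0 < l -> curvatures (fun v => l * k v).
Proof. by move=> k0 l0 v; rewrite mulr_gt0. Qed.

Lemma dual_scale f k l : curvatures k -> 0 < l ->
  dual f (fun v => l * k v) = dual f k / l.
Proof.
move=> k0 l0; apply/esym/dual_uniq; first exact: curvatures_scale.
rewrite -(dualP f k0).2; apply: eq_bigr => w _; congr atan.
by field; rewrite gt_eqF.
Qed.

Lemma total_gt0 k v f : curvatures k -> v \in fv f -> 0 < total k v.
Proof.
move=> k0 vf; have pos g : 0 < 2 * half_curv (k v) (k v * dual g k).
  by rewrite mulr_gt0// half_curv_gt0// mulr_gt0// dual_gt0.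
rewrite /total (bigD1 f)//= ltr_pwDl// sumr_ge0// => g _; exact: ltW.
Qed.

(** The dual radius parameter of [k'] is at least that of [l * k], namely [dual f k / l]; hence
    [k' v * dual f k'] is at least [k v * dual f k], and the first argument of [half_curv] has grown
    too. This makes dilated solutions barriers for the algorithm. *)
Lemma total_le_scale k k' l v : curvatures k -> curvatures k' -> 1 <= l ->
  (forall w, k' w <= l * k w) -> k' v = l * k v -> total k v <= total k' v.
Proof.
move=> k0 k'0 l1 kk' kv; have l0 : 0 < l by lra.
apply: ler_sum => f vf; rewrite ler_pM2l//.
apply: (@le_trans _ _ (half_curv (k v) (k' v * dual f k'))).
  apply: half_curv_le => //; have := dual_anti f k'0 kk'.
  rewrite dual_scale// ler_pdivrMr// kv => h.
  by rewrite -mulrA [l * _]mulrC -mulrA ler_pM2l// [l * _]mulrC -mulrC mulrC.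
have : k v <= k' v by rewrite kv ler_peMl// ltW.
rewrite le_eqVlt => /predU1P[->//|h].
by rewrite ltW// half_curv_incr// mulr_gt0// dual_gt0.
Qed.

(* Multiplying all curvatures by [l] divides [dual] by [l], so that the
   products [k v * dual f k] are unchanged, while [half_curv] increases
   with its first argument. *)
Lemma total_lt_scale k k' l v f : curvatures k -> curvatures k' -> 1 < l ->
  (forall w, k' w <= l * k w) -> k' v = l * k v -> v \in fv f ->
  total k v < total k' v.
Proof.
move=> k0 k'0 l1 kk' kv vf; have l0 : 0 < l by lra.
have h g : half_curv (k v) (k v * dual g k) < half_curv (k' v) (k' v * dual g k').
  apply: (@le_lt_trans _ _ (half_curv (k v) (k' v * dual g k'))).
    apply: half_curv_le => //; have := dual_anti g k'0 kk'.
    rewrite dual_scale// ler_pdivrMr// kv => h.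
    by rewrite -mulrA [l * _]mulrC -mulrA ler_pM2l// [l * _]mulrC -mulrC mulrC.
  by rewrite half_curv_incr ?mulr_gt0 ?dual_gt0// kv ltr_pMl.
rewrite /total (bigD1 f)//= [X in _ < X](bigD1 f)//= ltr_leD ?ltr_pM2l//.
by apply: ler_sum => g _; rewrite ler_pM2l// ltW.
Qed.

Lemma total_anti k k' v : curvatures k -> (forall w, k w <= k' w) -> k' v = k v ->
  total k' v <= total k v.
Proof.
move=> k0 kk' kv; apply: ler_sum => f vf; rewrite ler_pM2l// kv.
by apply: half_curv_le => //; rewrite ler_pM2l// dual_anti.
Qed.

(** The parameter [dual] changes by a factor of at most [l], so the second argument of [half_curv]
    grows by at most [l ^+ 2] and the first by at most [l]; sublinearity in each argument gives the
    cube. *)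
Lemma total_close k k' l v : curvatures k -> curvatures k' -> 1 <= l ->
  (forall w, k' w <= l * k w) -> (forall w, k w <= l * k' w) ->
  total k' v <= l ^+ 3 * total k v.
Proof.
move=> k0 k'0 l1 h1 h2; have l0 : 0 < l by lra.
rewrite /total mulr_sumr; apply: ler_sum => f vf; rewrite [leRHS]mulrCA ler_pM2l//.
have dk := dual_gt0 f k0; have dk' := dual_gt0 f k'0.
have zz : 0 <= k v * dual f k by rewrite mulr_ge0// ltW.
have dd : dual f k' <= l * dual f k.
  by have := dual_anti f k0 h2; rewrite dual_scale// ler_pdivrMr// mulrC.
have zz' : k' v * dual f k' <= l ^+ 2 * (k v * dual f k).
  by rewrite expr2 mulrACA; apply: ler_pM => //; exact: ltW.
have l2 : 1 <= l ^+ 2 by rewrite exprn_ege1.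
apply: (@le_trans _ _ (half_curv (l * k v) (l ^+ 2 * (k v * dual f k)))).
  apply: (@le_trans _ _ (half_curv (k' v) (l ^+ 2 * (k v * dual f k)))).
    exact: half_curv_le.
  have := h1 v; rewrite le_eqVlt => /predU1P[->//|h].
  by rewrite ltW// half_curv_incr// !mulr_gt0// exprn_gt0.
have z2 : 0 <= l ^+ 2 * (k v * dual f k) by rewrite mulr_ge0 ?sqr_ge0.
rewrite (le_trans (half_curv_scale_curv (k0 v) l1 z2))//.
rewrite (exprS l 2) -[leRHS]mulrA ler_pM2l//; exact: half_curv_scale_arg.
Qed.

(** The bound involves no curvature but [k v], so a small value there can be chosen without knowing
    the others. The constant is 6 = 2 * 3. *)
Lemma total_small k v : curvatures k ->
  total k v <= 6 * #|F|%:R * Num.sqrt (k v).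
Proof.
move=> k0; have s0 : 0 <= 6 * Num.sqrt (k v) by rewrite mulr_ge0 ?sqrtr_ge0.
apply: (@le_trans _ _ (\sum_(f | v \in fv f) 6 * Num.sqrt (k v))).
  apply: ler_sum => f _.
  have z0 : 0 <= k v * dual f k by rewrite ltW// mulr_gt0// dual_gt0.
  by have := half_curv_small (k0 v) z0; lra.
rewrite big_const iter_addr addr0 mulrAC -[leLHS]mulr_natr ler_wpM2l//.
by rewrite ler_nat max_card.
Qed.

Definition replace k v t : V -> R := fun w => if w == v then t else k w.

Lemma curvatures_replace k v t : curvatures k -> 0 < t -> curvatures (replace k v t).
Proof. by move=> k0 t0 w; rewrite /replace; case: ifP. Qed.

Lemma replaceE k v t : replace k v t v = t.
Proof. by rewrite /replace eqxx. Qed.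

(* Raising [k v] lowers the dual radius, hence the angles at the other vertices,
   hence raises the angle at [v], the sum of the angles being fixed. *)
Lemma total_replace_lt k v f s t : curvatures k -> 0 < s -> s < t -> v \in fv f ->
  total (replace k v s) v < total (replace k v t) v.
Proof.
move=> k0 s0 st vf; have t0 := lt_trans s0 st.
have ks := curvatures_replace v k0 s0; have kt := curvatures_replace v k0 t0.
have le_st w : replace k v s w <= replace k v t w.
  by rewrite /replace; case: ifP => // _; exact: ltW.
have h g : v \in fv g -> half_curv s (s * dual g (replace k v s)) <
    half_curv t (t * dual g (replace k v t)).
  move=> vg; have ds := dual_gt0 g ks; have dt := dual_gt0 g kt.
  apply: (@le_lt_trans _ _ (half_curv s (t * dual g (replace k v t)))); last first.
    by rewrite half_curv_incr// mulr_gt0.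
  apply: half_curv_le => //; rewrite leNgt; apply/negP => /lt_atan lt_v.
  have := (dualP g ks).2; rewrite -(dualP g kt).2 => /eqP; rewrite eq_sym lt_eqF//.
  rewrite /angle_sum (bigD1 v)//= [X in _ < X](bigD1 v)//= !replaceE.
  apply: ltr_leD => //; apply: ler_sum => w /andP[_ wv]; rewrite le_atan//.
  rewrite /replace (negbTE wv) ler_pM2l//; exact: dual_anti.
rewrite /total (bigD1 f)//= [X in _ < X](bigD1 f)//= !replaceE ltr_leD ?ltr_pM2l ?h//.
by apply: ler_sum => g /andP[vg _]; rewrite ler_pM2l// ltW// h.
Qed.

(** Two regimes, separated by r = d / B. If the dual parameter is at least [r], large curvatures on
    [Q] bring each arctangent there close to pi / 2. If it is at most [r], each vertex outside [Q]
    contributes at most [d] to the angle sum, so the vertices of [Q] carry almost all of it. *)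
Lemma blowup_face f (Q : {set V}) (B e : R) : 0 < B -> 0 < e ->
  exists2 K, 0 < K & forall k, curvatures k ->
    (forall w, w \notin Q -> k w <= B) -> (forall w, w \in Q -> K <= k w) ->
    pi * (minn #|fv f :&: Q| (#|fv f| - 2))%:R - e <=
    \sum_(v in fv f :&: Q) 2 * half_curv (k v) (k v * dual f k).
Proof.
move=> B0 e0; set N := #|fv f|; set NQ := #|fv f :&: Q|.
have N3 : (3 <= N)%N := fv_ge3 f.
have N0 : 0 < N%:R :> R by rewrite ltr0n (leq_trans _ N3).
have NQN : (NQ <= N)%N by rewrite subset_leq_card// finset.subsetIl.
(* Replacing [half_curv] by [atan] costs at most 2 N d, and so does either regime. *)
set d := e / (4 * N%:R).
have d0 : 0 < d by rewrite divr_gt0// mulr_gt0.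
have [K1 K10 hK1] := half_curv_large d0.
have [z z0 hz] := atan_large d0.
set r := d / B; have r0 : 0 < r by rewrite divr_gt0.
exists (Num.max K1 (z / r)); first by rewrite lt_max K10.
move=> k k0 hB hK; set s := dual f k.
have s0 : 0 < s := dual_gt0 f k0.
have step1 : \sum_(v in fv f :&: Q) 2 * (atan (k v * s) - d) <=
    \sum_(v in fv f :&: Q) 2 * half_curv (k v) (k v * s).
  apply: ler_sum => v; rewrite finset.in_setI => /andP[_ vQ]; rewrite ler_pM2l//.
  apply: hK1; last by rewrite mulr_ge0// ltW.
  by rewrite (le_trans _ (hK v vQ))// le_max lexx.
apply: le_trans step1; rewrite -mulr_sumr sumrB big_const iter_addr addr0 -/NQ.
have de : e = 4 * (N%:R * d) by rewrite /d; field; rewrite gt_eqF.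
have NQd : d *+ NQ <= N%:R * d by rewrite -mulr_natl ler_pM2r// ler_nat.
have pi0 := pi_gt0 R.
have [rs|/ltW sr] := leP r s.
- have : \sum_(v in fv f :&: Q) (pi / 2 - d) <= \sum_(v in fv f :&: Q) atan (k v * s).
    apply: ler_sum => v; rewrite finset.in_setI => /andP[_ vQ].
    rewrite (le_trans (ltW hz))// le_atan//.
    have : z / r <= k v by rewrite (le_trans _ (hK v vQ))// le_max lexx orbT.
    rewrite ler_pdivrMr// => /le_trans; apply; rewrite ler_pM2l//.
  rewrite big_const iter_addr addr0 -/NQ -mulr_natl => h.
  have : pi * (minn NQ (N - 2))%:R <= pi * NQ%:R :> R.
    by rewrite ler_pM2l// ler_nat geq_minl.
  rewrite -mulr_natl in NQd *; lra.
- have := (dualP f k0).2; rewrite /angle_sum /angle_target -/N -/s.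
  rewrite (big_setID Q)/= => es.
  have : \sum_(v in fv f :\: Q) atan (k v * s) <= \sum_(v in fv f :\: Q) d.
    apply: ler_sum => v; rewrite finset.in_setD => /andP[vQ _].
    rewrite (le_trans (atan_le_id _)) ?mulr_ge0 ?(ltW (k0 v)) ?(ltW s0)//.
    have : s * B <= d by rewrite -ler_pdivlMr.
    apply: le_trans; rewrite [leRHS]mulrC ler_pM2r//; exact: hB.
  rewrite big_const iter_addr addr0 -mulr_natl => h1.
  have h2 : #|fv f :\: Q|%:R * d <= N%:R * d.
    by rewrite ler_pM2r// ler_nat subset_leq_card// finset.subsetDl.
  have : pi * (minn NQ (N - 2))%:R <= pi * (N - 2)%:R :> R.
    by rewrite ler_pM2l// ler_nat geq_minr.
  lra.
Qed.

Lemma sum_total k (Q : {set V}) : \sum_(v in Q) total k v =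
  \sum_(f | fv f :&: Q != finset.set0)
    \sum_(v in fv f :&: Q) 2 * half_curv (k v) (k v * dual f k).
Proof.
rewrite /total (exchange_big_dep (fun f => fv f :&: Q != finset.set0))/=.
  by apply: eq_bigr => f _; apply: eq_bigl => v; rewrite finset.in_setI andbC.
by move=> v f vQ vf; apply/finset.set0Pn; exists v; rewrite finset.in_setI vf.
Qed.

Lemma blowup (Q : {set V}) (B T : R) : 0 < B ->
  T < \sum_(f | fv f :&: Q != finset.set0)
        pi * (minn #|fv f :&: Q| (#|fv f| - 2))%:R ->
  exists2 K, 0 < K & forall k, curvatures k ->
    (forall w, w \notin Q -> k w <= B) -> (forall w, w \in Q -> K <= k w) ->
    T < \sum_(v in Q) total k v.
Proof.
move=> B0; set S := \sum_(f | _) _ => TS.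
have n0 : 0 < #|F|.+1%:R :> R by rewrite ltr0n.
(* A loss of [e] on at most #|F| faces leaves at least T + e, which keeps the inequality strict. *)
set e := (S - T) / #|F|.+1%:R; have e0 : 0 < e by rewrite divr_gt0// subr_gt0.
have h f : exists K, 0 < K /\ forall k, curvatures k ->
    (forall w, w \notin Q -> k w <= B) -> (forall w, w \in Q -> K <= k w) ->
    pi * (minn #|fv f :&: Q| (#|fv f| - 2))%:R - e <=
    \sum_(v in fv f :&: Q) 2 * half_curv (k v) (k v * dual f k).
  by have [K K0 hK] := blowup_face f Q B0 e0; exists K.
have [K hK] := boolp.choice h.
have K0 f : 0 < K f := (hK f).1.
exists (1 + \sum_f K f); first by rewrite ltr_pwDl// sumr_ge0// => f _; exact: ltW.
move=> k k0 hB hQ; rewrite sum_total.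
have : S - e * #|F|%:R <= \sum_(f | fv f :&: Q != finset.set0)
    \sum_(v in fv f :&: Q) 2 * half_curv (k v) (k v * dual f k).
  apply: (@le_trans _ _ (\sum_(f | fv f :&: Q != finset.set0)
      (pi * (minn #|fv f :&: Q| (#|fv f| - 2))%:R - e))).
    rewrite sumrB big_const iter_addr addr0 lerD2l lerN2 -[leLHS]mulr_natr ler_pM2l//.
    by rewrite ler_nat max_card.
  apply: ler_sum => f _; apply: (hK f).2 => // w wQ.
  apply: le_trans (hQ w wQ); rewrite (bigD1 f)//= addrCA lerDl addr_ge0// sumr_ge0//.
  by move=> g _; exact: ltW.
apply: lt_le_trans; have : S - T = e * #|F|.+1%:R by rewrite /e divfK// gt_eqF.
rewrite -natr1; lra.
Qed.

End Hypergraph.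

(** * Fixed points and convergence of the algorithm *)

Section Thurston.
Variables (R : realType) (V F : finType) (fv : F -> {set V}).
Hypothesis fv_ge3 : forall f, (3 <= #|fv f|)%N.
Variables (I : {set V}) (khat That : V -> R).
Hypothesis khat_gt0 : forall w, w \notin I -> 0 < khat w.
Hypothesis That_gt0 : forall v, v \in I -> 0 < That v.
Hypothesis That_lt : forall Q : {set V}, Q != finset.set0 -> Q \subset I ->
  \sum_(v in Q) That v <
  \sum_(f | fv f :&: Q != finset.set0)
    pi * (minn #|fv f :&: Q| (#|fv f| - 2))%:R.
Implicit Types (k : V -> R) (t l : R) (v w : V).
Local Notation total := (total fv).

(** For Q = {v}, a vertex on no face would make the upper bound an empty sum, against
    [That v > 0]. *)
Lemma interior_face v : v \in I -> exists f, v \in fv f.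
Proof.
move=> vI; have s1 : [set v]%SET \subset I by rewrite finset.sub1set.
have n1 : [set v]%SET != finset.set0 by apply/finset.set0Pn; exists v; rewrite finset.set11.
have := That_lt n1 s1; rewrite finset.big_set1.
have [//|nf] := pselect (exists f, v \in fv f).
rewrite big_pred0 => [|f]; first by rewrite ltNge ltW// That_gt0.
apply/negbTE/negPn/eqP/finset.setP => w; rewrite !inE.
by apply/negbTE/negP => /andP[wf /eqP wv]; apply: nf; exists f; rewrite -wv.
Qed.

Lemma solve_exists k v : curvatures k -> v \in I ->
  exists2 t, 0 < t & total (replace k v t) v = That v.
Proof.
move=> k0 vI; have [f0 vf0] := interior_face vI.
have s1 : [set v]%SET \subset I by rewrite finset.sub1set.
have n1 : [set v]%SET != finset.set0 by apply/finset.set0Pn; exists v; rewrite finset.set11.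
have := That_lt n1 s1; rewrite finset.big_set1.
have B0 : 0 < \sum_w k w.
  by rewrite (bigD1 v)//= ltr_pwDl// sumr_ge0// => w _; exact: ltW.
move=> /(blowup fv_ge3 B0) [K K0 hK].
have cr t : 0 < t -> curvatures (replace k v t) by exact: curvatures_replace.
have C0 : 0 < 6 * #|F|%:R :> R.
  by rewrite mulr_gt0// ltr0n; apply/card_gt0P; exists f0.
(* The value at which the bound of [total_small] equals [That v]. The other end [K] of the bracket
   is the blow-up bound for Q = {v}. *)
pose a := (That v / (6 * #|F|%:R)) ^+ 2.
have a0 : 0 < a by rewrite exprn_gt0// divr_gt0// That_gt0.
apply: (@scaling_root _ (fun t => total (replace k v t) v) a K) => //.
- by move=> x x0; apply: (total_gt0 fv_ge3 (cr x x0) vf0).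
- move=> x z x0; rewrite le_eqVlt => /predU1P[->//|xz].
  exact/ltW/(total_replace_lt fv_ge3 k0 x0 xz vf0).
- move=> l x l1 x0; have lx : 0 < l * x by rewrite mulr_gt0//; lra.
  apply: total_close => //; rewrite ?cr// => w; rewrite /replace; case: ifP => _ //.
  + by rewrite ler_peMl// ltW.
  + by apply: (@le_trans _ _ (l * x)); rewrite ler_peMl// ltW.
  + by rewrite ler_peMl// ltW.
- apply: (le_trans (total_small fv_ge3 v (cr a a0))).
  rewrite replaceE sqrtr_sqr ger0_norm; last by rewrite divr_ge0 ?ltW ?That_gt0.
  by rewrite mulrC divfK// gt_eqF.
- rewrite ltW//; have := hK _ (cr K K0); rewrite finset.big_set1; apply=> w; rewrite inE.
    by move=> wv; rewrite /replace (negbTE wv) (bigD1 w)//= lerDl sumr_ge0// => u _; exact: ltW.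
  by move=> /eqP ->; rewrite replaceE.
Qed.

(** Each equation is solved against the old vector [k]. A relation rather than a function, so that
    it applies to any given sequence of iterates. *)
Definition step k k' := [/\ curvatures k', forall v, v \notin I -> k' v = k v &
  forall v, v \in I -> total (replace k v (k' v)) v = That v].

Lemma total_replace_le_inj k v s t : curvatures k -> v \in I -> 0 < s -> 0 < t ->
  total (replace k v s) v <= total (replace k v t) v -> s <= t.
Proof.
move=> k0 vI s0 t0 h; rewrite leNgt; apply/negP => ts.
have [f vf] := interior_face vI.
by have := total_replace_lt fv_ge3 k0 t0 ts vf; rewrite ltNge h.
Qed.

Lemma solve_unique k v s t : curvatures k -> v \in I -> 0 < s -> 0 < t ->
  total (replace k v s) v = total (replace k v t) v -> s = t.
Proof.
move=> k0 vI s0 t0 e; apply/eqP; rewrite eq_le; apply/andP.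
by split; apply: (total_replace_le_inj k0 vI) => //; rewrite e.
Qed.

Lemma step_exists k : curvatures k -> exists k', step k k'.
Proof.
move=> k0; have h v : exists t, 0 < t /\
    (if v \in I then total (replace k v t) v = That v else t = k v).
  have [vI|vI] := boolP (v \in I); last by exists (k v).
  by have [t t0 e] := solve_exists k0 vI; exists t.
have [k' hk'] := boolp.choice h; exists k'; split=> v; first by have [] := hk' v.
  by move=> vI; have [_] := hk' v; rewrite (negbTE vI).
by move=> vI; have [_] := hk' v; rewrite vI.
Qed.

Lemma replace_id k v : replace k v (k v) = k.
Proof. by apply/funext => w; rewrite /replace; case: eqP => [->|]. Qed.

Lemma total_replace_anti k1 k2 v t : curvatures k1 -> 0 < t ->
  (forall w, k1 w <= k2 w) -> total (replace k2 v t) v <= total (replace k1 v t) v.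
Proof.
move=> k10 t0 h; apply: total_anti => //; last by rewrite !replaceE.
  exact: curvatures_replace.
by move=> w; rewrite /replace; case: ifP.
Qed.

(** Larger curvatures at the other vertices lower the total curvature at [w], so a larger value at
    [w] is needed to reach [That w]. *)
Lemma step_mono k1 k1' k2 k2' : curvatures k1 -> curvatures k2 ->
  step k1 k1' -> step k2 k2' -> (forall w, k1 w <= k2 w) ->
  forall w, k1' w <= k2' w.
Proof.
move=> k10 k20 [p1 b1 e1] [p2 b2 e2] h w.
have [wI|wI] := boolP (w \in I); last by rewrite b1 ?b2.
apply: (total_replace_le_inj k20 wI) => //.
by rewrite (e2 _ wI) -(e1 _ wI) total_replace_anti.
Qed.

Lemma step_sub k k' : curvatures k -> step k k' ->
  (forall v, v \in I -> total k v <= That v) -> forall v, k v <= k' v.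
Proof.
move=> k0 [p b e] h v; have [vI|vI] := boolP (v \in I); last by rewrite b.
by apply: (total_replace_le_inj k0 vI) => //; rewrite e// replace_id h.
Qed.

Lemma step_super k k' : curvatures k -> step k k' ->
  (forall v, v \in I -> That v <= total k v) -> forall v, k' v <= k v.
Proof.
move=> k0 [p b e] h v; have [vI|vI] := boolP (v \in I); last by rewrite b.
by apply: (total_replace_le_inj k0 vI) => //; rewrite e// replace_id h.
Qed.

Definition solution k := [/\ curvatures k, forall w, w \notin I -> k w = khat w &
  forall v, v \in I -> total k v = That v].

Lemma solution_step k : solution k -> step k k.
Proof. by move=> [k0 _ e]; split=> // v vI; rewrite replace_id e. Qed.

(* Maximum principle: at a vertex where [k' / k] is maximal and exceeds 1,
   [k'] would have a larger total curvature than [k]. *)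
Lemma solution_le k k' : solution k -> solution k' -> forall v, k' v <= k v.
Proof.
move=> [k0 bk ek] [k'0 bk' ek'] v; rewrite leNgt; apply/negP => kv.
have [w _ wmax] := @arg_maxP _ _ _ v xpredT (fun w => k' w / k w) isT.
pose l := k' w / k w.
have l1 : 1 < l by rewrite (lt_le_trans _ (wmax v isT))// ltr_pdivlMr// mul1r.
have kw : k' w = l * k w by rewrite /l divfK// gt_eqF.
have wI : w \in I.
  apply/negPn/negP => wI; move: l1; rewrite /l bk'// bk// divff ?ltxx//.
  by rewrite gt_eqF// khat_gt0.
have [f wf] := interior_face wI.
have le u : k' u <= l * k u by rewrite -ler_pdivrMr//; exact: wmax.
by have := total_lt_scale fv_ge3 k0 k'0 l1 le kw wf; rewrite ek// ek'// ltxx.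
Qed.

Definition orbit (u : nat -> V -> R) := curvatures (u 0%N) /\ forall m, step (u m) (u m.+1).

Lemma orbit_curvatures u m : orbit u -> curvatures (u m).
Proof. by case=> u0 us; case: m => // m; case: (us m). Qed.

Lemma orbit_exists k : curvatures k -> exists2 u, orbit u & u 0%N = k.
Proof.
move=> k0; have h k' : exists k'', curvatures k' -> step k' k''.
  have [c|nc] := pselect (curvatures k'); last by exists k'.
  by have [k'' hk] := step_exists c; exists k''.
have [J hJ] := boolp.choice h; exists (fun m => iter m J k) => //.
have c m : curvatures (iter m J k) by elim: m => //= m /hJ [].
by split=> // m; exact: hJ.
Qed.

Lemma orbit_mono u u' : orbit u -> orbit u' -> (forall v, u 0%N v <= u' 0%N v) ->
  forall m v, u m v <= u' m v.
Proof.
move=> ou ou' h; elim=> // m ih.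
apply: (step_mono (orbit_curvatures m ou) (orbit_curvatures m ou')) ih.
- exact: ou.2.
- exact: ou'.2.
Qed.

Lemma orbit_bdry u m w : orbit u -> w \notin I -> u m w = u 0%N w.
Proof. by move=> [_ us] wI; elim: m => // m <-; case: (us m) => _ ->. Qed.

Lemma orbit_incr u : orbit u -> (forall v, v \in I -> total (u 0%N) v <= That v) ->
  forall m v, u m v <= u m.+1 v.
Proof.
move=> ou h; elim=> [|m ih] v.
  exact: (step_sub (orbit_curvatures 0 ou) (ou.2 0%N) h).
exact: (step_mono (orbit_curvatures m ou) (orbit_curvatures m.+1 ou)
  (ou.2 m) (ou.2 m.+1) ih).
Qed.

Lemma orbit_decr u : orbit u -> (forall v, v \in I -> That v <= total (u 0%N) v) ->
  forall m v, u m.+1 v <= u m v.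
Proof.
move=> ou h; elim=> [|m ih] v.
  exact: (step_super (orbit_curvatures 0 ou) (ou.2 0%N) h).
exact: (step_mono (orbit_curvatures m.+1 ou) (orbit_curvatures m ou)
  (ou.2 m.+1) (ou.2 m) ih).
Qed.

Lemma cvg_near_scale (a : nat -> R) (b l : R) : 0 < b -> 1 < l -> a @ \oo --> b ->
  \forall m \near \oo, a m <= l * b /\ b <= l * a m.
Proof.
move=> b0 l1 ab; have l0 : 0 < l by lra.
(* Within this distance of [b] one has a > b / l, and also a < (2 - 1 / l) b <= l b because l + 1 /
   l >= 2. *)
have e0 : 0 < (1 - l^-1) * b by rewrite mulr_gt0// subr_gt0 invf_lt1.
move/cvgrPdist_lt : ab => /(_ _ e0); apply: filterS => m.
rewrite mulrBl mul1r ltr_norml => /andP[h1 h2].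
have li : l^-1 + l >= 2.
  by rewrite -(@ler_pM2l _ l)// [leRHS]mulrDr divff ?gt_eqF//; have := sqr_ge0 (l - 1); lra.
have lb : (l^-1 + l) * b >= 2 * b by rewrite ler_pM2r.
split; first by lra.
have : l * (l^-1 * b) <= l * a m by rewrite ler_pM2l//; lra.
by rewrite mulrA divff ?gt_eqF// mul1r.
Qed.

(** For any l > 1 and some [m], both [u m] and [u m.+1] are within a factor [l] of [k]. So is the
    mixed vector of the equation at [v], whose total curvature there is exactly [That v]; by
    [total_close], [total k v] and [That v] agree up to [l ^+ 3]. *)
Lemma orbit_limit u k : orbit u -> curvatures k ->
  (forall v, (fun m => u m v) @ \oo --> k v) ->
  forall v, v \in I -> total k v = That v.
Proof.
move=> ou k0 cu v vI.
have key l : 1 < l -> total k v <= l ^+ 3 * That v /\ That v <= l ^+ 3 * total k v.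
  move=> l1.
  have nr w : \forall m \near \oo, u m w <= l * k w /\ k w <= l * u m w.
    exact: cvg_near_scale.
  have nr1 w : \forall m \near \oo, u m.+1 w <= l * k w /\ k w <= l * u m.+1 w.
    apply: (@cvg_near_scale (fun m => u m.+1 w)) => //.
    by have := cu w; rewrite -cvg_shiftS.
  have : \forall m \near \oo, forall w, (u m w <= l * k w /\ k w <= l * u m w) /\
      (u m.+1 w <= l * k w /\ k w <= l * u m.+1 w).
    by apply: filter_forall => w; apply: filterI; [exact: nr|exact: nr1].
  move=> /filter_ex [m hm].
  have [p _ /(_ v vI) <-] := ou.2 m.
  have cr := curvatures_replace v (orbit_curvatures m ou) (p v).
  have c1 w : replace (u m) v (u m.+1 v) w <= l * k w.
    by rewrite /replace; case: eqP => [->|_]; apply (hm _).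
  have c2 w : k w <= l * replace (u m) v (u m.+1 v) w.
    by rewrite /replace; case: eqP => [->|_]; apply (hm _).
  by split; apply: total_close => //; exact: ltW.
have [f vf] := interior_face vI.
apply/eqP; rewrite eq_le; apply/andP; split; apply: le_of_cubes.
- exact: That_gt0.
- by move=> l /key[].
- exact: (total_gt0 fv_ge3 k0 vf).
- by move=> l /key[].
Qed.

Lemma solution_exists : exists k, solution k.
Proof.
(* With interior values (That v / C)^2, [total_small] makes the starting vector a subsolution; the
   successor keeps [C] positive in all cases. *)
pose C : R := 6 * (#|F|.+1)%:R.
have C0 : 0 < C by rewrite mulr_gt0// ltr0n.
pose k0 v := if v \in I then (That v / C) ^+ 2 else khat v.
have k00 : curvatures k0.
  move=> v; rewrite /k0; case: ifPn => vI; last exact: khat_gt0.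
  by rewrite exprn_gt0// divr_gt0// That_gt0.
have [u ou u0] := orbit_exists k00.
have sub0 v : v \in I -> total (u 0%N) v <= That v.
  move=> vI; rewrite u0 (le_trans (total_small fv_ge3 v k00))// /k0 vI.
  rewrite sqrtr_sqr ger0_norm; last by rewrite divr_ge0 ?ltW ?That_gt0.
  rewrite mulrCA ler_piMr ?(ltW (That_gt0 vI))// ler_pdivrMr// mul1r.
  by rewrite ler_pM2l// ler_nat.
have uc m : curvatures (u m) := orbit_curvatures m ou.
have uS := orbit_incr ou sub0.
have nd v : nondecreasing_seq (fun m => u m v) by apply/nondecreasing_seqP.
(* Every iterate is a subsolution: raising the value at [v] to [u m.+1 v], which is not smaller,
   brings the total curvature up to exactly [That v]. *)
have subm m v : v \in I -> total (u m) v <= That v.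
  move=> vI; have [p _ /(_ v vI) <-] := ou.2 m.
  have [f vf] := interior_face vI; rewrite -{1}(replace_id (u m) v).
  have := uS m v; rewrite le_eqVlt => /predU1P[->//|lt].
  exact: (ltW (total_replace_lt fv_ge3 (uc m) (uc m v) lt vf)).
have [bd|] := pselect (forall v, exists B, forall m, u m v <= B).
  have cv v : cvgn (fun m => u m v).
    apply: nondecreasing_is_cvgn => //; have [B hB] := bd v.
    by exists B => _ [m _ <-].
  pose k v := limn (fun m => u m v).
  have kc : curvatures k.
    by move=> v; rewrite (lt_le_trans (uc 0%N v))// /k; apply: nondecreasing_cvgn_le.
  exists k; split=> // [w wI|v vI].
    rewrite /k (_ : (fun m => u m w) = fun=> khat w); first exact: lim_cst.
    by apply/funext => m; rewrite (orbit_bdry m ou wI) u0 /k0 (negbTE wI).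
  exact: (orbit_limit ou kc).
(* The vertices where the orbit is unbounded form a nonempty set of interior vertices, to which the
   hypothesis on [That] applies. *)
move=> nbd; pose unb v := `[< forall B, exists m, B < u m v >].
pose Q : {set V} := finset.finset unb.
have QI : Q \subset I.
  apply/fintype.subsetP => v; rewrite inE => /asboolP hv; apply/negPn/negP => vI.
  by have [m] := hv (u 0%N v); rewrite (orbit_bdry m ou vI) ltxx.
have Q0 : Q != finset.set0.
  apply/negP => /eqP Q0; apply: nbd => v.
  have : v \notin Q by rewrite Q0 inE.
  rewrite inE => /asboolPn hv; apply: contrapT => h; apply: hv => B.
  apply: contrapT => hB; apply: h; exists B => m; rewrite leNgt; apply/negP => lt.
  by apply: hB; exists m.
have hB v : exists B, 0 < B /\ (v \notin Q -> forall m, u m v <= B).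
  have [vQ|vQ] := boolP (v \in Q); first by exists 1.
  move: vQ; rewrite inE => /asboolPn hv.
  have [B hB] : exists B, forall m, u m v <= B.
    apply: contrapT => h; apply: hv => B.
    apply: contrapT => hB; apply: h; exists B => m; rewrite leNgt; apply/negP => lt.
    by apply: hB; exists m.
  by exists B; split=> //; exact: lt_le_trans (uc 0%N v) (hB 0%N).
have [B hB'] := boolp.choice hB.
have B0 v : 0 < B v := (hB' v).1.
have [v0 v0Q] := finset.set0Pn _ Q0.
have BB : 0 < \sum_v B v.
  by rewrite (bigD1 v0)//= ltr_pwDl// sumr_ge0// => w _; exact: ltW.
have [K K0 hK] := blowup fv_ge3 BB (That_lt Q0 QI).
have hm v : exists m, v \in Q -> K <= u m v.
  have [vQ|_] := boolP (v \in Q); last by exists 0%N.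
  by move: vQ; rewrite inE => /asboolP /(_ K) [m /ltW]; exists m.
have [M hM] := boolp.choice hm.
(* As the orbit increases, at this single time all curvatures on [Q] have passed [K], while those
   outside [Q] are still bounded. The blow-up inequality then contradicts [subm]. *)
pose m := \max_v M v.
have /hK : curvatures (u m) := uc m.
have hb w : w \notin Q -> u m w <= \sum_v B v.
  move=> wQ; apply: le_trans ((hB' w).2 wQ m) _.
  by rewrite (bigD1 w)//= lerDl sumr_ge0// => v _; exact: ltW.
have hq w : w \in Q -> K <= u m w.
  move=> wQ; apply: le_trans (hM w wQ) _; apply: nd; exact: leq_bigmax.
move=> /(_ hb hq); rewrite ltNge => /negP; case.
by apply: ler_sum => v vQ; apply: subm; exact: (fintype.subsetP QI).
Qed.

Lemma solution_orbit_cvg k u : solution k -> orbit u ->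
  (forall w, w \notin I -> u 0%N w = khat w) ->
  forall v, (fun m => u m v) @ \oo --> k v.
Proof.
move=> sk ou bu; have [k0 bk ek] := sk.
(* Exceeds every ratio between the starting vector and [k], in both directions. *)
pose l := 1 + \sum_w (u 0%N w / k w + k w / u 0%N w).
have uc m : curvatures (u m) := orbit_curvatures m ou.
have pos w : 0 < u 0%N w / k w + k w / u 0%N w.
  by rewrite addr_gt0// divr_gt0// uc.
have l1 : 1 <= l by rewrite lerDl sumr_ge0// => w _; exact: ltW.
have l0 : 0 < l by lra.
have tl w : u 0%N w / k w + k w / u 0%N w <= l.
  rewrite /l (bigD1 w)//= addrCA lerDl addr_ge0// sumr_ge0// => v _; exact: ltW.
have hl w : u 0%N w <= l * k w.
  rewrite -ler_pdivrMr// (le_trans _ (tl w))// lerDl divr_ge0 ?ltW//; exact: uc.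
have hl' w : k w <= l * u 0%N w.
  rewrite -ler_pdivrMr ?uc// (le_trans _ (tl w))// lerDr divr_ge0 ?ltW//; exact: uc.
(* Only interior values are dilated, since the boundary values must stay equal to [khat]. The
   scaling comparison still applies: it asks for equality at the vertex considered and for a factor
   of at most [l] elsewhere. *)
pose kU w := if w \in I then l * k w else k w.
pose kL w := if w \in I then l^-1 * k w else k w.
have kU0 : curvatures kU by move=> w; rewrite /kU; case: ifP => // _; rewrite mulr_gt0.
have kL0 : curvatures kL.
  by move=> w; rewrite /kL; case: ifP => // _; rewrite mulr_gt0// invr_gt0.
have [U oU U0] := orbit_exists kU0; have [L oL L0] := orbit_exists kL0.
have Uc m : curvatures (U m) := orbit_curvatures m oU.
have Lc m : curvatures (L m) := orbit_curvatures m oL.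
have ok : orbit (fun=> k) by split=> // m; exact: solution_step.
have kkU w : k w <= kU w by rewrite /kU; case: ifP => // _; rewrite ler_peMl// ltW.
have kLk w : kL w <= k w.
  rewrite /kL; case: ifP => // _; rewrite ler_piMl ?(ltW (k0 w))//.
  by rewrite invf_le1.
have superU v : v \in I -> That v <= total (U 0%N) v.
  move=> vI; rewrite U0 -ek//; apply: (total_le_scale fv_ge3 (l := l)) => //.
    by move=> w; rewrite /kU; case: ifP => // _; rewrite ler_peMl// ltW.
  by rewrite /kU vI.
have subL v : v \in I -> total (L 0%N) v <= That v.
  move=> vI; rewrite L0 -ek//; apply: (total_le_scale fv_ge3 (l := l)) => //.
    move=> w; rewrite /kL; case: ifP => // _; last by rewrite ler_peMl// ltW.
    by rewrite mulrA divff ?gt_eqF// mul1r.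
  by rewrite /kL vI mulrA divff ?gt_eqF// mul1r.
have Uk m v : k v <= U m v.
  by apply: (orbit_mono ok oU) => w; rewrite U0.
have Lk m v : L m v <= k v.
  by apply: (orbit_mono oL ok) => w; rewrite L0.
have uU m v : u m v <= U m v.
  apply: (orbit_mono ou oU) => w; rewrite U0 /kU; case: ifPn => // wI.
  by rewrite bu// bk.
have Lu m v : L m v <= u m v.
  apply: (orbit_mono oL ou) => w; rewrite L0 /kL; case: ifPn => wI; last by rewrite bu// bk.
  by rewrite -(@ler_pM2l _ l)// mulrA divff ?gt_eqF// mul1r.
have lim_solution (W : nat -> V -> R) (x : V -> R) : orbit W -> curvatures x ->
    (forall v, v \notin I -> W 0%N v = k v) ->
    (forall v, (fun m => W m v) @ \oo --> x v) -> x = k.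
  move=> oW x0 bW cW; have sw : solution x.
    split=> // [v vI|]; last exact: orbit_limit cW.
    rewrite -bk// -bW//; have <- : limn (fun m => W m v) = x v.
      by apply/cvg_lim => //; exact: cW.
    rewrite (_ : (fun m => W m v) = fun=> W 0%N v); first exact: lim_cst.
    by apply/funext => m; rewrite (orbit_bdry m oW vI).
  by apply/funext => v; apply/eqP; rewrite eq_le !solution_le.
have cU v : cvgn (fun m => U m v).
  apply: nonincreasing_is_cvgn; last by exists (k v) => _ [m _ <-].
  by apply/nonincreasing_seqP => m; exact: orbit_decr.
have cL v : cvgn (fun m => L m v).
  apply: nondecreasing_is_cvgn; last by exists (k v) => _ [m _ <-].
  by apply/nondecreasing_seqP => m; exact: orbit_incr.
have limU : (fun v => limn (fun m => U m v)) = k.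
  apply: (lim_solution U) => // [v|v vI]; last by rewrite U0 /kU (negbTE vI).
  rewrite (lt_le_trans (k0 v))//; apply: limr_ge => //; exact: nearW.
have limL : (fun v => limn (fun m => L m v)) = k.
  apply: (lim_solution L) => // [v|v vI]; last by rewrite L0 /kL (negbTE vI).
  rewrite (lt_le_trans (Lc 0%N v))//; apply: nondecreasing_cvgn_le => //.
  by apply/nondecreasing_seqP => m; exact: orbit_incr.
move=> v; apply: (@squeeze_cvgr _ _ _ _ (fun m => L m v) (fun m => U m v)).
- by apply: nearW => m; rewrite Lu uU.
- by have := cL v; rewrite -[X in _ --> X](congr1 (@^~ v) limL).
- by have := cU v; rewrite -[X in _ --> X](congr1 (@^~ v) limU).
Qed.

End Thurston.

(** * The hyperboloid model and generalized circles *)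

Section Minkowski.
Variable R : realType.
Implicit Types (x y z o e : 'rV[R]_3) (a b c : R).

Lemma minkC x y : mink x y = mink y x.
Proof. by rewrite /mink; ring. Qed.

Lemma minkDl x y z : mink (x + y) z = mink x z + mink y z.
Proof. by rewrite /mink !mxE; ring. Qed.

Lemma minkZl a x z : mink (a *: x) z = a * mink x z.
Proof. by rewrite /mink !mxE; ring. Qed.

Lemma minkNl x z : mink (- x) z = - mink x z.
Proof. by rewrite /mink !mxE; ring. Qed.

Lemma minkDr x y z : mink z (x + y) = mink z x + mink z y.
Proof. by rewrite /mink !mxE; ring. Qed.

Lemma minkZr a x z : mink z (a *: x) = a * mink z x.
Proof. by rewrite /mink !mxE; ring. Qed.

Lemma minkNr x z : mink z (- x) = - mink z x.
Proof. by rewrite /mink !mxE; ring. Qed.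

Definition minkE := (minkDl, minkDr, minkNl, minkNr, minkZl, minkZr).

Lemma sum_ord3 (V : nmodType) (f : 'I_3 -> V) : \sum_i f i = f ord0 + f 1 + f 2%R.
Proof.
by rewrite !big_ord_recr big_ord0 /= add0r; do ![congr (_ + _)]; congr f; exact/val_inj.
Qed.

Lemma row3P x y : x ord0 0 = y ord0 0 -> x ord0 1 = y ord0 1 -> x ord0 2%R = y ord0 2%R ->
  x = y.
Proof.
move=> h0 h1 h2; apply/rowP => -[[|[|[|//]]] lt].
- by rewrite (_ : Ordinal lt = 0)//; exact/val_inj.
- by rewrite (_ : Ordinal lt = 1)//; exact/val_inj.
- by rewrite (_ : Ordinal lt = 2%R)//; exact/val_inj.
Qed.

Definition frame o e1 e2 := [/\ hyp o, mink e1 e1 = -1, mink e2 e2 = -1 &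
  [/\ mink o e1 = 0, mink o e2 = 0 & mink e1 e2 = 0]].

Definition mink_sign (i : 'I_3) : R := if i == 0 then 1 else -1.

(** The linear map carrying the first frame to the second, acting on row vectors: expand in the
    first frame and recombine in the second. [mink_sign] turns the matrix product into Minkowski
    products. *)
Definition frame_map o e1 e2 o' e1' e2' : 'M[R]_3 :=
  \matrix_(i, j) (mink_sign i *
    (o ord0 i * o' ord0 j - e1 ord0 i * e1' ord0 j - e2 ord0 i * e2' ord0 j)).

Lemma frame_mapE o e1 e2 o' e1' e2' x : x *m frame_map o e1 e2 o' e1' e2' =
  mink x o *: o' - mink x e1 *: e1' - mink x e2 *: e2'.
Proof.
by apply/rowP => j; rewrite !mxE sum_ord3 !mxE /mink_sign /mink /=; ring.
Qed.


(** Orthonormality says that the matrix of the frame has its Minkowski adjoint as a right inverse.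
    It is then a left inverse as well, and this is the expansion formula. *)
Lemma frame_decomp o e1 e2 x : frame o e1 e2 ->
  x = mink x o *: o - mink x e1 *: e1 - mink x e2 *: e2.
Proof.
move=> [[oo _] e11 e22 [oe1 oe2 e12]].
pose v (i : 'I_3) := if i == 0 then o else if i == 1 then e1 else e2.
pose M : 'M[R]_3 := \matrix_(i, j) v i ord0 j.
pose N : 'M[R]_3 := \matrix_(i, j) (mink_sign i * v j ord0 i * mink_sign j).
have MN : M *m N = 1%:M.
  apply/matrixP => i j; rewrite !mxE sum_ord3 !mxE /=.
  transitivity (mink_sign j * mink (v i) (v j)); first by rewrite /mink /mink_sign /=; ring.
  by case: i j => -[|[|[|//]]] hi [[|[|[|//]]] hj]; rewrite /v /mink_sign /=;
    rewrite ?oo ?e11 ?e22 ?oe1 ?oe2 ?e12 ?(minkC e1 o) ?(minkC e2 o) ?(minkC e2 e1)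
      ?oe1 ?oe2 ?e12; lra.
have NM := mulmx1C MN.
rewrite -frame_mapE -[LHS]mulmx1 -NM; congr (_ *m _).
apply/matrixP => i j; rewrite !mxE sum_ord3 !mxE /v /mink_sign /=; ring.
Qed.

Lemma hyp_sqr x : hyp x -> x ord0 0 ^+ 2 = 1 + x ord0 1 ^+ 2 + x ord0 2%R ^+ 2.
Proof. by rewrite /hyp /mink => -[<- _]; ring. Qed.

(** Reversed Cauchy-Schwarz inequality: squaring and Lagrange's identity leave a sum of three
    squares that is at most 0. *)
Lemma hyp_mink_le1 x y : hyp x -> hyp y -> mink x y <= 1 -> x = y.
Proof.
move=> hx hy; have ex := hyp_sqr hx; have ey := hyp_sqr hy.
case: hx hy => _ x0 [_ y0]; rewrite /mink.
set a := x ord0 0 in ex x0 *; set a' := y ord0 0 in ey y0 *.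
set b := x ord0 1 in ex *; set b' := y ord0 1 in ey *.
set c := x ord0 2%R in ex *; set c' := y ord0 2%R in ey *.
move=> h; have aa : 0 < a * a' by rewrite mulr_gt0.
have le : a * a' <= 1 + b * b' + c * c' by lra.
have : (a * a') ^+ 2 <= (1 + b * b' + c * c') ^+ 2.
  by rewrite ler_pXn2r// nnegrE ?ltW// (lt_le_trans aa).
rewrite exprMn ex ey => hh.
have sq : (b - b') ^+ 2 + (c - c') ^+ 2 + (b * c' - b' * c) ^+ 2 <= 0 by nra.
have s1 := sqr_ge0 (b - b'); have s2 := sqr_ge0 (c - c').
have s3 := sqr_ge0 (b * c' - b' * c).
have /eqP : (b - b') ^+ 2 = 0 by lra.
rewrite sqrf_eq0 subr_eq0 => /eqP bb.
have /eqP : (c - c') ^+ 2 = 0 by lra.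
rewrite sqrf_eq0 subr_eq0 => /eqP cc.
apply: row3P => //; apply/eqP; rewrite -(@eqrXn2 _ 2) ?ltW//.
by rewrite -/a -/a' ex ey bb cc.
Qed.

Lemma hyp_mink_ge1 x y : hyp x -> hyp y -> 1 <= mink x y.
Proof.
move=> hx hy; rewrite leNgt; apply/negP => lt.
have e := hyp_mink_le1 hx hy (ltW lt).
by move: lt; rewrite e; case: hy => -> _; rewrite ltxx.
Qed.

Lemma hyp_of_mink o x : hyp o -> mink x x = 1 -> 0 < mink x o -> hyp x.
Proof.
move=> ho xx xo; split=> //; rewrite ltNge; apply/negP => x0.
have x1 : x ord0 0 != 0.
  apply/negP => /eqP x1; move: xx; rewrite /mink x1.
  by have := sqr_ge0 (x ord0 1); have := sqr_ge0 (x ord0 2%R); lra.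
have hNx : hyp (- x).
  split; first by rewrite minkNl minkNr opprK.
  by rewrite mxE oppr_gt0 lt_neqAle x1.
by have := hyp_mink_ge1 hNx ho; rewrite minkNl; lra.
Qed.

(** Rescaled to norm 1, [v] is a point of the plane, and its product with [x] is at least 1. Applied
    to the sum of two normalized poles, this separates their circles. *)
Lemma timelike_mink x o v c : hyp x -> hyp o -> 0 < mink v o -> 0 < c ->
  c ^+ 2 < mink v v -> c < mink x v.
Proof.
move=> hx ho vo c0 cv; have vv : 0 < mink v v by rewrite (lt_trans _ cv)// exprn_gt0.
set q := Num.sqrt (mink v v); have q0 : 0 < q by rewrite sqrtr_gt0.
have qE : q ^+ 2 = mink v v by rewrite sqr_sqrtr// ltW.
have hw : hyp (q^-1 *: v).
  apply: (hyp_of_mink ho); last by rewrite minkZl mulr_gt0// invr_gt0.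
  by rewrite minkZl minkZr -qE; field; rewrite gt_eqF.
have := hyp_mink_ge1 hx hw; rewrite minkZr mulrC ler_pdivlMr// mul1r.
by apply: lt_le_trans; rewrite -(@ltr_pXn2r _ 2)// ?nnegrE ?(ltW c0) ?(ltW q0)// qE.
Qed.

Section Frame.
Variables o e1 e2 : 'rV[R]_3.
Hypothesis fr : frame o e1 e2.

Definition pt a b c : 'rV[R]_3 := a *: o + b *: e1 + c *: e2.

Lemma mink_pt a b c a' b' c' :
  mink (pt a b c) (pt a' b' c') = a * a' - b * b' - c * c'.
Proof.
case: fr => -[oo _] e11 e22 [oe1 oe2 e12].
rewrite /pt !minkE (minkC e1 o) (minkC e2 o) (minkC e2 e1) oo e11 e22 oe1 oe2 e12.
ring.
Qed.

Lemma mink_pto a b c : mink (pt a b c) o = a.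
Proof.
transitivity (mink (pt a b c) (pt 1 0 0)); last by rewrite mink_pt; ring.
by congr mink; rewrite /pt scale1r !scale0r !addr0.
Qed.

Lemma ptP x : exists a b c, x = pt a b c.
Proof.
exists (mink x o), (- mink x e1), (- mink x e2).
by rewrite {1}(frame_decomp x fr) /pt !scaleNr.
Qed.

Lemma pt_inj a b c a' b' c' : pt a b c = pt a' b' c' -> [/\ a = a', b = b' & c = c'].
Proof.
move=> e; have h (x y z : R) : mink (pt a b c) (pt x y z) = mink (pt a' b' c') (pt x y z).
  by rewrite e.
have := h 1 0 0; have := h 0 1 0; have := h 0 0 1; rewrite !mink_pt => h2 h1 h0.
by split; lra.
Qed.

Lemma ptD a b c a' b' c' : pt a b c + pt a' b' c' = pt (a + a') (b + b') (c + c').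
Proof. by rewrite /pt !scalerDl; apply/rowP => j; rewrite !mxE; ring. Qed.

Lemma ptZ l a b c : l *: pt a b c = pt (l * a) (l * b) (l * c).
Proof. by apply/rowP => j; rewrite !mxE; ring. Qed.

Lemma ptN a b c : - pt a b c = pt (- a) (- b) (- c).
Proof. by apply/rowP => j; rewrite !mxE; ring. Qed.

Lemma pt_o : o = pt 1 0 0.
Proof. by rewrite /pt scale1r !scale0r !addr0. Qed.

Lemma hyp_o : hyp o. Proof. by case: fr. Qed.

Lemma hyp_pt a b c : hyp (pt a b c) <-> a ^+ 2 = 1 + b ^+ 2 + c ^+ 2 /\ 0 < a.
Proof.
split.
  move=> h; have := hyp_mink_ge1 h hyp_o; case: h => h _.
  by move: h; rewrite mink_pto mink_pt => h1 h2; split; lra.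
move=> [h a0]; apply: (hyp_of_mink hyp_o); rewrite ?mink_pto// mink_pt; lra.
Qed.

Lemma frame_rotate (r : R) :
  frame o (cos r *: e1 - sin r *: e2) (sin r *: e1 + cos r *: e2).
Proof.
case: (fr) => ho e11 e22 [oe1 oe2 e12]; have cs := cos2Dsin2 r.
split=> //; [| |split]; rewrite !minkE ?(minkC e2 e1) ?oe1 ?oe2 ?e11 ?e22 ?e12; lra.
Qed.

End Frame.

Lemma frame_map_isometry o e1 e2 o' e1' e2' : frame o e1 e2 -> frame o' e1' e2' ->
  Defs.isometry (frame_map o e1 e2 o' e1' e2').
Proof.
move=> fr fr'; have img x a b c : x = pt o e1 e2 a b c ->
    x *m frame_map o e1 e2 o' e1' e2' = pt o' e1' e2' a b c.
  move=> ->; rewrite frame_mapE mink_pto// /pt; case: fr => -[oo _] e11 e22 [oe1 oe2 e12].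
  rewrite !minkE (minkC e2 e1) oe1 oe2 e11 e22 e12 -!scaleNr.
  by congr (_ + _ *: _ + _ *: _); ring.
split=> [x y|x].
  have [a [b [c ex]]] := ptP fr x; have [a' [b' [c' ey]]] := ptP fr y.
  by rewrite (img _ _ _ _ ex) (img _ _ _ _ ey) ex ey !mink_pt.
have [a [b [c ex]]] := ptP fr x; rewrite (img _ _ _ _ ex) ex.
by move=> /(hyp_pt fr) h; apply/(hyp_pt fr').
Qed.

Lemma frame_map_pt o e1 e2 o' e1' e2' a b c : frame o e1 e2 ->
  pt o e1 e2 a b c *m frame_map o e1 e2 o' e1' e2' = pt o' e1' e2' a b c.
Proof.
move=> fr; rewrite frame_mapE mink_pto// /pt; case: fr => -[oo _] e11 e22 [oe1 oe2 e12].
rewrite !minkE (minkC e2 e1) oe1 oe2 e11 e22 e12 -!scaleNr.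
by congr (_ + _ *: _ + _ *: _); ring.
Qed.

Lemma std_frame : exists o e1 e2 : 'rV[R]_3, frame o e1 e2.
Proof.
exists (\row_j (j == 0)%:R), (\row_j (j == 1)%:R), (\row_j (j == 2%R)%:R).
by rewrite /frame /hyp /mink !mxE /=; do !split; lra.
Qed.

End Minkowski.

(** * Generalized circles described by normalized poles *)

Section GeneralizedCircles.
Variable R : realType.
Implicit Types (C : gcircle R) (x n : 'rV[R]_3) (k r s : R).

Lemma cosh2_sinh2 r : cosh r ^+ 2 = 1 + sinh r ^+ 2.
Proof.
have : expR r * expR (- r) = 1 by rewrite -expRD subrr expR0.
by rewrite /cosh /sinh => h; nra.
Qed.

Lemma cosh_gt0 r : 0 < cosh r.
Proof. by rewrite divr_gt0// addr_gt0// expR_gt0. Qed.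

Lemma sinh_gt0 r : 0 < r -> 0 < sinh r.
Proof. by move=> r0; rewrite divr_gt0// subr_gt0 ltr_expR; lra. Qed.

Lemma arsinh s : exists r, [/\ sinh r = s, cosh r = Num.sqrt (1 + s ^+ 2) & 0 < s -> 0 < r].
Proof.
set c := Num.sqrt _; have d0 := oneDsqr_gt0 s.
have c0 : 0 < c by rewrite sqrtr_gt0.
have cE : c ^+ 2 = 1 + s ^+ 2 by rewrite sqr_sqrtr// ltW.
have cs : 0 < c + s by nra.
exists (ln (c + s)); rewrite /sinh /cosh expRN lnK ?posrE//.
have -> : (c + s)^-1 = c - s.
  by apply: (mulfI (lt0r_neq0 cs)); rewrite divff ?gt_eqF//; lra.
split; [by field|by field|move=> s0; rewrite ln_gt0//; nra].
Qed.

Definition radial_scale C : R :=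
  match C with Circle _ r => sinh r | Horocycle _ => 1 | Hypercycle _ d => cosh d end.

(* With this normalization all generalized circles of curvature [k] have the
   equation [mink x n = k], where [mink n n = k ^+ 2 - 1]. *)
Definition npole C : 'rV[R]_3 := locked ((radial_scale C)^-1 *: pole C).

Lemma radial_scale_gt0 C : gcircle_wf C -> 0 < radial_scale C.
Proof.
case: C => [c r|p|u d] //= [_ h]; [exact: sinh_gt0|exact: cosh_gt0].
Qed.

Lemma pole_npole C : gcircle_wf C -> pole C = radial_scale C *: npole C.
Proof.
by move=> /radial_scale_gt0 h; rewrite /npole -lock scalerA divff ?gt_eqF// scale1r.
Qed.

Lemma level_curvature C : gcircle_wf C -> level C = radial_scale C * curvature C.
Proof.
move=> /radial_scale_gt0; case: C => [c r|p|u d] //= h.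
- by rewrite mulrCA divff ?mulr1// gt_eqF.
- by rewrite mulr1.
- by rewrite mulrCA divff ?mulr1// gt_eqF.
Qed.

Lemma curvature_gt0 C : gcircle_wf C -> 0 < curvature C.
Proof.
case: C => [c r|p|u d] //= [_ h]; first by rewrite divr_gt0// ?cosh_gt0// sinh_gt0.
by rewrite divr_gt0// ?cosh_gt0// sinh_gt0.
Qed.

Lemma npole_sqr C : gcircle_wf C -> mink (npole C) (npole C) = curvature C ^+ 2 - 1.
Proof.
move=> wf; have := radial_scale_gt0 wf; rewrite /npole -lock minkZl minkZr.
case: C wf => [c r|p|u d] /= [h _] h0.
- by rewrite h.1 expr_div_n cosh2_sinh2; field; rewrite gt_eqF.
- by rewrite h; ring.
- have e : sinh d ^+ 2 = cosh d ^+ 2 - 1 by rewrite cosh2_sinh2; ring.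
  by rewrite h expr_div_n e; field; rewrite gt_eqF.
Qed.

Lemma on_gcircleE C x : gcircle_wf C -> on_gcircle C x <-> mink x (npole C) = curvature C.
Proof.
move=> wf; have h := radial_scale_gt0 wf.
rewrite /on_gcircle (level_curvature wf) (pole_npole wf) minkZr.
by split=> [/(mulfI (lt0r_neq0 h))|->].
Qed.

Lemma in_gcircleE C x : gcircle_wf C -> in_gcircle C x <-> mink x (npole C) <= curvature C.
Proof.
move=> wf; have h := radial_scale_gt0 wf.
by rewrite /in_gcircle (level_curvature wf) (pole_npole wf) minkZr ler_pM2l.
Qed.

Lemma normalE C x : gcircle_wf C ->
  normal C x = radial_scale C *: (npole C - mink (npole C) x *: x).
Proof.
by move=> wf; rewrite /normal (pole_npole wf) minkZl -[X in _ - X]scalerA -scalerBr.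
Qed.

(** The pole is n / b with b^2 = |k^2 - 1| when k differs from 1. The size is then fixed by sinh r =
    1 / b and cosh r = k / b for a circle, and by sinh d = k / b and cosh d = 1 / b for a
    hypercycle. *)
Lemma gcircle_exists k n o : 0 < k -> mink n n = k ^+ 2 - 1 -> hyp o -> 0 < mink n o ->
  exists C, [/\ gcircle_wf C, curvature C = k & npole C = n].
Proof.
move=> k0 nn ho no; case: (ltrgtP k 1) => k1.
- have b0 : 0 < 1 - k ^+ 2 by nra.
  set b := Num.sqrt (1 - k ^+ 2); have bp : 0 < b by rewrite sqrtr_gt0.
  have bE : b ^+ 2 = 1 - k ^+ 2 by rewrite sqr_sqrtr// ltW.
  have bn : b != 0 by rewrite gt_eqF.
  have [d [sd cd d0]] := arsinh (k / b).
  have {}cd : cosh d = b^-1.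
    rewrite cd; have -> : 1 + (k / b) ^+ 2 = b^-1 ^+ 2.
      by apply: (mulfI (expf_neq0 2 bn)); rewrite mulrDr !exprMn exprVn; 
        rewrite mulr1 mulrCA divff ?expf_neq0// bE; ring.
    by rewrite sqrtr_sqr ger0_norm// invr_ge0 ltW.
  exists (Hypercycle (b^-1 *: n) d); split=> /=.
  + split; last by apply: d0; rewrite divr_gt0.
    rewrite minkZl minkZr nn; have -> : k ^+ 2 - 1 = - b ^+ 2 by rewrite bE; ring.
    by field.
  + by rewrite sd cd; field.
  + by rewrite /npole -lock /= cd invrK scalerA divff// scale1r.
- have b0 : 0 < k ^+ 2 - 1 by rewrite subr_gt0 exprn_egt1.
  set b := Num.sqrt (k ^+ 2 - 1); have bp : 0 < b by rewrite sqrtr_gt0.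
  have bE : b ^+ 2 = k ^+ 2 - 1 by rewrite sqr_sqrtr// ltW.
  have bn : b != 0 by rewrite gt_eqF.
  have [r [sr cr r0]] := arsinh (b^-1).
  have {}cr : cosh r = k / b.
    rewrite cr; have -> : 1 + b^-1 ^+ 2 = (k / b) ^+ 2.
      by apply: (mulfI (expf_neq0 2 bn)); rewrite mulrDr !exprMn exprVn; 
        rewrite mulr1 mulrCA divff ?expf_neq0// bE; ring.
    by rewrite sqrtr_sqr ger0_norm// divr_ge0// ltW.
  exists (Circle (b^-1 *: n) r); split=> /=.
  + split; last by apply: r0; rewrite invr_gt0.
    apply: (hyp_of_mink ho); last by rewrite minkZl mulr_gt0// invr_gt0.
    by rewrite minkZl minkZr nn -bE; field.
  + by rewrite sr cr; field.
  + by rewrite /npole -lock /= sr invrK scalerA divff// scale1r.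
- exists (Horocycle n); split=> //=; last by rewrite /npole -lock /= invr1 scale1r.
  rewrite nn k1 expr1n subrr; split=> //; rewrite ltNge; apply/negP => n0.
  (* a null vector in the past has non-positive products with the future *)
  have nE : n ord0 0 ^+ 2 = n ord0 1 ^+ 2 + n ord0 2%R ^+ 2.
    by move: nn; rewrite k1 /mink; lra.
  have oE := hyp_sqr ho; case: ho => _ o0.
  move: no; rewrite /mink.
  set a := n ord0 0 in n0 nE *; set b := n ord0 1 in nE *; set c := n ord0 2%R in nE *.
  set a' := o ord0 0 in o0 oE *; set b' := o ord0 1 in oE *; set c' := o ord0 2%R in oE *.
  move=> h; have h1 : 0 <= - a * a' by rewrite mulr_ge0 ?oppr_ge0// ltW.
  have h2 : (- a * a') ^+ 2 < (- (b * b' + c * c')) ^+ 2.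
    rewrite ltr_pXn2r ?nnegrE//; lra.
  move: h2; rewrite exprMn !sqrrN nE oE.
  by have := sqr_ge0 (b * c' - b' * c); have := sqr_ge0 b; have := sqr_ge0 c; nra.
Qed.

End GeneralizedCircles.

(** * Normal form of a configuration *)

Section Trigonometry.
Variable R : realType.
Implicit Types a b c d k s t x y : R.

Lemma cos_pihalf_atan x : Num.sqrt (1 + x ^+ 2) * cos (pi / 2 - atan x) = x.
Proof.
rewrite cosB cos_pihalf sin_pihalf mul0r add0r mul1r.
have d0 : 0 < 1 + x ^+ 2 := oneDsqr_gt0 x.
have r0 : 0 < Num.sqrt (1 + x ^+ 2) by rewrite sqrtr_gt0.
have ca : cos (atan x) != 0 by rewrite cos_atan invr_eq0 gt_eqF.
have : tan (atan x) = x by rewrite atanK.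
rewrite /tan => e; rewrite -[RHS]e cos_atan invrK mulrC.
by rewrite mulrC.
Qed.

Lemma sin_pihalf_atan x : Num.sqrt (1 + x ^+ 2) * sin (pi / 2 - atan x) = 1.
Proof.
rewrite sinB cos_pihalf sin_pihalf mul0r subr0 mul1r cos_atan divff//.
by rewrite gt_eqF// sqrtr_gt0 oneDsqr_gt0.
Qed.

Lemma cos_lt_arc a b : 0 <= a -> a < b -> b < pi *+ 2 - a -> cos b < cos a.
Proof.
move=> a0 ab b2; have api : a < pi by move: b2; rewrite mulr2n; lra.
have [bpi|pib] := leP b pi.
  by rewrite ltr_cos// in_itv /=; lra.
have -> : cos b = cos (pi *+ 2 - b).
  by rewrite addrC cosD2pi cosN.
by rewrite mulr2n in b2 *; rewrite ltr_cos ?in_itv /=; lra.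
Qed.

Lemma polar (b c : R) : exists r t, [/\ 0 <= r, - pi <= t <= pi, b = r * cos t &
  c = r * sin t].
Proof.
set r := Num.sqrt (b ^+ 2 + c ^+ 2).
have r0 : 0 <= r by rewrite sqrtr_ge0.
have rE : r ^+ 2 = b ^+ 2 + c ^+ 2 by rewrite sqr_sqrtr// addr_ge0 ?sqr_ge0.
have pi0 := pi_gt0 R.
have [rz|rn] := eqVneq r 0.
  have b2 := sqr_ge0 b; have c2 := sqr_ge0 c; rewrite rz expr0n /= in rE.
  have /eqP : b ^+ 2 = 0 by lra.
  have /eqP : c ^+ 2 = 0 by lra.
  rewrite !sqrf_eq0 => /eqP -> /eqP ->.
  by exists 0, 0; rewrite lexx !mul0r; split=> //; lra.
have rp : 0 < r by rewrite lt_neqAle eq_sym rn.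
set q := b / r.
have q2 : q ^+ 2 + (c / r) ^+ 2 = 1 by rewrite /q !expr_div_n -mulrDl -rE divff// expf_neq0.
have hq : -1 <= q <= 1 by have := sqr_ge0 (c / r); nra.
have h0 := acos_ge0 hq; have h1 := acos_lepi hq.
have bE : b = r * cos (acos q).
  by rewrite acosK ?in_itv//= /q mulrC divfK.
have sE : sin (acos q) = `|c / r|.
  by rewrite sin_acos// -q2 addrAC subrr add0r sqrtr_sqr.
have cr : r * (c / r) = c by rewrite mulrC divfK.
have [c0|c0] := leP 0 c.
  exists r, (acos q); split=> //; first by lra.
  by rewrite sE ger0_norm ?cr// divr_ge0.
exists r, (- acos q); split=> //; [lra|by rewrite cosN|].
by rewrite sinN sE ltr0_norm ?opprK ?cr// ltr_pdivrMr// mul0r.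
Qed.

Lemma linear_form_lt b c d t : 0 < d -> b ^+ 2 + c ^+ 2 < d ^+ 2 ->
  b * cos t + c * sin t < d.
Proof.
move=> d0 h; rewrite ltNge; apply/negP => le.
have : d ^+ 2 <= (b * cos t + c * sin t) ^+ 2.
  by rewrite ler_pXn2r// nnegrE ltW// (lt_le_trans d0).
have : (b * cos t + c * sin t) ^+ 2 + (b * sin t - c * cos t) ^+ 2 = b ^+ 2 + c ^+ 2.
  by rewrite -[RHS]mulr1 -(cos2Dsin2 t); ring.
by have := sqr_ge0 (b * sin t - c * cos t); lra.
Qed.

(** The equation reads cot g = e k. The case e = 1 is the half angle of a configuration, and e = -1
    gives its supplement. *)
Lemma tan_half_angle k (e g : R) : 0 < k -> 0 < g -> g < pi ->
  e * cos g = k * sin g -> (e = 1 -> g = pi / 2 - atan k) /\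
  (e = -1 -> g = pi / 2 + atan k).
Proof.
move=> k0 g0 gpi h; have sg : 0 < sin g by apply: sin_gt0_pi; rewrite g0.
have sn : sin g != 0 by rewrite gt_eqF.
have tE : tan (pi / 2 - g) = cos g / sin g.
  by rewrite /tan sinB cosB cos_pihalf sin_pihalf !mul0r !mul1r subr0 add0r.
have tK : pi / 2 - g = atan (cos g / sin g).
  by rewrite -tE tanK// in_itv /=; lra.
split=> e1; move: h; rewrite e1 ?mul1r ?mulN1r => h.
  have kE : cos g / sin g = k by rewrite h mulfK.
  by rewrite -kE -tK; ring.
have kE : cos g / sin g = - k by rewrite -[cos g]opprK h mulNr mulfK.
by have := atanN k; rewrite -kE -tK; lra.
Qed.

End Trigonometry.

(** * How far the region extends within the sector of one circle *)

Section Sector.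
Variable R : realType.
(** [c] and [s] are cosh and sinh of the dual radius. A point has coordinate [x0] along the dual
    centre, and spatial coordinates [C] along and [S] across the direction of the nearer tangency
    point. [CkS] says that it lies in the half sector, and [Cx] that it is on the inner side of the
    geodesic tangent to the dual circle there. Its product with the normalized pole is
    [k * c * x0 - k * s * C - S]. *)
Variables k s c x0 C S : R.
Hypotheses (k0 : 0 < k) (s0 : 0 < s) (c0 : 0 < c) (cE : c ^+ 2 = 1 + s ^+ 2).
Hypotheses (x0_gt0 : 0 < x0) (CS : C ^+ 2 + S ^+ 2 = x0 ^+ 2 - 1) (S0 : 0 <= S)
  (CkS : k * s * S <= C) (Cx : c * C <= s * x0).

Let C0 : 0 <= C.
Proof. by rewrite (le_trans _ CkS)// !mulr_ge0// ltW. Qed.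

(** Eliminate [S] by [CkS], then [C] by [Cx]. For k > 1 the extreme point is the centre of the
    circle, a vertex of the polygon. *)
Lemma sector_circle : (k ^+ 2 - 1) * x0 ^+ 2 <= k ^+ 2 * c ^+ 2.
Proof.
have h1 : (k * s) ^+ 2 * S ^+ 2 <= C ^+ 2.
  by rewrite -exprMn ler_pXn2r// nnegrE !mulr_ge0// ltW.
have h2 : c ^+ 2 * C ^+ 2 <= s ^+ 2 * x0 ^+ 2.
  by rewrite -!exprMn ler_pXn2r// nnegrE mulr_ge0// ltW.
have h3 : (k * s) ^+ 2 * (x0 ^+ 2 - 1) <= C ^+ 2 * (1 + (k * s) ^+ 2) by rewrite -CS; lra.
have h4 : c ^+ 2 * ((k * s) ^+ 2 * (x0 ^+ 2 - 1)) <= s ^+ 2 * x0 ^+ 2 * (1 + (k * s) ^+ 2).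
  have := ler_wpM2l (sqr_ge0 c) h3; move/le_trans; apply.
  by rewrite mulrA ler_wpM2r// addr_ge0 ?sqr_ge0.
have s2 : 0 < s ^+ 2 by rewrite exprn_gt0.
rewrite -(ler_pM2l s2); move: h4; rewrite exprMn cE; lra.
Qed.

(** For fixed [x0] the product with the pole is largest on the tangent geodesic, at (C1, S1). There
    z = x0 / c is the cosh of the distance to the tangency point, by the right triangle with the
    dual centre. *)
Lemma sector_pole : c < x0 ->
  k * c * x0 - k * s * C - S <= k * (x0 / c) - Num.sqrt ((x0 / c) ^+ 2 - 1).
Proof.
move=> cx; set z := x0 / c.
have z1 : 1 < z by rewrite ltr_pdivlMr// mul1r.
have zc : x0 = z * c by rewrite /z divfK// gt_eqF.
have d0 : 0 < z ^+ 2 - 1 by rewrite subr_gt0 exprn_egt1.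
set S1 := Num.sqrt _; have S10 : 0 < S1 by rewrite sqrtr_gt0.
have S1E : S1 ^+ 2 = z ^+ 2 - 1 by rewrite sqr_sqrtr// ltW.
pose C1 := s * z.
have CC1 : C <= C1.
  by rewrite -(ler_pM2l c0) (le_trans Cx)// zc /C1; lra.
have e1 : C1 ^+ 2 + S1 ^+ 2 = C ^+ 2 + S ^+ 2.
  by rewrite S1E CS zc /C1 !exprMn cE; ring.
have ks : 0 < k * s by rewrite mulr_gt0.
have SS1 : S1 <= S.
  rewrite -(@ler_pXn2r _ 2)// ?nnegrE ?(ltW S10)//.
  have : C ^+ 2 <= C1 ^+ 2 by rewrite ler_pXn2r// nnegrE (le_trans C0).
  lra.
have h : 0 <= (S - S1 - k * s * (C1 - C)) * (S + S1).
  have -> : (S - S1 - k * s * (C1 - C)) * (S + S1) =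
      (C1 - C) * (C1 + C - k * s * (S + S1)).
    have : (S - S1) * (S + S1) = (C1 - C) * (C1 + C) by lra.
    by lra.
  rewrite mulr_ge0 ?subr_ge0//.
  have h1 : k * s * S1 <= k * s * S by rewrite ler_pM2l.
  rewrite mulrDr addrC; apply: lerD => //; exact: le_trans h1 (le_trans CkS CC1).
have {h} : 0 <= S - S1 - k * s * (C1 - C) by rewrite -(pmulr_lge0 _ (_ : 0 < S + S1))//; lra.
have -> : k * c * x0 = k * z * c ^+ 2 by rewrite zc; ring.
by rewrite cE /C1; lra.
Qed.

(** The axis condition and [sector_pole] give sqrt (z^2 - 1) <= k z; the extreme point is the
    intersection of the tangent geodesic with the axis. *)
Lemma sector_hypercycle : k < 1 -> 0 <= k * c * x0 - k * s * C - S ->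
  (1 - k ^+ 2) * x0 ^+ 2 <= c ^+ 2.
Proof.
move=> k1 h; have k2 : 0 < 1 - k ^+ 2.
  by rewrite subr_gt0 exprn_ilt1// ltW.
have [xc|cx] := leP x0 c.
  have : x0 ^+ 2 <= c ^+ 2 by rewrite ler_pXn2r// nnegrE ltW.
  by have := sqr_ge0 x0; have := mulr_ge0 (sqr_ge0 k) (sqr_ge0 x0); lra.
have := sector_pole cx; set z := x0 / c; set q := Num.sqrt _ => hz.
have z1 : 1 < z by rewrite ltr_pdivlMr// mul1r.
have qE : q ^+ 2 = z ^+ 2 - 1 by rewrite sqr_sqrtr// subr_ge0 exprn_ege1// ltW.
have q0 : 0 <= q by rewrite sqrtr_ge0.
have zc : x0 = z * c by rewrite /z divfK// gt_eqF.
have : q ^+ 2 <= (k * z) ^+ 2.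
  have kz : 0 <= k * z by rewrite mulr_ge0 ?(ltW k0)// (le_trans ler01)// ltW.
  by rewrite ler_pXn2r ?nnegrE//; have := le_trans h hz; rewrite subr_ge0.
rewrite qE zc => hh; have c2 : 0 < c ^+ 2 by rewrite exprn_gt0.
have -> : (1 - k ^+ 2) * (z * c) ^+ 2 = ((1 - k ^+ 2) * z ^+ 2) * c ^+ 2 by ring.
by rewrite ger_pMl//; lra.
Qed.

(** Outside the horoball, a point with z > 1 would satisfy sqrt (z^2 - 1) < z - 1, which is
    impossible. *)
Lemma sector_horocycle : k = 1 -> 1 < k * c * x0 - k * s * C - S -> x0 <= c.
Proof.
move=> k1 h; rewrite leNgt; apply/negP => cx.
have := sector_pole cx; set z := x0 / c; set q := Num.sqrt _ => hz.
have z1 : 1 < z by rewrite ltr_pdivlMr// mul1r.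
have qE : q ^+ 2 = z ^+ 2 - 1 by rewrite sqr_sqrtr// subr_ge0 exprn_ege1// ltW.
have q0 : 0 <= q by rewrite sqrtr_ge0.
have qz : q < z - 1 by move: h hz; rewrite k1; lra.
have : q ^+ 2 < (z - 1) ^+ 2 by rewrite ltr_pXn2r// nnegrE; lra.
by rewrite qE; lra.
Qed.

End Sector.

(** * Polar angles of the tangency points *)

Section Angles.
Variables (R : realType) (m : nat) (kap : 'I_m -> R) (s : R).
Hypotheses (kap_gt0 : forall i, 0 < kap i) (s0 : 0 < s).

Definition half_angle (i : 'I_m) : R := pi / 2 - atan (kap i * s).

(* The polar angle at the dual centre of the tangency point number [n - 1]. *)
Definition tang_angle (n : nat) : R := - pi + \sum_(l < m | (l < n)%N) 2 * half_angle l.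

Hypothesis sum_half_angle : \sum_i half_angle i = pi.

Lemma half_angle_gt0 i : 0 < half_angle i.
Proof. by rewrite subr_gt0 atan_ltpi2. Qed.

Lemma half_angle_lt i : half_angle i < pi / 2.
Proof.
by rewrite ltrBlDr ltrDl -(@atan0 R) lt_atan// mulr_gt0.
Qed.

Lemma tang_angle0 : tang_angle 0 = - pi.
Proof. by rewrite /tang_angle big_pred0 ?addr0. Qed.

Lemma tang_angle_max : tang_angle m = pi.
Proof.
rewrite /tang_angle (eq_bigl xpredT); last by move=> l; rewrite ltn_ord.
rewrite -mulr_sumr sum_half_angle; ring.
Qed.

Lemma tang_angleS (i : 'I_m) : tang_angle i.+1 = tang_angle i + 2 * half_angle i.
Proof.
rewrite /tang_angle (bigD1 i)/= ?leqnn// -addrA [2 * _ + _]addrC; congr (_ + (_ + _)).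
apply: eq_bigl => l; rewrite ltnS [RHS]ltn_neqAle andbC.
by congr (_ && _); rewrite -val_eqE.
Qed.

Lemma tang_angle_le a b : (a <= b)%N -> tang_angle a <= tang_angle b.
Proof.
move=> ab; rewrite /tang_angle lerD2l [leRHS](bigID (fun l : 'I_m => (l < a)%N))/=.
rewrite [X in _ <= X + _](eq_bigl (fun l : 'I_m => (l < a)%N)); last first.
  move=> l; by rewrite andb_idl// => /leq_trans; apply.
by rewrite lerDl sumr_ge0// => l _; rewrite mulr_ge0// ltW// half_angle_gt0.
Qed.

Lemma tang_angle_lt a b : (a < b)%N -> (b <= m)%N -> tang_angle a < tang_angle b.
Proof.
move=> ab bm; apply: lt_le_trans (tang_angle_le ab).
have am : (a < m)%N := leq_trans ab bm.
by rewrite (tang_angleS (Ordinal am)) ltrDl mulr_gt0// half_angle_gt0.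
Qed.

Lemma tang_angle_pred (i : 'I_m) :
  cos (tang_angle (ord_pred i).+1) = cos (tang_angle i) /\
  sin (tang_angle (ord_pred i).+1) = sin (tang_angle i).
Proof.
case: i => -[|i] lt /=.
  rewrite add0n modn_small ?ltn_predL// prednK//.
  rewrite tang_angle_max tang_angle0 -(cosD2pi (- pi)) -(sinD2pi (- pi)) mulr2n.
  by rewrite addKr.
by rewrite modnDr modn_small// (ltn_trans _ lt).
Qed.

Lemma sector t : - pi <= t <= pi -> exists i : 'I_m, tang_angle i <= t <= tang_angle i.+1.
Proof.
move=> /andP[t1 t2]; have m0 : (0 < m)%N.
  case: posnP => // m0; have := sum_half_angle; rewrite big1 => [|[i lt]].
    by move=> e; have := pi_gt0 R; rewrite -e ltxx.
  by exfalso; rewrite m0 in lt.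
suff h n : (0 < n <= m)%N -> t <= tang_angle n ->
    exists i : 'I_m, tang_angle i <= t <= tang_angle i.+1.
  by apply: (h m); rewrite ?m0 ?leqnn// tang_angle_max.
elim: n => // n ih /= nm tn.
have [tle|tgt] := leP t (tang_angle n); last first.
  by exists (Ordinal nm); rewrite /= tn ltW.
case: n => [|n] in ih nm tn tle *; last by apply: ih; rewrite //= ltnW.
by exists (Ordinal nm); rewrite /= tn tang_angle0 t1.
Qed.

End Angles.

(* The dual circle has centre [o] and radius [arsinh s], and everything is
   written in the orthonormal frame (o, e1, e2). *)
Record normal_form (R : realType) (m : nat) (K : configuration R m) (kap : 'I_m -> R)
    (o e1 e2 : 'rV[R]_3) (s : R) : Prop := NormalForm {
  nf_frame : frame o e1 e2;
  nf_s : 0 < s;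
  nf_kap : forall i, 0 < kap i;
  nf_sum : \sum_i half_angle kap s i = pi;
  nf_size : (3 <= m)%N;
  nf_center : dual_center K = o;
  nf_sinh : sinh (dual_radius K) = s;
  nf_radius : 0 < dual_radius K;
  nf_wf : forall i, gcircle_wf (circ K i);
  nf_curv : forall i, curvature (circ K i) = kap i;
  nf_tang : forall i, tang K i = pt o e1 e2 (Num.sqrt (1 + s ^+ 2))
    (s * cos (tang_angle kap s i.+1)) (s * sin (tang_angle kap s i.+1));
  nf_npole : forall i, npole (circ K i) = pt o e1 e2 (kap i * Num.sqrt (1 + s ^+ 2))
    (kap i * s * cos (tang_angle kap s i.+1) + sin (tang_angle kap s i.+1))
    (kap i * s * sin (tang_angle kap s i.+1) - cos (tang_angle kap s i.+1)) }.

(** * A normal form is a configuration *)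

Section NormalForm.
Variables (R : realType) (m : nat) (K : configuration R m) (kap : 'I_m -> R).
Variables (o e1 e2 : 'rV[R]_3) (s : R).
Hypothesis nf : normal_form K kap o e1 e2 s.

Local Notation A := (tang_angle kap s).
Local Notation del := (half_angle kap s).
Local Notation c := (Num.sqrt (1 + s ^+ 2)).
Local Notation P := (pt o e1 e2).
Let fr := nf_frame nf.
Let s0 := nf_s nf.
Let k0 := nf_kap nf.
Let sumd := nf_sum nf.
Let wf := nf_wf nf.

(** Polar coordinates of the spatial part of the normalized pole: its direction bisects the sector
    between the two tangency points, and its length is [axis_coef i]. *)
Definition axis_angle (i : 'I_m) := A i + del i.
Definition axis_coef (i : 'I_m) := Num.sqrt (1 + (kap i * s) ^+ 2).
Local Notation psi := axis_angle.
Local Notation rho := axis_coef.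

Lemma dual_c_gt0 : 0 < c. Proof. by rewrite sqrtr_gt0 oneDsqr_gt0. Qed.

Lemma dual_c_sqr : c ^+ 2 = 1 + s ^+ 2.
Proof. by rewrite sqr_sqrtr// ltW// oneDsqr_gt0. Qed.

Lemma nf_cosh : cosh (dual_radius K) = c.
Proof.
apply/eqP; rewrite -(@eqrXn2 _ 2) ?(ltW (cosh_gt0 _)) ?(ltW dual_c_gt0)//.
by rewrite dual_c_sqr cosh2_sinh2 (nf_sinh nf).
Qed.

Lemma rho_gt0 i : 0 < rho i. Proof. by rewrite sqrtr_gt0 oneDsqr_gt0. Qed.

Lemma rho_sqr i : rho i ^+ 2 = 1 + (kap i * s) ^+ 2.
Proof. by rewrite sqr_sqrtr// ltW// oneDsqr_gt0. Qed.

Lemma rho_cos i : rho i * cos (del i) = kap i * s.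
Proof. exact: cos_pihalf_atan. Qed.

Lemma rho_sin i : rho i * sin (del i) = 1.
Proof. exact: sin_pihalf_atan. Qed.

Lemma nf_npole_psi i : npole (circ K i) = P (kap i * c) (rho i * cos (psi i)) (rho i * sin (psi i)).
Proof.
have e : psi i = A i.+1 - del i.
  by rewrite tang_angleS /axis_angle; ring.
rewrite (nf_npole nf) e cosB sinB; congr (P _ _ _).
  by rewrite -{1}(rho_cos i) -{1}[sin (A i.+1)]mul1r -{1}(rho_sin i); ring.
by rewrite -{1}(rho_cos i) -{1}[cos (A i.+1)]mul1r -{1}(rho_sin i); ring.
Qed.

Lemma nf_npole_pred i : npole (circ K i) = P (kap i * c)
  (kap i * s * cos (A i) - sin (A i)) (kap i * s * sin (A i) + cos (A i)).
Proof.
rewrite nf_npole_psi /axis_angle cosD sinD; congr (P _ _ _).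
  transitivity (rho i * cos (del i) * cos (A i) - rho i * sin (del i) * sin (A i)); first by ring.
  by rewrite rho_cos rho_sin mul1r.
transitivity (rho i * cos (del i) * sin (A i) + rho i * sin (del i) * cos (A i)); first by ring.
by rewrite rho_cos rho_sin mul1r.
Qed.

Lemma nf_tang_pred i : tang K (ord_pred i) = P c (s * cos (A i)) (s * sin (A i)).
Proof.
by rewrite (nf_tang nf); have [-> ->] := tang_angle_pred sumd i.
Qed.

Lemma nf_hyp_tang i : hyp (tang K i).
Proof.
rewrite (nf_tang nf); apply/(hyp_pt fr); split; last exact: dual_c_gt0.
by rewrite dual_c_sqr !exprMn -addrA -mulrDr cos2Dsin2 mulr1.
Qed.

Lemma nf_mink_tang i : mink (tang K i) (npole (circ K i)) = kap i.
Proof.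
rewrite (nf_tang nf) (nf_npole nf) (mink_pt fr); have := cos2Dsin2 (A i.+1) => cs.
transitivity (kap i * (c ^+ 2 - s ^+ 2 * (cos (A i.+1) ^+ 2 + sin (A i.+1) ^+ 2))); first by ring.
by rewrite cs dual_c_sqr; ring.
Qed.

Lemma nf_mink_tang_pred i : mink (tang K (ord_pred i)) (npole (circ K i)) = kap i.
Proof.
rewrite nf_tang_pred nf_npole_pred (mink_pt fr); have := cos2Dsin2 (A i) => cs.
transitivity (kap i * (c ^+ 2 - s ^+ 2 * (cos (A i) ^+ 2 + sin (A i) ^+ 2))); first by ring.
by rewrite cs dual_c_sqr; ring.
Qed.

(** Tangency in linear form: adding the inequalities that define the two convex sides gives mink x t
    <= 1, which forces x = t. *)
Lemma nf_npole_sum i : npole (circ K i) + npole (circ K (ordS i)) =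
  (kap i + kap (ordS i)) *: tang K i.
Proof.
rewrite (nf_npole nf i) nf_npole_pred (nf_tang nf).
have := tang_angle_pred sumd (ordS i); rewrite ordSK => -[<- <-].
by rewrite ptD ptZ; congr (P _ _ _); ring.
Qed.

Lemma nf_ext_tangent i : ext_tangent_at (circ K i) (circ K (ordS i)) (tang K i).
Proof.
split; [exact: nf_hyp_tang|apply/on_gcircleE => //|apply/on_gcircleE => //|].
- by rewrite nf_mink_tang (nf_curv nf).
- by have := nf_mink_tang_pred (ordS i); rewrite ordSK (nf_curv nf).
move=> x hx /in_gcircleE h1 /in_gcircleE h2.
apply: hyp_mink_le1 => //; first exact: nf_hyp_tang.
have kk : 0 < kap i + kap (ordS i) by rewrite addr_gt0.
rewrite -(ler_pM2l kk) mulr1 -minkZr -nf_npole_sum minkDr.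
by rewrite -!(nf_curv nf) lerD// ?h1// h2.
Qed.

Lemma tang_angle_bounds n : (n <= m)%N -> - pi <= A n <= pi.
Proof.
move=> nm; rewrite -(tang_angle0 kap s) -(tang_angle_max sumd).
by rewrite !tang_angle_le.
Qed.

(** For tangent circles there is equality, the axes being at the angle [del i + del j]; the axes of
    non-neighbours are further apart. The disjunction excludes the first and last index, which are
    cyclic neighbours. The inequality makes the norm of the sum of the poles exceed (k_i +
    k_j)^2. *)
Lemma nf_mink_npole_lt (i j : 'I_m) : (i.+1 < j)%N -> (0 < i)%N || (j.+1 < m)%N ->
  kap i * kap j + 1 < mink (npole (circ K i)) (npole (circ K j)).
Proof.
move=> ij h; rewrite !nf_npole_psi (mink_pt fr).
have c2 := dual_c_sqr; have rr : 0 < rho i * rho j by rewrite mulr_gt0 ?rho_gt0.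
have di := half_angle_gt0 kap s i; have dj := half_angle_gt0 kap s j.
have lt : cos (psi j - psi i) < cos (del i + del j).
  have Ai := tang_angleS kap s i; have Aj := tang_angleS kap s j.
  have lij : A i.+1 < A j by apply: (tang_angle_lt _ _ ij); rewrite ltnW.
  have := tang_angle_bounds (ltn_ord j); have := tang_angle_bounds (ltnW (ltn_ord i)).
  move=> /andP[b1 b2] /andP[b3 b4].
  have far : A j.+1 - A i < 2 * pi.
    case/orP: h => h; first by have := tang_angle_lt kap s h (ltnW (ltn_ord i)); rewrite tang_angle0; lra.
    by have := tang_angle_lt kap s h (leqnn m); rewrite tang_angle_max//; lra.
  by apply: cos_lt_arc; rewrite /axis_angle ?mulr2n; lra.
have : rho i * rho j * cos (psi j - psi i) < rho i * rho j * cos (del i + del j).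
  by rewrite ltr_pM2l.
have -> : rho i * rho j * cos (del i + del j) = kap i * kap j * s ^+ 2 - 1.
  rewrite cosD; transitivity ((rho i * cos (del i)) * (rho j * cos (del j)) -
    (rho i * sin (del i)) * (rho j * sin (del j))); first by ring.
  by rewrite !rho_cos !rho_sin; ring.
rewrite cosB; have -> : kap i * c * (kap j * c) = kap i * kap j * c ^+ 2 by ring.
rewrite c2; by lra.
Qed.

Lemma nf_disjoint_lt (i j : 'I_m) x : (i.+1 < j)%N -> (0 < i)%N || (j.+1 < m)%N -> hyp x ->
  on_gcircle (circ K i) x -> ~ on_gcircle (circ K j) x.
Proof.
move=> ij h hx /(on_gcircleE _ (wf i)) h1 /(on_gcircleE _ (wf j)) h2.
have lt := nf_mink_npole_lt ij h.
have kk : 0 < kap i + kap j by rewrite addr_gt0.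
have : kap i + kap j < mink x (npole (circ K i) + npole (circ K j)).
  apply: (timelike_mink hx (hyp_o fr)) => //.
    rewrite minkDl !nf_npole_psi !(mink_pto fr).
    by rewrite addr_gt0// mulr_gt0// dual_c_gt0.
  rewrite !minkE (minkC (npole (circ K j)) (npole (circ K i))) !npole_sqr// !(nf_curv nf).
  by lra.
by rewrite minkDr h1 h2 !(nf_curv nf) ltxx.
Qed.

Lemma ordS_val (i : 'I_m) : (ordS i : nat) = if (i.+1 < m)%N then i.+1 else 0%N.
Proof.
rewrite /=; case: ltnP => h; first by rewrite modn_small.
by have -> : i.+1 = m; [apply/eqP; rewrite eqn_leq h ltn_ord|rewrite modnn].
Qed.

Lemma nf_disjoint (i j : 'I_m) x : j != i -> j != ordS i -> i != ordS j -> hyp x ->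
  on_gcircle (circ K i) x -> ~ on_gcircle (circ K j) x.
Proof.
have key (a b : 'I_m) : (a < b)%N -> b != ordS a -> a != ordS b ->
    (a.+1 < b)%N /\ ((0 < a)%N || (b.+1 < m)%N).
  move=> ab; rewrite -!(inj_eq (@ord_inj m)) ordS_val (leq_ltn_trans ab (ltn_ord b)) => h1.
  rewrite ordS_val => h2; split; first by rewrite ltn_neqAle eq_sym h1.
  by move: h2; case: (b.+1 < m)%N; rewrite ?orbT// orbF lt0n.
move=> ji h1 h2 hx; case: (ltngtP i j) => [ij|gt|/val_inj e].
- by have [a b] := key _ _ ij h1 h2; exact: nf_disjoint_lt.
- have [a b] := key _ _ gt h2 h1 => o1 o2.
  exact: (nf_disjoint_lt a b hx o2 o1).
- by rewrite e eqxx in ji.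
Qed.

Lemma nf_tang_inj : injective (tang K).
Proof.
have key (a b : 'I_m) : (a < b)%N -> tang K a <> tang K b.
  move=> ab; rewrite !(nf_tang nf) => /(pt_inj fr) [_ h1 h2].
  have {}h1 := mulfI (lt0r_neq0 s0) h1; have {}h2 := mulfI (lt0r_neq0 s0) h2.
  have lt : A a.+1 < A b.+1 by apply: tang_angle_lt => //; rewrite ltnS.
  have [/andP[_ hb] /andP[ha _]] := (tang_angle_bounds (ltn_ord b), tang_angle_bounds (ltnW (ltn_ord a))).
  have da := half_angle_gt0 kap s a; have := tang_angleS kap s a => ea.
  have : cos (A b.+1 - A a.+1) < cos 0.
    by apply: cos_lt_arc => //; rewrite ?mulr2n; lra.
  by rewrite cos0 cosB h1 h2 -!expr2 cos2Dsin2 ltxx.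
move=> a b e; apply/val_inj; case: (ltngtP a b) => // /key; first by [].
by move=> h; case: h.
Qed.

Lemma nf_common (i j : 'I_m) x : i != j -> hyp x ->
  on_gcircle (circ K i) x -> on_gcircle (circ K j) x ->
  exists2 a, x = tang K a & (a == i) || (a == j).
Proof.
move=> ij hx oi oj.
have inn l : on_gcircle (circ K l) x -> in_gcircle (circ K l) x.
  by move=> /(on_gcircleE _ (wf l)) h; apply/in_gcircleE => //; rewrite h.
have [e|n1] := eqVneq j (ordS i).
  exists i; rewrite ?eqxx//; have [_ _ _] := nf_ext_tangent i; apply=> //; first exact: inn.
  by rewrite -e; exact: inn.
have [e|n2] := eqVneq i (ordS j).
  exists j; rewrite ?eqxx ?orbT//; have [_ _ _] := nf_ext_tangent j; apply=> //; first exact: inn.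
  by rewrite -e; exact: inn.
by exfalso; apply: (nf_disjoint _ n1 n2 hx oi oj); rewrite eq_sym.
Qed.

(** The common point would be a tangency point whose index lies in each of {i, j}, {j, l} and {i,
    l}. *)
Lemma nf_no_triple (i j l : 'I_m) x : i != j -> j != l -> i != l -> hyp x ->
  on_gcircle (circ K i) x -> on_gcircle (circ K j) x -> ~ on_gcircle (circ K l) x.
Proof.
move=> ij jl il hx oi oj ol.
have [a ea /orP ha] := nf_common ij hx oi oj.
have [b eb /orP hb] := nf_common jl hx oj ol.
have [d ed /orP hd] := nf_common il hx oi ol.
have ab : a = b by apply: nf_tang_inj; rewrite -ea -eb.
have ad : a = d by apply: nf_tang_inj; rewrite -ea -ed.
subst b d; move: ij jl il.
by case: ha => /eqP ea'; case: hb => /eqP eb'; case: hd => /eqP ed'; subst; rewrite ?eqxx.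
Qed.

Lemma nf_dual_wf : gcircle_wf (dual_circle K).
Proof. by rewrite /= (nf_center nf); split; [exact: hyp_o fr|exact: nf_radius nf]. Qed.

Lemma nf_on_dual i : on_gcircle (dual_circle K) (tang K i).
Proof. by rewrite /on_gcircle /= (nf_center nf) nf_cosh (nf_tang nf) (mink_pto fr). Qed.

Lemma nf_perpendicular i : perpendicular (dual_circle K) (circ K i).
Proof.
move=> x [xx _]; rewrite /on_gcircle /= (nf_center nf) nf_cosh => h1 /(on_gcircleE _ (wf i)) h2.
have h3 : mink o (npole (circ K i)) = kap i * c.
  by rewrite minkC nf_npole_psi (mink_pto fr).
rewrite (normalE _ (wf i)) /normal /= (nf_center nf) !minkE.
by rewrite (minkC (npole (circ K i)) x) (minkC o x) h1 h2 h3 xx (nf_curv nf); ring.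
Qed.

Lemma nf_cyclic : cyclic_order K.
Proof.
exists e1, e2, (fun i => A i.+1); case: (fr) => ho e11 e22 [oe1 oe2 e12].
cbv zeta; rewrite (nf_center nf) nf_cosh (nf_sinh nf); split=> //.
- by move=> i; rewrite (nf_tang nf) /pt scalerDr !scalerA addrA.
- by move=> i j ij; apply: tang_angle_lt => //; rewrite ltnS.
- move=> i j; have /andP[_ h1] := tang_angle_bounds (ltn_ord j).
  have /andP[h2 _] := tang_angle_bounds (ltnW (ltn_ord i)).
  by have := tang_angleS kap s i; have := half_angle_gt0 kap s i; lra.
Qed.

Lemma nf_dual_normal i : dual_center K - cosh (dual_radius K) *: tang K i =
  P (- s ^+ 2) (- (c * s) * cos (A i.+1)) (- (c * s) * sin (A i.+1)).
Proof.
rewrite (nf_center nf) nf_cosh (nf_tang nf) [X in X - _](pt_o o e1 e2) ptZ ptN ptD.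
by congr (P _ _ _); rewrite ?add0r -?expr2 ?dual_c_sqr; ring.
Qed.

Lemma nf_hypercycle i u d : circ K i = Hypercycle u d ->
  forall x, 0 <= mink x u <-> 0 <= mink x (npole (circ K i)).
Proof.
move=> e x; have -> : u = pole (circ K i) by rewrite e.
by rewrite (pole_npole (wf i)) minkZr pmulr_rge0// radial_scale_gt0.
Qed.

Lemma nf_region_interior : region_nonempty_interior K.
Proof.
(* A ball about the dual centre, the sinh of its radius being 1 / a, fits into the half-planes as
   soon as c / a <= s and rho i / a <= kap i * c. *)
pose a := c / s + \sum_i rho i / (kap i * c).
have c0 := dual_c_gt0.
have tge0 i : 0 <= rho i / (kap i * c) by rewrite divr_ge0 ?mulr_ge0 ?ltW ?rho_gt0.
have cs : 0 < c / s by rewrite divr_gt0.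
have a0 : 0 < a by rewrite ltr_pwDl// sumr_ge0.
have [eps [se ce e0]] := arsinh a^-1; have ai : 0 < a^-1 by rewrite invr_gt0.
have ca : c * a^-1 <= s.
  by rewrite ler_pdivrMr// mulrC -ler_pdivrMr// lerDl sumr_ge0.
have ra i : rho i * a^-1 <= kap i * c.
  rewrite ler_pdivrMr// mulrC -ler_pdivrMr ?mulr_gt0// /a (bigD1 i)//= addrCA lerDl.
  by rewrite addr_ge0 ?(ltW cs)// sumr_ge0.
exists o, eps; split; [exact: hyp_o fr|exact: e0|].
move=> y hy; have [y0 [Y1 [Y2 ey]]] := ptP fr y.
have := hy; rewrite ey => /(hyp_pt fr) [yE yp].
rewrite minkC (mink_pto fr) ce => lt.
have y1 : 1 <= y0 by have := sqr_ge0 Y1; have := sqr_ge0 Y2; nra.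
have small : Y1 ^+ 2 + Y2 ^+ 2 < a^-1 ^+ 2.
  have : y0 ^+ 2 < Num.sqrt (1 + a^-1 ^+ 2) ^+ 2 by rewrite ltr_pXn2r ?nnegrE ?sqrtr_ge0 ?(ltW yp).
  by rewrite sqr_sqrtr ?(ltW (oneDsqr_gt0 _))//; lra.
split; first by rewrite -ey.
- move=> i; rewrite nf_dual_normal (mink_pt fr).
  have := linear_form_lt (A i.+1) ai small; set L := _ + _ => hL.
  have -> : y0 * - s ^+ 2 - Y1 * (- (c * s) * cos (A i.+1)) - Y2 * (- (c * s) * sin (A i.+1)) =
    s * (c * L - s * y0) by rewrite /L; ring.
  rewrite pmulr_rle0// subr_le0 (@le_trans _ _ (c * a^-1))// ?ler_pM2l// ?(ltW hL)//.
  by rewrite (le_trans ca)// ler_peMr// ltW.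
- move=> i u d e; apply/(nf_hypercycle e); rewrite nf_npole_psi (mink_pt fr).
  have := linear_form_lt (psi i) ai small; set L := _ + _ => hL.
  have -> : y0 * (kap i * c) - Y1 * (rho i * cos (psi i)) - Y2 * (rho i * sin (psi i)) =
    kap i * c * y0 - rho i * L by rewrite /L; ring.
  rewrite subr_ge0 (@le_trans _ _ (rho i * a^-1))// ?ler_pM2l ?rho_gt0// ?(ltW hL)//.
  by rewrite (le_trans (ra i))// ler_peMr// mulr_ge0 ?(ltW (k0 i)) ?(ltW c0).
Qed.

Lemma nf_region_bounded : region_compact_off_ideal_vertices K.
Proof.
have c0 := dual_c_gt0; have c2 := dual_c_sqr.
(* Majorizes the bounds on x0^2 in the circle and hypercycle sectors. For curvature 1 division by 0
   makes it 0; there the bound is [c]. *)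
pose B i := (1 + kap i ^+ 2) * c ^+ 2 / `|kap i ^+ 2 - 1|.
have B0 i : 0 <= B i by rewrite divr_ge0// mulr_ge0 ?sqr_ge0// ltW// oneDsqr_gt0.
exists (c + \sum_i B i) => x [hx reg1 reg2] nh.
have [x0 [X1 [X2 ex]]] := ptP fr x; rewrite ex in hx *.
rewrite (nf_center nf) (mink_pto fr).
have [xE xp] := (hyp_pt fr _ _ _).1 hx.
have x1 : 1 <= x0 by have := sqr_ge0 X1; have := sqr_ge0 X2; nra.
have [r [t [r0 ht e1X e2X]]] := polar X1 X2.
have [i /andP[t1 t2]] := sector sumd ht.
suff : x0 <= c \/ x0 ^+ 2 <= B i.
  case=> h; first by rewrite (le_trans h)// lerDl sumr_ge0.
  apply: (@le_trans _ _ (B i)).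
    by rewrite (le_trans _ h)// expr2 ler_peMl// ltW.
  by rewrite (bigD1 i)//= addrCA lerDl addr_ge0 ?(ltW c0)// sumr_ge0.
have d0 := half_angle_gt0 kap s i; have dlt := half_angle_lt (nf_kap nf) s0 i.
have AS := tang_angleS kap s i.
have pi0 := pi_gt0 R.
(* chi is the angular distance to the nearest end of the sector *)
have [chi [chi0 chid c1 c3]] : exists chi, [/\ 0 <= chi, chi <= del i,
    c * (r * cos chi) <= s * x0 & cos (t - psi i) = cos (del i - chi)].
  have hp (j : 'I_m) : c * (r * cos (t - A j.+1)) <= s * x0.
    have := reg1 j; rewrite ex nf_dual_normal (mink_pt fr) e1X e2X cosB.
    have -> : x0 * - s ^+ 2 - r * cos t * (- (c * s) * cos (A j.+1)) -
      r * sin t * (- (c * s) * sin (A j.+1)) =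
      s * (c * (r * (cos t * cos (A j.+1) + sin t * sin (A j.+1))) - s * x0) by ring.
    by rewrite pmulr_rle0// subr_le0.
  have [le|/ltW ge] := leP (t - A i) (del i).
    exists (t - A i); split=> //; first by lra.
      have := hp (ord_pred i); rewrite cosB.
      by have [-> ->] := tang_angle_pred sumd i; rewrite -cosB.
    by rewrite -cosN /axis_angle; congr cos; ring.
  exists (A i.+1 - t); split; [lra|lra| |].
    by rewrite -cosN opprB; exact: hp.
  by congr cos; rewrite AS /axis_angle; ring.
have r2 : r ^+ 2 = x0 ^+ 2 - 1.
  rewrite xE e1X e2X -[LHS]mulr1 -(cos2Dsin2 t); ring.
set C := r * cos chi in c1; pose S := r * sin chi.
have CS : C ^+ 2 + S ^+ 2 = x0 ^+ 2 - 1.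
  by rewrite !exprMn -mulrDr cos2Dsin2 mulr1.
have S0 : 0 <= S by rewrite mulr_ge0// sin_ge0_pi//; lra.
have CkS : kap i * s * S <= C.
  have : 0 <= rho i * (r * sin (del i - chi)).
    rewrite mulr_ge0 ?(ltW (rho_gt0 i))// mulr_ge0// sin_ge0_pi//; lra.
  rewrite sinB; have -> : rho i * (r * (sin (del i) * cos chi - cos (del i) * sin chi)) =
    (rho i * sin (del i)) * C - (rho i * cos (del i)) * S by rewrite /C /S; ring.
  by rewrite rho_cos rho_sin mul1r subr_ge0.
have NE : mink (P x0 X1 X2) (npole (circ K i)) = kap i * c * x0 - kap i * s * C - S.
  rewrite nf_npole_psi (mink_pt fr) e1X e2X.
  have -> : x0 * (kap i * c) - r * cos t * (rho i * cos (psi i)) - r * sin t * (rho i * sin (psi i)) =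
    kap i * c * x0 - rho i * r * (cos t * cos (psi i) + sin t * sin (psi i)) by ring.
  rewrite -cosB c3 cosB.
  have -> : rho i * r * (cos (del i) * cos chi + sin (del i) * sin chi) =
    (rho i * cos (del i)) * C + (rho i * sin (del i)) * S by rewrite /C /S; ring.
  by rewrite rho_cos rho_sin; ring.
case: (ltrgtP (kap i) 1) => k1.
- right; have k2 : 0 < 1 - kap i ^+ 2 by rewrite subr_gt0 exprn_ilt1// ltW.
  rewrite /B ltr0_norm ?opprB; last by lra.
  rewrite ler_pdivlMr// mulrC.
  have [u [d eu]] : exists u d, circ K i = Hypercycle u d.
    have := nf_curv nf i; have := wf i; case: (circ K i) => [u d|p|u d] /=.
    - move=> [_ d00] ek; have := sinh_gt0 d00 => sp; exfalso.
      have : cosh d < sinh d.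
        by move: k1; rewrite -ek ltr_pdivrMr// mul1r.
      by have := cosh2_sinh2 d; have := cosh_gt0 d; nra.
    - by move=> _ ek; rewrite -ek ltxx in k1.
    - by exists u, d.
  have N0 : 0 <= kap i * c * x0 - kap i * s * C - S.
    by rewrite -NE; apply/(nf_hypercycle eu); rewrite -ex; exact: reg2 eu.
  apply: le_trans (sector_hypercycle (k0 i) s0 c0 c2 xp CS S0 CkS c1 k1 N0) _.
  by rewrite ler_peMl ?sqr_ge0// lerDl sqr_ge0.
- right; have k2 : 0 < kap i ^+ 2 - 1 by rewrite subr_gt0 exprn_egt1.
  rewrite /B gtr0_norm// ler_pdivlMr// mulrC.
  apply: le_trans (sector_circle (k0 i) s0 c0 c2 xp CS S0 CkS c1) _.
  by rewrite ler_pM2r ?exprn_gt0// lerDr.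
- left; apply: (sector_horocycle (k := kap i) (s := s) (C := C) (S := S)) => //.
  have [p ep] : exists p, circ K i = Horocycle p.
    have := nf_curv nf i; have := wf i; case: (circ K i) => [u d|p|u d] /=.
    - move=> [_ d00] ek; have := sinh_gt0 d00 => sp; exfalso.
      have e : cosh d = sinh d by rewrite -[RHS]mul1r -k1 -ek divfK// gt_eqF.
      by have := cosh2_sinh2 d; rewrite e; lra.
    - by exists p.
    - move=> [_ d00] ek; have := cosh_gt0 d => sp; exfalso.
      have e : sinh d = cosh d by rewrite -[RHS]mul1r -k1 -ek divfK// gt_eqF.
      by have := cosh2_sinh2 d; rewrite e; lra.
  have := nh i p ep; rewrite -NE => h; rewrite ltNge; apply/negP => h'; apply: h.
  by apply/in_gcircleE; rewrite ?wf// ex (nf_curv nf) k1.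
Qed.

Lemma nf_is_configuration : is_configuration K.
Proof.
split.
- by split; [exact: nf_size nf|exact: wf|exact: nf_dual_wf].
- by split; [exact: nf_ext_tangent|exact: nf_disjoint|exact: nf_no_triple].
- by split; [exact: nf_on_dual|exact: nf_perpendicular|exact: nf_cyclic].
- exact: nf_region_interior.
- exact: nf_region_bounded.
Qed.

End NormalForm.

Lemma normal_form_exists (R : realType) (m : nat) (kap : 'I_m -> R) (o e1 e2 : 'rV[R]_3) (s : R) :
  frame o e1 e2 -> 0 < s -> (forall i, 0 < kap i) -> \sum_i half_angle kap s i = pi ->
  (3 <= m)%N -> exists K, normal_form K kap o e1 e2 s.
Proof.
move=> fr s0 k0 sumd m3; set c := Num.sqrt (1 + s ^+ 2).
have d0 := oneDsqr_gt0 s; have c0 : 0 < c by rewrite sqrtr_gt0.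
have c2 : c ^+ 2 = 1 + s ^+ 2 by rewrite sqr_sqrtr// ltW.
pose a (i : 'I_m) := tang_angle kap s i.+1.
pose n i := pt o e1 e2 (kap i * c) (kap i * s * cos (a i) + sin (a i))
  (kap i * s * sin (a i) - cos (a i)).
have h i : exists C, [/\ gcircle_wf C, curvature C = kap i & npole C = n i].
  apply: (gcircle_exists (k0 i) _ (hyp_o fr)); rewrite /n; last first.
    by rewrite (mink_pto fr) mulr_gt0.
  rewrite (mink_pt fr); have cs := cos2Dsin2 (a i).
  transitivity (kap i ^+ 2 * (c ^+ 2 - s ^+ 2 * (cos (a i) ^+ 2 + sin (a i) ^+ 2)) -
    (cos (a i) ^+ 2 + sin (a i) ^+ 2)); first by ring.
  by rewrite cs c2; ring.
have [C hC] := boolp.choice h.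
have [r [sr cr r0]] := arsinh s.
exists (Configuration C (fun i => pt o e1 e2 c (s * cos (a i)) (s * sin (a i))) o r).
by split=> //=; [exact: r0| | |] => i; case: (hC i).
Qed.

(** * Every configuration is in normal form *)

Section Tangencies.
Variable R : realType.

(** Incidence at the angle [phi] fixes the radial part [k * s] of the pole, and the norm leaves a
    tangential part e = 1 or e = -1. Incidence at [phi - g] then relates [e] to the half gap. *)
Lemma tangent_direction (k s c b1 b2 phi g : R) : 0 < s -> c ^+ 2 = 1 + s ^+ 2 ->
  c * (k * c) - s * cos phi * b1 - s * sin phi * b2 = k ->
  c * (k * c) - s * cos (phi - g) * b1 - s * sin (phi - g) * b2 = k ->
  (k * c) ^+ 2 - b1 ^+ 2 - b2 ^+ 2 = k ^+ 2 - 1 -> 0 < g -> g < 2 * pi ->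
  exists e, [/\ e = 1 \/ e = -1, b1 = k * s * cos phi + e * sin phi,
    b2 = k * s * sin phi - e * cos phi & e * cos (g / 2) = k * s * sin (g / 2)].
Proof.
move=> s0 c2 h1 h2 h3 g0 g1; have cs := cos2Dsin2 phi.
have cc : c * (k * c) = k * c ^+ 2 by ring.
rewrite cc c2 in h1 h2.
have p1 : cos phi * b1 + sin phi * b2 = k * s.
  by apply: (mulfI (lt0r_neq0 s0)); lra.
have p2 : cos (phi - g) * b1 + sin (phi - g) * b2 = k * s.
  by apply: (mulfI (lt0r_neq0 s0)); lra.
pose e := sin phi * b1 - cos phi * b2.
have b1E : b1 = k * s * cos phi + e * sin phi.
  rewrite -p1 /e -[LHS]mulr1 -cs; ring.
have b2E : b2 = k * s * sin phi - e * cos phi.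
  rewrite -p1 /e -[LHS]mulr1 -cs; ring.
have e2 : e ^+ 2 = 1.
  have : (k * s) ^+ 2 + e ^+ 2 = b1 ^+ 2 + b2 ^+ 2.
    rewrite -[RHS]mulr1 -cs -p1 /e; ring.
  by rewrite exprMn c2 in h3; rewrite exprMn; lra.
have hs : 0 < sin (g / 2) by apply: sin_gt0_pi; lra.
have gE : g = g / 2 *+ 2 by rewrite mulr2n -splitr.
have p3 : cos g * (k * s) + sin g * e = k * s.
  by rewrite -{1}p1 -p2 /e cosB sinB; ring.
exists e; split=> //.
  by move/eqP: e2; rewrite sqrf_eq1 => /orP[] /eqP; [left|right].
apply: (mulfI (lt0r_neq0 hs)); move: p3; rewrite gE cos_mulr2n sin_mulr2n -gE.
have -> : cos (g / 2) ^+ 2 = 1 - sin (g / 2) ^+ 2 by have := cos2Dsin2 (g / 2); lra.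
by rewrite !mulr2n; lra.
Qed.

Variables (m : nat) (K : configuration R m).
Hypothesis isK : is_configuration K.

Lemma configuration_normal_form : exists o e1 e2,
  normal_form K (fun i => curvature (circ K i)) o e1 e2 (sinh (dual_radius K)).
Proof.
case: isK => -[m3 wf wfD] [tgt _ _] [onD perp cyc] _ _.
have k0 i : 0 < curvature (circ K i) := curvature_gt0 (wf i).
move: wfD => /= [ho r0]; have s0 := sinh_gt0 r0.
have cc0 := cosh_gt0 (dual_radius K).
case: cyc => e1 [e2 [phi]] /=; set o := dual_center K in ho *.
set r := dual_radius K in r0 s0 cc0 *; set s := sinh r in s0 *; set c := cosh r in cc0 *.
move=> [[e11 e22 e12 oe1 oe2] tE mono bnd].
have fr : frame o e1 e2 by split.
have c2 : c ^+ 2 = 1 + s ^+ 2 := cosh2_sinh2 r.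
have cE : c = Num.sqrt (1 + s ^+ 2) by rewrite -c2 sqrtr_sqr ger0_norm// ltW.
have {}tE i : tang K i = pt o e1 e2 c (s * cos (phi i)) (s * sin (phi i)).
  by rewrite tE /pt scalerDr !scalerA addrA.
pose k i := curvature (circ K i).
have m0 : (0 < m)%N by rewrite (leq_trans _ m3).
pose i0 := Ordinal m0.
(* The predecessor of index 0 is the last index, so a full turn is added there. *)
pose gap (i : 'I_m) := phi i - phi (ord_pred i) + (if i == i0 then pi * 2 else 0).
have pi0 := pi_gt0 R.
have pred_lt (i : 'I_m) : i != i0 -> (ord_pred i < i)%N /\ (ord_pred i).+1 = i.
  case: i => -[|i] lt; first by rewrite -(inj_eq val_inj).
  by move=> _ /=; rewrite modnDr modn_small// (ltn_trans _ lt).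
have pred0 : (i0 < ord_pred i0)%N.
  by rewrite /= add0n modn_small ?ltn_predL// -ltnS prednK// (leq_trans _ m3).
have gap0 i : 0 < gap i.
  rewrite /gap; case: eqP => [->|/eqP /pred_lt[h _]]; first by have := bnd i0 (ord_pred i0); lra.
  by have := mono _ _ h; lra.
have gap2 i : gap i < 2 * pi.
  rewrite /gap; case: eqP => [->|_]; last by have := bnd (ord_pred i) i; lra.
  by have := mono _ _ pred0; lra.
have cs_pred i : cos (phi i - gap i) = cos (phi (ord_pred i)) /\
    sin (phi i - gap i) = sin (phi (ord_pred i)).
  have -> : phi i - gap i = phi (ord_pred i) - (if i == i0 then pi * 2 else 0).
    by rewrite /gap; ring.
  case: ifP => _; last by rewrite subr0.
  rewrite -(cosD2pi (_ - _)) -(sinD2pi (_ - _)).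
  by have -> : phi (ord_pred i) - pi * 2 + pi *+ 2 = phi (ord_pred i) by rewrite mulr_natr subrK.
have sum_gap : \sum_i gap i = 2 * pi.
  rewrite /gap big_split /= sumrB.
  have -> : \sum_i phi (ord_pred i) = \sum_i phi i.
    by rewrite [RHS](reindex_inj (@ord_pred_inj m)).
  rewrite subrr add0r -big_mkcond big_pred1_eq; ring.
have on_t i : mink (tang K i) (npole (circ K i)) = k i.
  by case: (tgt i) => _ /(on_gcircleE _ (wf i)).
have on_tp i : mink (tang K (ord_pred i)) (npole (circ K i)) = k i.
  by case: (tgt (ord_pred i)) => _ _; rewrite ord_predK => /(on_gcircleE _ (wf i)).
(* Expanding perpendicularity at the tangency point t, for a pole n, leaves <n, o> = <n, t> <o,
   t>. *)
have npo i : mink (npole (circ K i)) o = k i * c.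
  have [ht ot _ _] := tgt i; have := perp i _ ht (onD i) ot.
  have := onD i; rewrite /on_gcircle /= -/o -/r -/c => od.
  rewrite (normalE _ (wf i)) /normal /= -/o !minkE.
  rewrite (minkC (npole (circ K i)) (tang K i)) on_t (minkC o (tang K i)) od (minkC o (npole _)).
  rewrite ht.1 => h; have := radial_scale_gt0 (wf i) => w0.
  by apply: (mulfI (lt0r_neq0 w0)); lra.
have dir i : exists e b1 b2, [/\ npole (circ K i) = pt o e1 e2 (k i * c) b1 b2,
    e = 1 \/ e = -1, b1 = k i * s * cos (phi i) + e * sin (phi i),
    b2 = k i * s * sin (phi i) - e * cos (phi i) &
    e * cos (gap i / 2) = k i * s * sin (gap i / 2)].
  have [a [b1 [b2 en]]] := ptP fr (npole (circ K i)).
  have ea : a = k i * c by rewrite -npo en (mink_pto fr).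
  rewrite ea in en; have [cp sp] := cs_pred i.
  have h1 : c * (k i * c) - s * cos (phi i) * b1 - s * sin (phi i) * b2 = k i.
    by rewrite -(mink_pt fr) -tE -en on_t.
  have h2 : c * (k i * c) - s * cos (phi i - gap i) * b1 - s * sin (phi i - gap i) * b2 = k i.
    by rewrite cp sp -(mink_pt fr) -tE -en on_tp.
  have h3 : (k i * c) ^+ 2 - b1 ^+ 2 - b2 ^+ 2 = k i ^+ 2 - 1.
    by rewrite -(npole_sqr (wf i)) en (mink_pt fr); ring.
  have [e [ee e3 e4 e5]] := tangent_direction s0 c2 h1 h2 h3 (gap0 i) (gap2 i).
  by exists e, b1, b2; split.
have gapE i : gap i = 2 * half_angle k s i /\
    npole (circ K i) = pt o e1 e2 (k i * c) (k i * s * cos (phi i) + sin (phi i))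
      (k i * s * sin (phi i) - cos (phi i)).
  have [e [b1 [b2 [en ee b1E b2E eg]]]] := dir i.
  have ks : 0 < k i * s by rewrite mulr_gt0// k0.
  have g0 : 0 < gap i / 2 by rewrite divr_gt0.
  have g1 : gap i / 2 < pi by rewrite ltr_pdivrMr// mulrC.
  have [T1 T2] := tan_half_angle ks g0 g1 eg.
  case: ee => ee; subst e.
    split; first by rewrite /half_angle -(T1 erefl); field.
    by rewrite en b1E b2E !mul1r.
  (* otherwise [circ i] would overlap [circ (ordS i)] up to the tangency point
     number [ordS i] *)
  exfalso; pose j := ordS i; have {T1} gi := T2 erefl.
  have ij : i != j.
    apply/negP => /eqP /(congr1 val) /=; case: (ltnP i.+1 m) => h.
      by rewrite modn_small// => e; have := ltnSn i; rewrite -{2}e ltnn.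
    have e : i.+1 = m by apply/eqP; rewrite eqn_leq h ltn_ord.
    by rewrite e modnn => e0; move: m3; rewrite -e e0.
  have le2 : gap i + gap j <= 2 * pi.
    rewrite -sum_gap (bigD1 i)//= lerD2l (bigD1 j) 1?eq_sym//= lerDl.
    by rewrite sumr_ge0// => l _; rewrite ltW.
  set h := gap j / 2; set d := pi / 2 - atan (k i * s).
  (* With the wrong sign the gap of [i] is 2 (pi - d), so at most 2 d is left for that of [j]. *)
  have hd : h <= d by rewrite /h /d; lra.
  have h0 : 0 < h by rewrite divr_gt0.
  have dl : d < pi / 2 by rewrite /d ltrBlDr ltrDl -(@atan0 R) lt_atan.
  have sh : 0 < sin h by apply: sin_gt0_pi; lra.
  pose q := Num.sqrt (1 + (k i * s) ^+ 2).
  have q0 : 0 < q by rewrite sqrtr_gt0 oneDsqr_gt0.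
  have cd : q * cos d = k i * s := cos_pihalf_atan (k i * s).
  have sd : q * sin d = 1 := sin_pihalf_atan (k i * s).
  have chd : cos d <= cos h.
    have : (h == d) || (h < d) by rewrite -le_eqVlt.
    by case/orP => [/eqP -> //|hd']; rewrite ltW// ltr_cos ?in_itv /=; lra.
  have shd : sin h <= sin d.
    have : (h == d) || (h < d) by rewrite -le_eqVlt.
    by case/orP => [/eqP -> //|hd']; rewrite ltW// ltr_sin ?in_itv /=; lra.
  have csh : k i * s * sin h <= cos h.
    rewrite (le_trans _ chd)// -(ler_pM2l q0) cd mulrCA ger_pMr// -sd.
    by rewrite ler_pM2l.
  have gjE : gap j = h *+ 2 by rewrite /h mulr2n -splitr.
  have [cp sp] := cs_pred j; rewrite ordSK in cp sp.
  have inC : in_gcircle (circ K i) (tang K j).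
    apply/in_gcircleE => //; rewrite en tE (mink_pt fr) b1E b2E -/(k i) -cp -sp.
    have cs := cos2Dsin2 (phi j); have csh2 := cos2Dsin2 h.
    have -> : c * (k i * c) -
        s * cos (phi j) * (k i * s * cos (phi j - gap j) + -1 * sin (phi j - gap j)) -
        s * sin (phi j) * (k i * s * sin (phi j - gap j) - -1 * cos (phi j - gap j)) =
        k i * c ^+ 2 - s * (k i * s * cos (gap j) + sin (gap j)) * (cos (phi j) ^+ 2 + sin (phi j) ^+ 2).
      by rewrite cosB sinB; ring.
    rewrite cs mulr1 c2 gjE cos_mulr2n sin_mulr2n !mulr2n.
    have : 0 <= s * (sin h * (cos h - k i * s * sin h)).
      by rewrite mulr_ge0 ?(ltW s0)// mulr_ge0 ?(ltW sh)// subr_ge0.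
    have -> : cos h ^+ 2 = 1 - sin h ^+ 2 by rewrite -csh2; ring.
    by lra.
  have [_ _ otj _] := tgt i; have [htj ojj _ _] := tgt j.
  have inj : in_gcircle (circ K j) (tang K j).
    by apply/in_gcircleE => //; rewrite on_t.
  have [_ _ _ /(_ _ htj inC inj)] := tgt i.
  rewrite !tE => /(pt_inj fr) [_ h1 h2].
  have {}h1 := mulfI (lt0r_neq0 s0) h1; have {}h2 := mulfI (lt0r_neq0 s0) h2.
  have : cos (gap j) = 1.
    have -> : gap j = phi j - (phi j - gap j) by ring.
    by rewrite cosB cp sp -h1 -h2 -!expr2 cos2Dsin2.
  rewrite gjE cos_mulr2n mulr2n; have := cos2Dsin2 h => csh2.
  have : 0 < sin h ^+ 2 by rewrite exprn_gt0.
  by lra.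
(* The frame is rotated so that the last tangency point has angle pi, in agreement with
   [tang_angle], which starts from -pi. *)
pose last := ord_pred i0; pose rot := pi - phi last.
have sumd : \sum_i half_angle k s i = pi.
  have : 2 * \sum_i half_angle k s i = 2 * pi.
    by rewrite -sum_gap mulr_sumr; apply: eq_bigr => i _; case: (gapE i).
  by move=> h; lra.
have ang n (lt : (n < m)%N) : tang_angle k s n.+1 = phi (Ordinal lt) + rot.
  elim: n lt => [|n ih] lt.
    rewrite (tang_angleS k s (Ordinal lt)) tang_angle0 -(gapE _).1 /gap.
    have -> : Ordinal lt = i0 by exact/val_inj.
    by rewrite eqxx /rot /last; ring.
  rewrite (tang_angleS k s (Ordinal lt)) (ih (ltnW lt)) -(gapE _).1 /gap.
  have ne : Ordinal lt != i0 by rewrite -(inj_eq val_inj).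
  have -> : ord_pred (Ordinal lt) = Ordinal (ltnW lt).
    by apply/val_inj; case: (pred_lt _ ne) => _ /= [].
  by rewrite (negbTE ne); ring.
have {}ang (i : 'I_m) : phi i = tang_angle k s i.+1 - rot.
  by rewrite (ang i (ltn_ord i)) addrK; congr phi; exact/val_inj.
exists o, (cos rot *: e1 - sin rot *: e2), (sin rot *: e1 + cos rot *: e2).
have ptE a x y : pt o (cos rot *: e1 - sin rot *: e2) (sin rot *: e1 + cos rot *: e2) a x y =
    pt o e1 e2 a (x * cos rot + y * sin rot) (y * cos rot - x * sin rot).
  by apply/rowP => j; rewrite !mxE; ring.
split=> //; [exact: frame_rotate| | ] => i.
- by rewrite tE -cE ptE ang cosB sinB; congr (pt _ _ _ _ _ _); ring.
- rewrite (gapE i).2 -cE ptE ang cosB sinB /k; congr (pt _ _ _ _ _ _); ring.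
Qed.

End Tangencies.

Lemma normal_form_isometric (R : realType) m (K K' : configuration R m) kap o e1 e2 o' e1' e2' s :
  normal_form K kap o e1 e2 s -> normal_form K' kap o' e1' e2' s ->
  isometric_configuration K K'.
Proof.
move=> nf nf'; have fr := nf_frame nf; have fr' := nf_frame nf'.
exists (frame_map o e1 e2 o' e1' e2'); have iso := frame_map_isometry fr fr'.
split=> // i x hx; have w := nf_wf nf i; have w' := nf_wf nf' i.
rewrite !on_gcircleE//.
rewrite (nf_npole nf') -(frame_map_pt _ _ _ _ _ _ fr) iso.1.
by rewrite (nf_npole nf) (nf_curv nf) (nf_curv nf').
Qed.

(** * Sides of the interstice *)

Section ArcLength.
Variable R : realType.
Implicit Types (k s c r x y : R).

(** The equations of the arc hold on its parameter interval only, so they are differentiated at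
    interior points. *)
Lemma der_const_on (f : R -> R) v a b x d : a < x < b ->
  (forall y, a < y < b -> f y = v) -> is_derive x 1 f d -> d = 0.
Proof.
move=> hx hf [_ <-]; have hc : is_derive x 1 (fun=> v) (0 : R) by exact: derC.
have hn : \near x, (fun=> v) x = f x.
  have : x \in `]a, b[ by rewrite in_itv.
  move=> /near_in_itvoo; apply: filterS => y; rewrite in_itv /= => hy.
  by rewrite hf.
by have [_ <-] := near_eq_is_derive hn hc.
Qed.

Lemma der_comp (f g : R -> R) x a b : has_deriv f (g x) a -> has_deriv g x b ->
  has_deriv (fun y => f (g y)) x (a * b).
Proof. by move=> hf hg; exact: (@is_derive1_comp R f g). Qed.

Lemma half_arcN k x : 0 < k -> -1 < x < 1 -> half_arc k (- x) = - half_arc k x.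
Proof.
move=> k0 hx; rewrite /half_arc; case: ifP => k1 /=; first by rewrite mulrN atanN mulNr.
case: ifP => // k2; set b := Num.sqrt _.
have b2 : 0 < 1 - k ^+ 2 by rewrite subr_gt0 exprn_ilt1// ltW.
have bE : b ^+ 2 = 1 - k ^+ 2 by rewrite sqr_sqrtr// ltW.
have b0 : 0 < b by rewrite sqrtr_gt0.
have b1 : b < 1 by rewrite -(@ltr_pXn2r _ 2)// ?nnegrE ?(ltW b0)// bE expr1n gtrBl exprn_gt0.
case/andP: hx => x1 x2.
have hp : 0 < 1 + b * x by nra.
have hm : 0 < 1 - b * x by nra.
rewrite mulrN opprK -[RHS]mulNr; congr (_ / _).
by rewrite -lnV ?posrE ?divr_gt0// invf_div.
Qed.

Lemma half_curv_tanh k s : 0 < k -> half_curv k (k * s) =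
  k * half_arc k (s / Num.sqrt (1 + s ^+ 2)).
Proof.
move=> k0; rewrite /half_curv; congr (_ * half_arc _ _).
have -> : k ^+ 2 + (k * s) ^+ 2 = k ^+ 2 * (1 + s ^+ 2) by ring.
rewrite sqrtrM ?sqr_ge0// sqrtr_sqr gtr0_norm//.
have : 0 < Num.sqrt (1 + s ^+ 2) by rewrite sqrtr_gt0 oneDsqr_gt0.
by move=> h; field; rewrite !gt_eqF.
Qed.

Lemma der_mink (gam dgam : R -> 'rV[R]_3) x (v : 'rV[R]_3) :
  (forall j, is_derive x 1 (fun y => gam y ord0 j) (dgam x ord0 j)) ->
  has_deriv (fun y => mink (gam y) v) x (mink (dgam x) v).
Proof.
move=> h; rewrite /mink; apply: has_deriv_eq.
  by apply: derD; [apply: derD; [|apply: derN]|apply: derN];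
    (apply: derM; [exact: h|exact: derC]).
by rewrite !mulr0 !add0r; ring.
Qed.

Section Algebra.
Variables k s c rho X0 X1 X2 : R.
Hypotheses (k0 : 0 < k) (s0 : 0 < s) (c0 : 0 < c) (c2 : c ^+ 2 = 1 + s ^+ 2).
Hypotheses (rho0 : 0 < rho) (rho2 : rho ^+ 2 = 1 + (k * s) ^+ 2).
Hypotheses (hX : X0 ^+ 2 = 1 + X1 ^+ 2 + X2 ^+ 2) (X0_gt0 : 0 < X0)
  (onC : k * c * X0 - rho * X1 = k).

(** The product with (rho, k c, 0), which is orthogonal to the pole (k c, rho, 0). The slope of the
    arc seen from its pole is X2 / M. *)
Let M := rho * X0 - k * c * X1.

Lemma rho_kc : rho ^+ 2 - k ^+ 2 * c ^+ 2 = 1 - k ^+ 2.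
Proof. by rewrite rho2 c2 exprMn; ring. Qed.

Let rX1 : rho * X1 = k * (c * X0 - 1).
Proof. by have := onC; lra. Qed.

Lemma arc_M : rho * M = X0 + k ^+ 2 * (c - X0).
Proof.
have -> : rho * M = rho ^+ 2 * X0 - k * c * (rho * X1) by rewrite /M; ring.
have s2 : s ^+ 2 = c ^+ 2 - 1 by rewrite c2; ring.
by rewrite rX1 rho2 exprMn s2; ring.
Qed.

Lemma arc_M_sqr : M ^+ 2 - (1 - k ^+ 2) * X2 ^+ 2 = 1.
Proof.
have -> : X2 ^+ 2 = X0 ^+ 2 - X1 ^+ 2 - 1 by rewrite hX; ring.
rewrite -rho_kc.
have -> : M ^+ 2 - (rho ^+ 2 - k ^+ 2 * c ^+ 2) * (X0 ^+ 2 - X1 ^+ 2 - 1) =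
  (k * c * X0 - rho * X1) ^+ 2 + (rho ^+ 2 - k ^+ 2 * c ^+ 2) by rewrite /M; ring.
by rewrite onC rho_kc; ring.
Qed.

Hypothesis X0c : X0 <= c.

Lemma arc_M_gt0 : 0 < M.
Proof.
rewrite -(pmulr_rgt0 _ rho0) arc_M ltr_pwDl// mulr_ge0 ?sqr_ge0//.
by rewrite subr_ge0.
Qed.

Lemma arc_X2_le : (rho * X2) ^+ 2 <= s ^+ 2.
Proof.
have -> : (rho * X2) ^+ 2 = rho ^+ 2 * (X0 ^+ 2 - 1) - (rho * X1) ^+ 2 by rewrite hX; ring.
rewrite rX1 rho2 !exprMn.
have -> : s ^+ 2 = c ^+ 2 - 1 by rewrite c2; ring.
rewrite -subr_ge0; have -> : c ^+ 2 - 1 - ((1 + k ^+ 2 * (c ^+ 2 - 1)) * (X0 ^+ 2 - 1) -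
  k ^+ 2 * (c * X0 - 1) ^+ 2) = (c - X0) * (c + X0 + k ^+ 2 * (c - X0)) by ring.
have k2 := sqr_ge0 k; have d : 0 <= c - X0 by rewrite subr_ge0.
by rewrite mulr_ge0// addr_ge0 ?(mulr_ge0 k2 d)// addr_ge0 ?(ltW c0) ?(ltW X0_gt0).
Qed.

Lemma arc_slope : -1 < X2 / M < 1.
Proof.
have M0 := arc_M_gt0; have M2 := arc_M_sqr.
have kX : (k * X2) ^+ 2 < 1.
  have r2 : 0 < rho ^+ 2 by rewrite exprn_gt0.
  rewrite -(ltr_pM2l r2) mulr1; have := arc_X2_le.
  have -> : rho ^+ 2 * (k * X2) ^+ 2 = k ^+ 2 * (rho * X2) ^+ 2 by ring.
  move=> /(ler_wpM2l (sqr_ge0 k)) /le_lt_trans; apply.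
  by rewrite rho2 exprMn ltrDr.
have : X2 ^+ 2 < M ^+ 2 by move: kX; rewrite exprMn; lra.
rewrite -[X2 ^+ 2]real_normK ?num_real// ltr_pXn2r ?nnegrE ?(ltW M0)// => h.
by rewrite -ltr_norml normrM normfV (gtr0_norm M0) ltr_pdivrMr// mul1r.
Qed.

Lemma arc_slope_den : 1 + (k ^+ 2 - 1) * (X2 / M) ^+ 2 = (M ^+ 2)^-1.
Proof.
have M0 := arc_M_gt0; have M2 := arc_M_sqr.
apply: (mulfI (expf_neq0 2 (lt0r_neq0 M0))); rewrite divff ?expf_neq0 ?gt_eqF//.
have -> : M ^+ 2 * (1 + (k ^+ 2 - 1) * (X2 / M) ^+ 2) = M ^+ 2 + (k ^+ 2 - 1) * X2 ^+ 2.
  by field; rewrite gt_eqF.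
by move: M2; lra.
Qed.

Variables Y0 Y1 Y2 : R.
Hypotheses (dC : k * c * Y0 - rho * Y1 = 0) (dH : X0 * Y0 - X1 * Y1 - X2 * Y2 = 0)
  (speed : Y0 ^+ 2 - Y1 ^+ 2 - Y2 ^+ 2 = -1).

(* The slope [X2 / M] satisfies the Riccati equation
   [x' = +- (1 + (k ^+ 2 - 1) * x ^+ 2)]. *)
Lemma arc_speed : (Y2 * M - X2 * (rho * Y0 - k * c * Y1)) ^+ 2 = 1.
Proof.
have M0 := arc_M_gt0; have M2 := arc_M_sqr; have rk := rho_kc.
have rY1 : rho * Y1 = k * c * Y0 by have := dC; lra.
set M' := rho * Y0 - k * c * Y1; set E := Y2 * M - X2 * M'.
have e1 : Y0 * M = rho * (X2 * Y2).
  have -> : X2 * Y2 = X0 * Y0 - X1 * Y1 by have := dH; lra.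
  have -> : rho * (X0 * Y0 - X1 * Y1) = rho * X0 * Y0 - X1 * (rho * Y1) by ring.
  by rewrite rY1 /M; ring.
have e2 : rho * M' = (1 - k ^+ 2) * Y0.
  have -> : rho * M' = rho ^+ 2 * Y0 - k * c * (rho * Y1) by rewrite /M'; ring.
  by rewrite rY1 -rk; ring.
have e3 : E * M = Y2.
  apply: (mulfI (lt0r_neq0 rho0)).
  have -> : rho * (E * M) = rho * Y2 * M ^+ 2 - X2 * (rho * M') * M by rewrite /E; ring.
  rewrite e2; have -> : X2 * ((1 - k ^+ 2) * Y0) * M = (1 - k ^+ 2) * X2 * (Y0 * M) by ring.
  rewrite e1; have -> : rho * Y2 * M ^+ 2 - (1 - k ^+ 2) * X2 * (rho * (X2 * Y2)) =
    rho * Y2 * (M ^+ 2 - (1 - k ^+ 2) * X2 ^+ 2) by ring.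
  by rewrite M2 mulr1.
have e4 : (1 - k ^+ 2) * Y0 ^+ 2 = rho ^+ 2 * (Y2 ^+ 2 - 1).
  have -> : Y2 ^+ 2 - 1 = Y0 ^+ 2 - Y1 ^+ 2 by have := speed; lra.
  have -> : rho ^+ 2 * (Y0 ^+ 2 - Y1 ^+ 2) = rho ^+ 2 * Y0 ^+ 2 - (rho * Y1) ^+ 2 by ring.
  by rewrite rY1 -rk; ring.
have e5 : Y2 ^+ 2 = M ^+ 2.
  have r2 : rho ^+ 2 != 0 by rewrite expf_neq0// gt_eqF.
  have : rho ^+ 2 * ((1 - k ^+ 2) * (X2 * Y2) ^+ 2) = rho ^+ 2 * ((Y2 ^+ 2 - 1) * M ^+ 2).
    have -> : rho ^+ 2 * ((1 - k ^+ 2) * (X2 * Y2) ^+ 2) = (1 - k ^+ 2) * (rho * (X2 * Y2)) ^+ 2 by ring.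
    rewrite -e1; have -> : (1 - k ^+ 2) * (Y0 * M) ^+ 2 = (1 - k ^+ 2) * Y0 ^+ 2 * M ^+ 2 by ring.
    by rewrite e4; ring.
  move=> /(mulfI r2) h.
  have : Y2 ^+ 2 * (M ^+ 2 - (1 - k ^+ 2) * X2 ^+ 2) = M ^+ 2 by move: h; rewrite exprMn; lra.
  by rewrite M2 mulr1.
apply: (mulfI (expf_neq0 2 (lt0r_neq0 M0))); rewrite mulr1 -exprMn mulrC e3.
exact: e5.
Qed.

End Algebra.

(** [half_arc k] applied to the slope has derivative 1 or -1 along the arc, and goes from minus to
    plus its value at s / c, the tanh of the dual radius. The mean value theorem uses the sign at
    one point only, and the positivity of [ell] and of the increment selects 1. *)
Lemma arc_length (o a e : 'rV[R]_3) k s c rho (gam dgam : R -> 'rV[R]_3) (ell : R) :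
  frame o a e -> 0 < k -> 0 < s -> c = Num.sqrt (1 + s ^+ 2) ->
  0 < rho -> rho ^+ 2 = 1 + (k * s) ^+ 2 -> 0 < ell ->
  gam 0 = pt o a e c (k * s ^+ 2 / rho) (- (s / rho)) ->
  gam ell = pt o a e c (k * s ^+ 2 / rho) (s / rho) ->
  (forall x, 0 <= x <= ell -> [/\ hyp (gam x), mink (gam x) (pt o a e (k * c) rho 0) = k &
     mink (gam x) o <= c]) ->
  (forall x j, 0 <= x <= ell -> is_derive x 1 (fun y => gam y ord0 j) (dgam x ord0 j)) ->
  (forall x, 0 <= x <= ell -> mink (dgam x) (dgam x) = -1) ->
  k * ell = 2 * half_curv k (k * s).
Proof.
move=> fr k0 s0 cE rho0 rho2 ell0 g0 g1 hg dg sp.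
have c0 : 0 < c by rewrite cE sqrtr_gt0 oneDsqr_gt0.
have c2 : c ^+ 2 = 1 + s ^+ 2 by rewrite cE sqr_sqrtr// ltW// oneDsqr_gt0.
have coord v : v = pt o a e (mink v o) (- mink v a) (- mink v e).
  by rewrite {1}(frame_decomp v fr) /pt !scaleNr.
pose X0 x := mink (gam x) o; pose X1 x := - mink (gam x) a; pose X2 x := - mink (gam x) e.
pose Y0 x := mink (dgam x) o; pose Y1 x := - mink (dgam x) a; pose Y2 x := - mink (dgam x) e.
pose M x := rho * X0 x - k * c * X1 x; pose M' x := rho * Y0 x - k * c * Y1 x.
have dX0 x : 0 <= x <= ell -> has_deriv X0 x (Y0 x).
  by move=> hx; apply: der_mink => j; exact: dg.
have dX1 x : 0 <= x <= ell -> has_deriv X1 x (Y1 x).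
  by move=> hx; apply: derN; apply: der_mink => j; exact: dg.
have dX2 x : 0 <= x <= ell -> has_deriv X2 x (Y2 x).
  by move=> hx; apply: derN; apply: der_mink => j; exact: dg.
have dM x : 0 <= x <= ell -> has_deriv M x (M' x).
  move=> hx; apply: has_deriv_eq.
    apply: derD; first by apply: derM; [exact: derC|exact: dX0].
    by apply: derN; apply: derM; [exact: derC|exact: dX1].
  by rewrite /M'; ring.
have pts x : 0 <= x <= ell -> [/\ X0 x ^+ 2 = 1 + X1 x ^+ 2 + X2 x ^+ 2, 0 < X0 x,
    k * c * X0 x - rho * X1 x = k & X0 x <= c].
  move=> hx; have [h1 h2 h3] := hg x hx; move: h1 h2.
  rewrite {1 2}(coord (gam x)) (mink_pt fr) => /(hyp_pt fr) [h1 h1'] h2.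
  by split=> //; rewrite -[RHS]h2 /X0 /X1; ring.
have M0 x : 0 <= x <= ell -> 0 < M x.
  by move=> /pts [h1 h2 h3 h4]; exact: (arc_M_gt0 c2 rho0 rho2 h2 h3 h4).
have slope x : 0 <= x <= ell -> -1 < X2 x / M x < 1.
  by move=> /pts [h1 h2 h3 h4]; exact: (arc_slope c0 c2 rho0 rho2 h1 h2 h3 h4).
pose H x := half_arc k (X2 x / M x).
pose E x := Y2 x * M x - X2 x * M' x.
have dH x : 0 <= x <= ell -> is_derive x 1 H (E x).
  move=> hx; have [h1 h2 h3 h4] := pts x hx.
  have Mn : M x != 0 by rewrite gt_eqF// M0.
  apply: has_deriv_eq.
    apply: (der_comp (f := half_arc k)); first exact: (is_derive_half_arc k0 (slope x hx)).
    by apply: derM; [exact: dX2|apply: derV => //; exact: dM].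
  have den : 1 + (k ^+ 2 - 1) * (X2 x / M x) ^+ 2 = (M x ^+ 2)^-1.
    exact: (arc_slope_den c2 rho0 rho2 h1 h2 h3 h4).
  by rewrite /= den invrK /E; field.
have [x hx eH] := mvt ell0 dH.
have hx' : 0 <= x <= ell by case/andP: hx => h1 h2; rewrite !ltW.
have E2 : E x ^+ 2 = 1.
  have [h1 h2 h3 h4] := pts x hx'.
  apply: (arc_speed c2 rho0 rho2 h1 h2 h3 h4 (Y0 := Y0 x) (Y1 := Y1 x) (Y2 := Y2 x)).
  - have dd : is_derive x 1 (fun y => k * c * X0 y - rho * X1 y) (k * c * Y0 x - rho * Y1 x).
      apply: has_deriv_eq.
        apply: derD; first by apply: derM; [exact: derC|exact: dX0].
        by apply: derN; apply: derM; [exact: derC|exact: dX1].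
      by rewrite /=; ring.
    apply: (der_const_on (v := k) hx _ dd) => y /andP[y1 y2].
    by have [] : [/\ X0 y ^+ 2 = 1 + X1 y ^+ 2 + X2 y ^+ 2, 0 < X0 y,
      k * c * X0 y - rho * X1 y = k & X0 y <= c] by apply: pts; rewrite !ltW.
  - have dd : is_derive x 1 (fun y => X0 y * X0 y - X1 y * X1 y - X2 y * X2 y)
        (2 * (X0 x * Y0 x - X1 x * Y1 x - X2 x * Y2 x)).
      apply: has_deriv_eq.
        apply: derD; first apply: derD; first by apply: derM; exact: dX0.
          by apply: derN; apply: derM; exact: dX1.
        by apply: derN; apply: derM; exact: dX2.
      by rewrite /=; ring.
    have : 2 * (X0 x * Y0 x - X1 x * Y1 x - X2 x * Y2 x) = 0.
      apply: (der_const_on (v := 1) hx _ dd) => y /andP[y1 y2].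
      have [q1 _ _ _] : [/\ X0 y ^+ 2 = 1 + X1 y ^+ 2 + X2 y ^+ 2, 0 < X0 y,
        k * c * X0 y - rho * X1 y = k & X0 y <= c] by apply: pts; rewrite !ltW.
      by rewrite -!expr2 q1; ring.
    by move=> h; lra.
  - have := sp x hx'; rewrite {1 2}(coord (dgam x)) (mink_pt fr) => h.
    by rewrite -[RHS]h /Y0 /Y1 /Y2; ring.
have rn : rho != 0 by rewrite gt_eqF.
have cn : c != 0 by rewrite gt_eqF.
have MM (v : 'rV[R]_3) y2 : v = pt o a e c (k * s ^+ 2 / rho) y2 ->
    rho * mink v o - k * c * - mink v a = c / rho /\ - mink v e = y2.
  move=> ev; have := coord v; rewrite {1}ev => /(pt_inj fr) [<- <- <-]; split=> //.
  have -> : rho * c - k * c * (k * s ^+ 2 / rho) = (rho ^+ 2 - (k * s) ^+ 2) * c / rho by field.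
  by rewrite rho2 addrK mul1r.
have [M_0 X2_0] := MM _ _ g0; have [M_1 X2_1] := MM _ _ g1.
have tau0 : s / rho / (c / rho) = s / c by field; rewrite rn cn.
have tau1 : -1 < s / c < 1.
  have sc : s < c.
    by rewrite -(@ltr_pXn2r _ 2)// ?nnegrE ?(ltW s0) ?(ltW c0)// c2 ltrDr.
  by rewrite ltr_pdivrMr// ltr_pdivlMr// mul1r sc andbT mulN1r; lra.
have H1 : H ell = half_arc k (s / c) by rewrite /H /M /X2 /X0 /X1 M_1 X2_1 tau0.
have H0 : H 0 = - half_arc k (s / c).
  by rewrite /H /M /X2 /X0 /X1 M_0 X2_0 mulNr tau0 half_arcN.
have hc := half_curv_tanh s k0; rewrite -cE in hc.
have pos : 0 < half_arc k (s / c).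
  by rewrite -(pmulr_rgt0 _ k0) -hc half_curv_gt0// mulr_gt0.
rewrite hc; move: eH; rewrite H1 H0 opprK subr0 => eH.
move/eqP: E2; rewrite sqrf_eq1 => /orP[] /eqP Ex; rewrite Ex in eH; nra.
Qed.

(** [S] and [V] are a generalized sine and versine, which parametrize the arc by length from its
    midpoint; [x0] is the time at which the slope S / (1 + (1 - k^2) V) reaches [t]. *)
Lemma curvature_flow (k t : R) : 0 < k -> 0 < t < 1 -> exists (S V : R -> R) (x0 : R),
  [/\ 0 < x0, forall x, is_derive x 1 V (S x),
      forall x, is_derive x 1 S (1 + (1 - k ^+ 2) * V x) &
  [/\ forall x, S x ^+ 2 = 2 * V x + (1 - k ^+ 2) * V x ^+ 2,
      forall x, V (- x) = V x /\ S (- x) = - S x, V 0 = 0,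
      forall x, 0 <= x <= x0 -> 0 <= S x &
      S x0 = t * (1 + (1 - k ^+ 2) * V x0) /\ 0 < 1 + (1 - k ^+ 2) * V x0]].
Proof.
move=> k0 /andP[t0 t1]; case: (ltrgtP k 1) => k1.
- have b2 : 0 < 1 - k ^+ 2 by rewrite subr_gt0 exprn_ilt1// ltW.
  set b := Num.sqrt (1 - k ^+ 2); have b0 : 0 < b by rewrite sqrtr_gt0.
  have bE : 1 - k ^+ 2 = b ^+ 2 by rewrite sqr_sqrtr// ltW.
  have bn : b != 0 by rewrite gt_eqF.
  have b1 : b < 1 by rewrite -(@ltr_pXn2r _ 2)// ?nnegrE ?(ltW b0)// -bE expr1n gtrBl exprn_gt0.
  have bt : (b * t) ^+ 2 < 1.
    by rewrite exprn_ilt1// ?mulr_ge0 ?(ltW b0) ?(ltW t0)// mulr_ilt1// ltW.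
  pose q := b * t / Num.sqrt (1 - (b * t) ^+ 2).
  have d0 : 0 < 1 - (b * t) ^+ 2 by rewrite subr_gt0.
  have d1 : 0 < Num.sqrt (1 - (b * t) ^+ 2) by rewrite sqrtr_gt0.
  have d2 : Num.sqrt (1 - (b * t) ^+ 2) ^+ 2 = 1 - (b * t) ^+ 2 by rewrite sqr_sqrtr// ltW.
  have [y [sy cy y0]] := arsinh q.
  have q0 : 0 < q by rewrite divr_gt0// mulr_gt0.
  have {}cy : cosh y = (Num.sqrt (1 - (b * t) ^+ 2))^-1.
    rewrite cy; have -> : 1 + q ^+ 2 = (Num.sqrt (1 - (b * t) ^+ 2))^-1 ^+ 2.
      rewrite /q exprMn exprVn d2; field; by rewrite gt_eqF.
    by rewrite sqrtr_sqr ger0_norm// invr_ge0 ltW.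
  have sN x : sinh (- x) = - sinh x by rewrite /sinh opprK; ring.
  have cN x : cosh (- x) = cosh x by rewrite /cosh opprK; ring.
  exists (fun x => sinh (b * x) / b), (fun x => (cosh (b * x) - 1) / b ^+ 2), (y / b).
  have by_ : b * (y / b) = y by rewrite mulrCA divff ?mulr1.
  have CE x : 1 + b ^+ 2 * ((cosh (b * x) - 1) / b ^+ 2) = cosh (b * x).
    by rewrite mulrCA divff ?expf_neq0// mulr1; ring.
  rewrite bE; split; first by rewrite divr_gt0// y0.
  + move=> x; rewrite /cosh /sinh; apply: has_deriv_eq; first by der.
    by rewrite /=; field.
  + move=> x; rewrite CE /cosh /sinh; apply: has_deriv_eq; first by der.
    by rewrite /=; field.
  split.
  + move=> x; rewrite -[RHS]mulr1; have := cosh2_sinh2 (b * x) => h.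
    have e : sinh (b * x) ^+ 2 = cosh (b * x) ^+ 2 - 1 by rewrite h; ring.
    by rewrite exprMn e; field.
  + by move=> x; rewrite mulrN cN sN mulNr.
  + by rewrite mulr0 /cosh oppr0 expR0; field.
  + move=> x /andP[x0 _]; rewrite divr_ge0 ?(ltW b0)//.
    have : 0 <= b * x by rewrite mulr_ge0// ltW.
    by rewrite le_eqVlt => /predU1P[<-|/sinh_gt0/ltW//]; rewrite /sinh oppr0 subrr mul0r.
  + rewrite CE by_ cy sy /q; split; last by rewrite invr_gt0.
    by field; rewrite bn gt_eqF.
- have b2 : 0 < k ^+ 2 - 1 by rewrite subr_gt0 exprn_egt1.
  set b := Num.sqrt (k ^+ 2 - 1); have b0 : 0 < b by rewrite sqrtr_gt0.
  have bE : 1 - k ^+ 2 = - b ^+ 2 by rewrite sqr_sqrtr ?opprB// ltW.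
  have bn : b != 0 by rewrite gt_eqF.
  exists (fun x => sin (b * x) / b), (fun x => (1 - cos (b * x)) / b ^+ 2), (atan (b * t) / b).
  set y := atan (b * t).
  have bt : 0 < b * t by rewrite mulr_gt0.
  have y0 : 0 < y by rewrite -(@atan0 R) lt_atan.
  have y1 : y < pi / 2 := atan_ltpi2 _.
  have pi0 := pi_gt0 R.
  have cy : 0 < cos y by apply: cos_gt0_pihalf; lra.
  have sy : sin y = b * t * cos y.
    have : tan y = b * t by rewrite atanK.
    by rewrite /tan => <-; rewrite divfK// gt_eqF.
  have by_ : b * (y / b) = y by rewrite mulrCA divff ?mulr1.
  have CE x : 1 + - b ^+ 2 * ((1 - cos (b * x)) / b ^+ 2) = cos (b * x).
    by rewrite mulNr mulrCA divff ?expf_neq0// mulr1; ring.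
  rewrite bE; split; first by rewrite divr_gt0.
  + move=> x; apply: has_deriv_eq; first by der.
    by rewrite /=; field.
  + move=> x; rewrite CE; apply: has_deriv_eq; first by der.
    by rewrite /=; field.
  split.
  + move=> x; have e : sin (b * x) ^+ 2 = 1 - cos (b * x) ^+ 2.
      by rewrite -(cos2Dsin2 (b * x)); ring.
    by rewrite exprMn e; field.
  + by move=> x; rewrite mulrN cosN sinN mulNr.
  + by rewrite mulr0 cos0 subrr mul0r.
  + move=> x /andP[x0 xy]; rewrite divr_ge0 ?(ltW b0)// sin_ge0_pi//.
    have : 0 <= b * x by rewrite mulr_ge0// ltW.
    have : b * x <= y by rewrite -by_ ler_pM2l.
    by lra.
  + rewrite CE by_ sy; split=> //; by field.
- exists (fun x => x), (fun x => x ^+ 2 / 2), t; rewrite k1 expr1n subrr.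
  split=> //; [| |split].
  + move=> x; apply: has_deriv_eq; first by der.
    by rewrite /=; field.
  + by move=> x; rewrite mul0r addr0; exact: derI.
  + by move=> x; field.
  + by move=> x; rewrite sqrrN.
  + by rewrite expr0n /= mul0r.
  + by move=> x /andP[].
  + by rewrite mul0r addr0 mulr1.
Qed.

End ArcLength.

(** The last bracket is the square of the transverse coordinate, by the quadratic relation between
    [S] and [V]. Denominators are cleared by rho^2. *)
Lemma arc_on_hyp (R : realType) (k s c rho w p q d : R) :
  c ^+ 2 = 1 + s ^+ 2 -> rho ^+ 2 = 1 + (k * s) ^+ 2 -> rho != 0 ->
  p * rho = s -> q * rho = k * s ^+ 2 -> d * rho = c ->
  (c + rho * w) ^+ 2 =
    1 + (q + k * c * w) ^+ 2 + (p ^+ 2 + 2 * w * d + (1 - k ^+ 2) * w ^+ 2).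
Proof.
move=> c2 r2 rn pq qq dq; have s2 : s ^+ 2 = c ^+ 2 - 1 by rewrite c2; ring.
apply: (mulfI (expf_neq0 2 rn)); apply/eqP; rewrite -subr_eq0; apply/eqP.
have -> : rho ^+ 2 * (c + rho * w) ^+ 2 - rho ^+ 2 *
    (1 + (q + k * c * w) ^+ 2 + (p ^+ 2 + 2 * w * d + (1 - k ^+ 2) * w ^+ 2)) =
  rho ^+ 2 * (c + rho * w) ^+ 2 - (rho ^+ 2 + (q * rho + rho * k * c * w) ^+ 2 +
   (p * rho) ^+ 2 + 2 * w * rho * (d * rho) + rho ^+ 2 * (1 - k ^+ 2) * w ^+ 2) by ring.
rewrite qq pq dq s2.
transitivity ((rho ^+ 2 - 1 - k ^+ 2 * (c ^+ 2 - 1)) *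
  (c ^+ 2 - 1 + 2 * c * rho * w + w ^+ 2 * rho ^+ 2)); first by ring.
by rewrite r2 exprMn s2; ring.
Qed.

(** * Length and existence of the side on one circle *)

Section Sides.
Variables (R : realType) (m : nat) (K : configuration R m) (kap : 'I_m -> R).
Variables (o e1 e2 : 'rV[R]_3) (s : R).
Hypothesis nf : normal_form K kap o e1 e2 s.
Variable i : 'I_m.

Local Notation c := (Num.sqrt (1 + s ^+ 2)).
Local Notation k := (kap i).
Local Notation rho := (axis_coef kap s i).

(** Rotating by [- axis_angle] puts the pole in the plane of [o] and [a], and makes the two tangency
    points symmetric about it. *)
Lemma nf_local_frame : exists a e, [/\ frame o a e,
  npole (circ K i) = pt o a e (k * c) rho 0,
  tang K (ord_pred i) = pt o a e c (k * s ^+ 2 / rho) (- (s / rho)) &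
  tang K i = pt o a e c (k * s ^+ 2 / rho) (s / rho)].
Proof.
have fr := nf_frame nf; have s0 := nf_s nf; have k0 := nf_kap nf.
pose r := - axis_angle kap s i.
exists (cos r *: e1 - sin r *: e2), (sin r *: e1 + cos r *: e2).
have ptE a x y : pt o (cos r *: e1 - sin r *: e2) (sin r *: e1 + cos r *: e2) a x y =
    pt o e1 e2 a (x * cos r + y * sin r) (y * cos r - x * sin r).
  by apply/rowP => j; rewrite !mxE; ring.
have rn : rho != 0 by rewrite gt_eqF// rho_gt0.
have q1 : k * s ^+ 2 / rho = s * cos (half_angle kap s i).
  apply: (mulfI rn); rewrite mulrCA divff// mulr1.
  by transitivity (s * (k * s)); [ring|rewrite -(rho_cos kap s i); ring].
have q2 : s / rho = s * sin (half_angle kap s i).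
  by apply: (mulfI rn); rewrite mulrCA divff// [RHS]mulrCA rho_sin.
split; first exact: frame_rotate.
- rewrite (nf_npole_psi nf) ptE /r cosN sinN; congr (pt _ _ _ _ _ _); ring.
- rewrite (nf_tang_pred nf) ptE /r cosN sinN q1 q2.
  have -> : tang_angle kap s i = axis_angle kap s i - half_angle kap s i.
    by rewrite /axis_angle addrK.
  by rewrite cosB sinB; congr (pt _ _ _ _ _ _); ring.
- rewrite (nf_tang nf) ptE /r cosN sinN q1 q2.
  have -> : tang_angle kap s i.+1 = axis_angle kap s i + half_angle kap s i.
    by rewrite tang_angleS /axis_angle; ring.
  by rewrite cosD sinD; congr (pt _ _ _ _ _ _); ring.
Qed.

Lemma nf_in_dual x : in_gcircle (dual_circle K) x <-> mink x o <= c.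
Proof. by rewrite /in_gcircle /= (nf_center nf) (nf_cosh nf). Qed.

Lemma nf_side_curv ell : side_length K i ell -> k * ell = 2 * half_curv k (k * s).
Proof.
case=> ell0 [gam [dgam [[g0 g1] hg dg _ sp]]].
have [a [e [fr en et0 et1]]] := nf_local_frame.
have wf := nf_wf nf i.
apply: (arc_length (o := o) (a := a) (e := e) (rho := rho) (gam := gam) (dgam := dgam)
  fr (nf_kap nf i) (nf_s nf) erefl (rho_gt0 _ _ _) (rho_sqr _ _ _) ell0).
- by rewrite g0 et0.
- by rewrite g1 et1.
- move=> x /hg [h1 /(on_gcircleE _ wf) h2 /nf_in_dual h3]; split=> //.
  by rewrite -en h2 (nf_curv nf).
- exact: sp.
Qed.

Lemma nf_side_exists : exists ell, side_length K i ell.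
Proof.
have [a [e [fr en et0 et1]]] := nf_local_frame.
have k0 := nf_kap nf i; have s0 := nf_s nf; have wf := nf_wf nf i.
have r0 : 0 < rho := rho_gt0 _ _ _; have r2 : rho ^+ 2 = 1 + (k * s) ^+ 2 := rho_sqr _ _ _.
have c0 : 0 < c := dual_c_gt0 s; have c2 : c ^+ 2 = 1 + s ^+ 2 := dual_c_sqr s.
have rn : rho != 0 by rewrite gt_eqF.
have cn : c != 0 by rewrite gt_eqF.
have t01 : 0 < s / c < 1.
  rewrite divr_gt0//= ltr_pdivrMr// mul1r -(@ltr_pXn2r _ 2)// ?nnegrE ?(ltW s0) ?(ltW c0)//.
  by rewrite c2 ltrDr.
have [S [V [x0 [x0p dV dS [S2 VN V00 Sp [Sx0 Cx0]]]]]] := curvature_flow k0 t01.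
set V0 := V x0 in Sx0 Cx0; pose al := 1 - k ^+ 2.
have rk : rho ^+ 2 - k ^+ 2 * c ^+ 2 = al by rewrite /al r2 c2 exprMn; ring.
(* Combines the slope s / c at the end of the arc with the relation (1 + al V)^2 - al S^2 = 1. *)
have C0E : 1 + al * V0 = c / rho.
  apply/eqP; rewrite -(@eqrXn2 _ 2) ?(ltW Cx0) ?divr_ge0 ?(ltW c0) ?(ltW r0)//; apply/eqP.
  have e1' : (1 + al * V0) ^+ 2 - al * S x0 ^+ 2 = 1 by rewrite S2 -/V0 /al; ring.
  rewrite Sx0 -/al in e1'.
  have e2' : (1 + al * V0) ^+ 2 * (c ^+ 2 - al * s ^+ 2) = c ^+ 2.
    rewrite -[RHS]mulr1 -[X in _ = _ * X]e1'; by field.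
  have e3' : c ^+ 2 - al * s ^+ 2 = rho ^+ 2 by rewrite r2 c2 /al exprMn; ring.
  by rewrite expr_div_n -e2' e3' mulfK// expf_neq0.
have S0E : S x0 = s / rho by rewrite Sx0 -/al C0E; field; rewrite cn rn.
have Vle y : 0 <= y <= x0 -> 0 <= V y <= V0.
  move=> /andP[y0 yx].
  have h1 : 0 - 0 <= V y - V 0.
    apply: (@le_increment _ (fun=> 0) (fun=> 0) V S) => // z /andP[z1 z2].
    by apply: Sp; rewrite !ltW// (lt_le_trans z2).
  have h2 : 0 - 0 <= V x0 - V y.
    apply: (@le_increment _ (fun=> 0) (fun=> 0) V S) => // z /andP[z1 z2].
    by apply: Sp; rewrite !ltW// (le_lt_trans y0).
  by rewrite V00 in h1; rewrite /V0; lra.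
(* Zero at both ends and nonpositive in between, which keeps the arc inside the dual circle. *)
pose W x := V (x - x0) - V0.
have Wb x : 0 <= x <= 2 * x0 -> 0 <= V (x - x0) /\ W x <= 0.
  move=> hx; rewrite /W subr_le0; apply/andP.
  have [h|h] := leP 0 (x - x0); first by apply: Vle; lra.
  by rewrite -(VN (x - x0)).1; apply: Vle; lra.
have rV0 : rho * V0 < c.
  have hx0 : 0 <= x0 <= x0 by rewrite lexx ltW.
  have /andP[V0p _] := Vle x0 hx0.
  have : V0 * (1 + (1 + al * V0)) = S x0 ^+ 2 by rewrite S2 -/V0 /al; ring.
  rewrite C0E S0E => h.
  have h' : rho * V0 * (rho + c) = s ^+ 2.
    transitivity (rho ^+ 2 * (V0 * (1 + c / rho))); first by field.
    by rewrite h; field.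
  rewrite -(ltr_pM2r (_ : 0 < rho + c)); last by rewrite addr_gt0.
  rewrite h'; have := mulr_gt0 c0 r0; rewrite mulrDr -expr2 c2; lra.
(* The displacements along (rho, k c, 0) and [e] are orthogonal to the pole, so the curve stays on
   the circle. *)
pose gam x := pt o a e (c + rho * W x) (k * s ^+ 2 / rho + k * c * W x) (S (x - x0)).
pose dgam x := pt o a e (rho * S (x - x0)) (k * c * S (x - x0)) (1 + al * V (x - x0)).
have dVs x : has_deriv (fun y => V (y - x0)) x (S (x - x0)).
  apply: has_deriv_eq; first by apply: der_comp; [exact: dV|apply: derD; [exact: derI|exact: derC]].
  by rewrite /=; ring.
have dSs x : has_deriv (fun y => S (y - x0)) x (1 + al * V (x - x0)).
  apply: has_deriv_eq; first by apply: der_comp; [exact: dS|apply: derD; [exact: derI|exact: derC]].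
  by rewrite /= /al; ring.
have coordE (f g h : R -> R) j : (fun x => pt o a e (f x) (g x) (h x) ord0 j) =
    (fun x => f x * o ord0 j + g x * a ord0 j + h x * e ord0 j).
  by apply/funext => x; rewrite !mxE.
have der3 (f g h : R -> R) (f' g' h' x : R) j : has_deriv f x f' -> has_deriv g x g' -> has_deriv h x h' ->
    is_derive x 1 (fun x => pt o a e (f x) (g x) (h x) ord0 j) (pt o a e f' g' h' ord0 j).
  move=> df dg dh; rewrite coordE; apply: has_deriv_eq.
    by apply: derD; [apply: derD|]; (apply: derM; [eassumption|exact: derC]).
  by rewrite !mxE /=; ring.
have der_aff (u v x : R) (f : R -> R) (f' : R) : has_deriv f x f' -> has_deriv (fun y => u + v * f y) x (v * f').
  move=> hf; apply: has_deriv_eq.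
    by apply: derD; [exact: derC|apply: derM; [exact: derC|exact: hf]].
  by rewrite mulr0; ring.
have der_W x : has_deriv W x (S (x - x0)).
  by apply: has_deriv_eq; [apply: derD; [exact: dVs|exact: derC]|rewrite addr0].
have der_lin (v : R) (f : R -> R) (x' f' : R) : has_deriv f x' f' -> has_deriv (fun y => v * f y) x' (v * f').
  move=> hf; apply: has_deriv_eq; first by apply: derM; [exact: derC|exact: hf].
  by rewrite mulr0 addr0.
pose ddgam (j : 'I_3) (x : R) : R := pt o a e (rho * (1 + al * V (x - x0)))
  (k * c * (1 + al * V (x - x0))) (al * S (x - x0)) ord0 j.
have der_dgam (j : 'I_3) (x : R) : is_derive x 1 (fun x => dgam x ord0 j : R) (ddgam j x).
  exact: (der3 (fun x => rho * S (x - x0)) (fun x => k * c * S (x - x0))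
    (fun x => 1 + al * V (x - x0)) _ _ _ x j (der_lin rho (fun y => S (y - x0)) x _ (dSs x))
    (der_lin (k * c) (fun y => S (y - x0)) x _ (dSs x)) (der_aff 1 al x (fun y => V (y - x0)) _ (dVs x))).
exists (2 * x0); split; first by rewrite mulr_gt0.
exists gam, dgam; split.
- rewrite et0 et1 /gam /W !sub0r (VN x0).1 (VN x0).2 -/V0 subrr !mulr0 !addr0 S0E.
  split=> //; have -> : 2 * x0 - x0 = x0 by ring.
  by rewrite -/V0 subrr !mulr0 !addr0 S0E.
- move=> x hx; have [Vp Wn] := Wb x hx.
  have X0p : 0 < c + rho * W x.
    have : rho * (V (x - x0)) >= 0 by rewrite mulr_ge0// ltW.
    by rewrite /W; lra.
  split.
  + apply/(hyp_pt fr); split => //.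
    have SE : S (x - x0) ^+ 2 = (s / rho) ^+ 2 + 2 * W x * (c / rho) + al * W x ^+ 2.
      by rewrite -S0E -C0E !S2 -/V0 /W /al; ring.
    by rewrite SE; exact: (arc_on_hyp (W x) c2 r2 rn (divfK rn _) (divfK rn _) (divfK rn _)).
  + apply/on_gcircleE => //; rewrite en (nf_curv nf) (mink_pt fr).
    transitivity (k * c ^+ 2 - k * s ^+ 2); first by field.
    by rewrite c2; ring.
  + apply/nf_in_dual; rewrite (mink_pto fr) gerDl.
    by rewrite pmulr_rle0.
- move=> x j _; exact: (der3 (fun x => c + rho * W x) (fun x => k * s ^+ 2 / rho + k * c * W x)
    (fun x => S (x - x0)) _ _ _ x j (der_aff _ _ x W _ (der_W x))
    (der_aff _ _ x W _ (der_W x)) (dSs x)).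
- move=> j; exact: (@der_within_continuous R (fun x => dgam x ord0 j : R) (ddgam j) 0 (2 * x0)
    (fun x _ => der_dgam j x)).
- move=> x _; rewrite (mink_pt fr); have := S2 (x - x0) => h.
  transitivity ((rho ^+ 2 - k ^+ 2 * c ^+ 2) * S (x - x0) ^+ 2 - (1 + al * V (x - x0)) ^+ 2); first by ring.
  by rewrite rk h /al; ring.
Qed.

End Sides.

(** * Packings *)

Section Corners.
Variables (g n : nat) (D : decomposition g n) (f : face D).
Local Notation d0 := (side0 f).
Local Notation nx := (@Defs.next _ _ D).

Lemma left_side_iter i : left_side (iter i nx d0) = inl f.
Proof.
apply/eqP; rewrite -(side0P f) eq_sym (left_sideP d0).
exact: fconnect_iter.
Qed.

Lemma left_side_fconnect d : (left_side d == inl f) = fconnect nx d0 d.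
Proof. by rewrite -left_sideP side0P eq_sym. Qed.

Lemma order_side0 : order nx d0 = #|face_verts f|.
Proof.
rewrite /face_verts card_in_imset; last first.
  move=> d d'; rewrite !inE => /eqP h /eqP h'; exact: (face_embedded h h').
by apply: eq_card => d; rewrite !inE left_side_fconnect.
Qed.

Lemma face_verts_ge3 : (3 <= #|face_verts f|)%N.
Proof.
rewrite /face_verts card_in_imset; first exact: face_sides.
move=> d d'; rewrite !inE => /eqP h /eqP h'; exact: (face_embedded h h').
Qed.

Lemma corner_inj : injective (@corner g n D f).
Proof.
move=> i j e; apply/val_inj => /=.
have := face_embedded (left_side_iter i) (left_side_iter j) e => /(congr1 (findex nx d0)).
by rewrite !findex_iter ?order_side0.
Qed.

Lemma face_verts_corner : face_verts f = [set corner i | i : 'I_#|face_verts f|]%SET.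
Proof.
apply/finset.setP => v; apply/finset.imsetP/finset.imsetP => -[].
  move=> d; rewrite inE left_side_fconnect => hd ->.
  have lt : (findex nx d0 d < #|face_verts f|)%N by rewrite -order_side0 findex_max.
  by exists (Ordinal lt) => //; rewrite /corner /= iter_findex.
move=> i _ ->; exists (iter i nx d0) => //.
by rewrite inE left_side_iter.
Qed.

Lemma corner_face i : @corner g n D f i \in face_verts f.
Proof. by rewrite face_verts_corner; apply/finset.imsetP; exists i. Qed.

Lemma face_corner v : v \in face_verts f -> exists i, v = @corner g n D f i.
Proof.
move=> vf; have : v \in [set @corner g n D f i | i : 'I_#|face_verts f|]%SET.
  by rewrite -face_verts_corner.
by move=> /finset.imsetP[i _ ->]; exists i.
Qed.

Lemma sum_corner (R : nmodType) (G : vert D -> R) :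
  \sum_(w in face_verts f) G w = \sum_i G (@corner g n D f i).
Proof.
transitivity (\sum_(w in [set @corner g n D f i | i : 'I_#|face_verts f|]%SET) G w).
  by rewrite -face_verts_corner.
rewrite big_imset//= => i j _ _; exact: corner_inj.
Qed.

End Corners.

(** * From geometric packings to the function [total] *)

Section Packings.
Variables (R : realType) (g n : nat) (D : decomposition g n).
Local Notation fv := (@face_verts g n D).
Let fv3 : forall f, (3 <= #|fv f|)%N := @face_verts_ge3 g n D.

Lemma half_angle_sum f (k : vert D -> R) (s : R) :
  \sum_(i : 'I_#|fv f|) half_angle (fun i => k (corner i)) s i =
    pi + (angle_target R fv f - angle_sum fv f k s).
Proof.
rewrite /half_angle sumrB -(sum_corner f (fun w => atan (k w * s))) addrA; congr (_ - _).
rewrite sumr_const card_ord /angle_target natrB; last by rewrite ltnW// fv3.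
by rewrite -[LHS]mulr_natl; field.
Qed.

(** The sinh of the dual radius of [K] solves the angle equation, whose root is unique. *)
Lemma face_normal_form f (k : vert D -> R) (K : configuration R #|fv f|) :
  curvatures k -> is_configuration K ->
  (forall i, curvature (circ K i) = k (corner i)) ->
  exists o e1 e2, normal_form K (fun i => k (corner i)) o e1 e2 (dual fv f k).
Proof.
move=> k0 isK hk; have [p [e1 [e2]]] := configuration_normal_form isK.
have -> : (fun i => curvature (circ K i)) = (fun i => k (corner i)) by apply/funext.
move=> nf; exists p, e1, e2.
suff <- : sinh (dual_radius K) = dual fv f k by [].
apply: dual_uniq => //; have := half_angle_sum f k (sinh (dual_radius K)).
by rewrite (nf_sum nf) => h; lra.
Qed.

Lemma packing_normal_form (P : packing R D) f : curvatures (pcurv P) ->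
  exists o e1 e2, normal_form (pconf P f) (fun i => pcurv P (corner i)) o e1 e2
    (dual fv f (pcurv P)).
Proof.
by move=> k0; apply: face_normal_form => //; [exact: pconfP|move=> i; exact: pcurvP].
Qed.

Lemma packing_total (P : packing R D) v t : curvatures (pcurv P) ->
  packing_total_curv P v t -> t = total fv (pcurv P) v.
Proof.
move=> k0 [ell [hell ->]]; rewrite /total [RHS]big_mkcond /=; apply: eq_bigr => f _.
have [p [e1 [e2 nf]]] := packing_normal_form f k0.
case: ifPn => vf.
  have [i0 e0] := face_corner vf.
  rewrite (big_pred1 i0) => [|i]; last by rewrite e0 (inj_eq (@corner_inj _ _ _ _)).
  by rewrite e0; exact: (nf_side_curv nf (hell f i0)).
rewrite big_pred0// => i; apply/negbTE/negP => /eqP e; move: vf.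
by rewrite -e corner_face.
Qed.

Lemma packing_exists (k : vert D -> R) : curvatures k -> exists P : packing R D,
  pcurv P = k /\ forall v, packing_total_curv P v (total fv k v).
Proof.
move=> k0; have [p [e1 [e2 fr]]] := std_frame R.
have h f : exists K : configuration R #|fv f|,
    is_configuration K /\ forall i, curvature (circ K i) = k (corner i).
  have [d0 de] := dualP fv3 f k0.
  have sd : \sum_(i : 'I_#|fv f|) half_angle (fun i => k (corner i)) (dual fv f k) i = pi.
    by rewrite half_angle_sum de; ring.
  have [K nf] := normal_form_exists fr d0 (fun i => k0 (corner i)) sd (fv3 f).
  by exists K; split; [exact: nf_is_configuration nf|move=> i; exact: nf_curv nf i].
pose P := @Packing R g n D k (fun f => sval (cid (h f)))
  (fun f => (svalP (cid (h f))).1) (fun f => (svalP (cid (h f))).2).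
exists P; split=> // v.
have hs f i : exists ell, side_length (pconf P f) i ell.
  have [p' [e1' [e2' nf]]] := packing_normal_form (P := P) f k0.
  exact: nf_side_exists nf i.
have pt : packing_total_curv P v
    (\sum_(f : face D) \sum_(i | corner i == v) pcurv P v * sval (cid (hs f i))).
  by exists (fun f i => sval (cid (hs f i))); split=> // f i; exact: svalP.
by rewrite -[k]/(pcurv P) -(packing_total (P := P) k0 pt).
Qed.

(** The bridge between the two halves of the proof: arcs and configurations are replaced by a
    function of the curvatures. *)
Lemma total_curvE (k : vert D -> R) v t : curvatures k ->
  total_curv k v t <-> t = total fv k v.
Proof.
move=> k0; split=> [[P [/funext ePk h]]|->].
  by rewrite -ePk in k0 *; exact: packing_total.
by have [P [eP h]] := packing_exists k0; exists P; rewrite eP; split.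
Qed.

Lemma packing_isometric (P P' : packing R D) : curvatures (pcurv P) ->
  pcurv P = pcurv P' -> isometric_packing P P'.
Proof.
move=> k0 e f; have [p [e1 [e2 nf]]] := packing_normal_form f k0.
have k0' : curvatures (pcurv P') by rewrite -e.
have [p' [e1' [e2' nf']]] := packing_normal_form f k0'.
by rewrite -e in nf'; exact: normal_form_isometric nf nf'.
Qed.

End Packings.

Theorem theorem1p3 (R : realType) (g n : nat) (n_ge1 : (1 <= n)%N)
    (D : decomposition g n) (khat That : vert D -> R)
    (khat_gt0 : forall w, w \in bdry_verts D -> 0 < khat w)
    (That_gt0 : forall v, v \in int_verts D -> 0 < That v)
    (That_lt : forall Q : {set vert D}, Q != finset.set0 -> Q \subset int_verts D ->
      \sum_(v in Q) That v <
      \sum_(f in faces_at Q)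
        pi * (minn #|face_verts f :&: Q| (#|face_verts f| - 2))%:R) :
  (* each step of the algorithm is well defined *)
  (forall (k : vert D -> R) (v : vert D), admissible khat k -> v \in int_verts D ->
     exists! t : R, 0 < t /\ total_curv (update k v t) v (That v)) /\
  exists Pstar : packing R D,
    [/\ realizes khat That Pstar,
        forall P : packing R D, realizes khat That P ->
          pcurv P =1 pcurv Pstar /\ isometric_packing P Pstar &
        forall k : nat -> vert D -> R, thurston_sequence khat That k ->
          (forall v, (fun m => k m v) @ \oo --> pcurv Pstar v) /\
          (exists P : nat -> packing R D, forall m, pcurv (P m) =1 k m) /\
          (forall P : nat -> packing R D, (forall m, pcurv (P m) =1 k m) ->
             packing_cvg P Pstar)].
Proof.
pose I := int_verts D; pose fv := @face_verts g n D.
have fv3 : forall f, (3 <= #|fv f|)%N := @face_verts_ge3 g n D.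
have notI w : (w \notin I) = (w \in bdry_verts D).
  by rewrite /I /int_verts finset.in_setC negbK.
have khat0 w : w \notin I -> 0 < khat w by rewrite notI; exact: khat_gt0.
have Tlt (Q : {set vert D}) : Q != finset.set0 -> Q \subset I ->
    \sum_(v in Q) That v < \sum_(f | fv f :&: Q != finset.set0)
      pi * (minn #|fv f :&: Q| (#|fv f| - 2))%:R.
  move=> Q0 QI; rewrite (lt_le_trans (That_lt Q Q0 QI))// le_eqVlt.
  by apply/orP; left; apply/eqP/eq_bigl => f; rewrite inE.
have face_of := interior_face That_gt0 Tlt.
have tcE k v t : curvatures k -> total_curv k v t <-> t = total fv k v.
  exact: total_curvE.
split.
  move=> k v [k0 kb] vI.
  have [t t0 et] := solve_exists fv3 That_gt0 Tlt k0 vI.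
  exists t; split.
    by split=> //; apply/tcE; [exact: curvatures_replace|rewrite -et].
  move=> u [u0 /tcE eu]; apply: (solve_unique fv3 That_gt0 Tlt k0 vI) => //.
  by rewrite et -eu//; exact: curvatures_replace.
have [ks sol] := solution_exists fv3 khat0 That_gt0 Tlt.
have [ks0 ksb kst] := sol.
have [Ps [ePs hPs]] := packing_exists ks0.
exists Ps; split.
- split=> [w wb|v vI]; first by rewrite ePs ksb// notI.
  by rewrite -kst//; exact: hPs.
- move=> P [Pb Pt].
  (* An interior vertex lies on a face, so its curvature is that of an actual generalized circle,
     hence positive; boundary values are prescribed. *)
  have P0 : curvatures (pcurv P).
    move=> v; have [vI|] := boolP (v \in I); last by rewrite notI => vb; rewrite Pb// khat_gt0.
    have [f /face_corner[i ->]] := face_of v vI.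
    rewrite -pcurvP; apply: curvature_gt0.
    by case: (pconfP P f) => -[_ wf _] _ _ _ _; exact: wf.
  have solP : solution fv I khat That (pcurv P).
    split=> // [w|v vI]; first by rewrite notI; exact: Pb.
    by apply/esym/packing_total => //; exact: Pt.
  have e : pcurv P = pcurv Ps.
    rewrite ePs; apply/funext => v; apply/eqP; rewrite eq_le.
    by rewrite !(solution_le fv3 khat0 That_gt0 Tlt).
  by split; [rewrite e|exact: packing_isometric].
- move=> k [[k00 kb0] adm stp].
  have km0 m : curvatures (k m) by case: m => [|m]; [|case: (adm m)].
  have orb : orbit fv I That k.
    split=> // m; split=> // [v|v vI].
      by rewrite notI => vb; rewrite (adm m).2//; case: m => [|m]; rewrite ?kb0// (adm m).2.
    have /tcE h := stp m v vI.
    by apply/esym/h/curvatures_replace => //; exact: (adm m).1.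
  have cv v : (fun m => k m v) @ \oo --> pcurv Ps v.
    rewrite ePs; apply: (solution_orbit_cvg fv3 khat0 That_gt0 Tlt sol orb).
    by move=> w; rewrite notI; exact: kb0.
  split=> //; split.
    have hP m : exists P : packing R D, pcurv P = k m.
      by have [P [eP _]] := packing_exists (km0 m); exists P.
    by exists (fun m => sval (cid (hP m))) => m v; rewrite (svalP (cid (hP m))).
  by move=> P eP v; under eq_fun do rewrite eP; exact: cv.
Qed.
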